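(* Let $(\mathfrak b,H,\widehat\beta,\alpha,\beta,V)$ be a $C^*$-pseudo-multiplicative unitary that is semi-regular, i.e. $[\langle\alpha|_1V|\alpha\rangle_2]\supseteq[\alpha\alpha^*]$. Then $\big((\widehat A_V)_H^{\alpha,\widehat\beta},\widehat\Delta_V\big)$ and $\big((A_V)_H^{\beta,\alpha},\Delta_V\big)$ are normal Hopf $C^*$-bimodules (over $\mathfrak b^\dagger$ and $\mathfrak b$, respectively).
   Context: General notions. $[Y]$ denotes the closed linear span of $Y$; products of sets of operators are elementwise; $X'$ is the commutant. A $C^*$-base is a triple $\mathfrak b=(\mathfrak K,\mathfrak B,\mathfrak B^\dagger)$ of a Hilbert space and two commuting nondegenerate $C^*$-algebras $\mathfrak B,\mathfrak B^\dagger\subseteq\mathcal L(\mathfrak K)$; $\mathfrak b^\dagger=(\mathfrak K,\mathfrak B^\dagger,\mathfrak B)$. A $C^*$-$\mathfrak b$-module $H_\alpha=(H,\alpha)$ is a Hilbert space $H$ with a closed subspace $\alpha\subseteq\mathcal L(\mathfrak K,H)$ such that $[\alpha\mathfrak K]=H$, $[\alpha\mathfrak B]=\alpha$, $[\alpha^*\alpha]=\mathfrak B$; it carries the representation $\rho_\alpha\colon\mathfrak B^\dagger\to\mathcal L(H)$, $\rho_\alpha(b^\dagger)\xi\zeta=\xi b^\dagger\zeta$. For $C^*$-$\mathfrak b^\dagger$-modules the roles of $\mathfrak B,\mathfrak B^\dagger$ are swapped. A semi-morphism $H_\alpha\to K_\beta$ is $T\in\mathcal L(H,K)$ with $T\alpha\subseteq\beta$;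 a morphism additionally satisfies $T^*\beta\subseteq\alpha$. A $C^*$-$(\mathfrak b_1,\dots,\mathfrak b_n)$-module is $(H,\alpha_1,\dots,\alpha_n)$ with each $(H,\alpha_i)$ a $C^*$-$\mathfrak b_i$-module and $[\rho_{\alpha_i}(\mathfrak B_i^\dagger)\alpha_j]=\alpha_j$ for $i\neq j$; (semi-)morphisms are operators that are (semi-)morphisms for every component. Relative tensor product. For a $C^*$-$\mathfrak b$-module $H_\beta$ and a $C^*$-$\mathfrak b^\dagger$-module $K_\gamma$, $H\,{}_\beta\otimes_\gamma K$ (base suppressed; same definition with $\mathfrak b,\mathfrak b^\dagger$ interchanged) is the Hilbert space generated by elements $\xi\otimes\zeta\otimes\eta$ ($\xi\in\beta,\zeta\in\mathfrak K,\eta\in\gamma$) with $\langle\xi\otimes\zeta\otimes\eta|\xi'\otimes\zeta'\otimes\eta'\rangle=\langle\zeta|\xi^*\xi'\eta^*\eta'\zeta'\rangle$. $|\xi\rangle_1\colon K\to H\,{}_\beta\otimes_\gamma K$, $|\eta\rangle_2\colon H\to H\,{}_\beta\otimes_\gamma K$ are given by $|\xi\rangle_1\eta\zeta=\xi\otimes\zeta\otimes\eta=|\eta\rangle_2\xi\zeta$, with adjoints $\langle\xi|_1,\langle\eta|_2$; $|\beta\rangle_1=\{|\xi\rangle_1:\xi\in\beta\}$ etc. For further module structures $\alpha$ on $H$, $\delta$ on $K$: $\alpha\triangleleft\gamma=[|\gamma\rangle_2\alpha]$, $\beta\triangleright\delta=[|\beta\rangle_1\delta]$, module structures on $H\,{}_\beta\otimes_\gamma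 K$. $S\otimes\mathrm{id}$, $\mathrm{id}\otimes T$ are determined by $(S\otimes\mathrm{id})|\eta\rangle_2=|\eta\rangle_2S$, $(\mathrm{id}\otimes T)|\xi\rangle_1=|\xi\rangle_1T$ for $S,T$ intertwining the representations $\rho_\beta$ resp. $\rho_\gamma$; for semi-morphisms $S,T$, $(S\otimes T)(\xi\otimes\zeta\otimes\eta)=S\xi\otimes\zeta\otimes T\eta$. Iterated products are identified by associativity; $\Sigma$ is the flip. $C^*$-pseudo-multiplicative unitary: a tuple $(\mathfrak b,H,\widehat\beta,\alpha,\beta,V)$ with $\mathfrak b$ a $C^*$-base, $(H,\widehat\beta,\alpha,\beta)$ a $C^*$-$(\mathfrak b^\dagger,\mathfrak b,\mathfrak b^\dagger)$-module and $V\colon H\,{}_{\widehat\beta}\otimes_\alpha H\to H\,{}_\alpha\otimes_\beta H$ a unitary with $V(\alpha\triangleleft\alpha)=\alpha\triangleright\alpha$, $V(\widehat\beta\triangleright\beta)=\widehat\beta\triangleleft\beta$, $V(\widehat\beta\triangleright\widehat\beta)=\alpha\triangleright\widehat\beta$, $V(\beta\triangleleft\alpha)=\beta\triangleleft\beta$ and $V_{23}V_{12}=V_{12}V_{13}V_{23}$ as operators $H\,{}_{\widehat\beta}\otimes_\alpha H\,{}_{\widehat\beta}\otimes_\alpha H\to H\,{}_\alpha\otimes_\beta H\,{}_\alpha\otimes_\beta H$, where $V_{12}=V\otimes\mathrm{id}$, $V_{23}=\mathrm{id}\otimes V$, and $V_{13}\colon H\,{}_{\widehat\beta}\otimes_{\alpha\triangleright\alpha}(H\,{}_\alpha\otimes_\beta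 H)\to(H\,{}_{\widehat\beta}\otimes_\alpha H)\,{}_{\alpha\triangleleft\alpha}\otimes_\beta H$ is $\Sigma_{23}(V\otimes\mathrm{id})(\mathrm{id}\otimes\Sigma)$ with $\Sigma_{23}$ exchanging the last two factors (from $(H\,{}_\alpha\otimes_\beta H)\,{}_{\widehat\beta\triangleleft\beta}\otimes_\alpha H$). $\widehat A_V=[\langle\beta|_2V|\alpha\rangle_2]$, $A_V=[\langle\alpha|_1V|\widehat\beta\rangle_1]\subseteq\mathcal L(H)$; $\widehat\Delta_V(y)=V^*(\mathrm{id}\otimes y)V$ ($y\in\rho_\beta(\mathfrak B)'$), $\Delta_V(z)=V(z\otimes\mathrm{id})V^*$ ($z\in\rho_{\widehat\beta}(\mathfrak B)'$), restricted to $\widehat A_V$, $A_V$. Hopf $C^*$-bimodules. A $C^*$-$(\mathfrak b_1,\mathfrak b_2)$-algebra $A_H^{\alpha_1,\alpha_2}$ is a $C^*$-$(\mathfrak b_1,\mathfrak b_2)$-module $(H,\alpha_1,\alpha_2)$ with a $C^*$-algebra $A\subseteq\mathcal L(H)$ such that $\rho_{\alpha_i}(\mathfrak B_i^\dagger)A\subseteq A$. A $*$-homomorphism $\pi\colon A\to C$ is a jointly normal (jointly semi-normal) morphism $A_H^{\alpha_1,\alpha_2}\to C_K^{\gamma_1,\gamma_2}$ if $[\mathcal L^\pi\alpha_i]=\gamma_i$ (resp. $[\mathcal L_s^\pi\alpha_i]=\gamma_i$) for $i=1,2$, where $\mathcal L^\pi$ (resp. $\mathcal L^\pi_s$) is the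 set of morphisms (resp. semi-morphisms) $T\colon(H,\alpha_1,\alpha_2)\to(K,\gamma_1,\gamma_2)$ with $Ta=\pi(a)T$ for all $a\in A$. The fiber product of $A$ on $H_\beta$ and $B$ on $K_\gamma$ is $A\,{}_\beta*_\gamma B=\{x\in\mathcal L(H\,{}_\beta\otimes_\gamma K):x|\beta\rangle_1,x^*|\beta\rangle_1\subseteq[|\beta\rangle_1B],\ x|\gamma\rangle_2,x^*|\gamma\rangle_2\subseteq[|\gamma\rangle_2A]\}$. For jointly semi-normal $\phi,\psi$, the $*$-homomorphism $\phi*\psi$ between fiber products is determined by $(\phi*\psi)(x)(S\otimes T)=(S\otimes T)x$ for all $S\in\mathcal L^\phi_s$, $T\in\mathcal L^\psi_s$. A normal Hopf $C^*$-bimodule over $\mathfrak b$ is a $C^*$-$(\mathfrak b^\dagger,\mathfrak b)$-algebra $A_H^{\beta,\alpha}$ with a jointly normal morphism $\Delta$ to $(A\,{}_\alpha*_\beta A)^{\beta\triangleleft\beta,\alpha\triangleright\alpha}_{H\,{}_\alpha\otimes_\beta H}$ such that $(\Delta*\mathrm{id})\Delta=(\mathrm{id}*\Delta)\Delta$ as maps to $\mathcal L(H\,{}_\alpha\otimes_\beta H\,{}_\alpha\otimes_\beta H)$. (Over $\mathfrak b^\dagger$: a $C^*$-$(\mathfrak b,\mathfrak b^\dagger)$-algebra $A_H^{\alpha,\widehat\beta}$ and $\Delta\colon A\to A\,{}_{\widehat\beta}*_\alpha A$ with module structures $\alpha\triangleleft\alpha$, $\widehat\beta\triangleright\widehat\beta$.)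 *)

(* Defs.v *)
From HB Require Import structures.
From mathcomp Require Import all_boot all_order all_algebra complex.
From mathcomp Require Import boolp classical_sets functions reals topology.
From mathcomp Require Import normedtype sequences.
From mathcomp Require Import ring.
Set Implicit Arguments.
Unset Strict Implicit.
Unset Printing Implicit Defensive.
Import Order.TTheory GRing.Theory Num.Theory.
Import numFieldNormedType.Exports.
Local Open Scope classical_set_scope.
Local Open Scope ring_scope.

(* Inner products are linear in the second variable. *)
HB.mixin Record isHilbert (R : realType) H & CompleteNormedModule R[i] H := {
  hdot : H -> H -> R[i];
  hdotDr : forall x y z, hdot x (y + z) = hdot x y + hdot x z;
  hdotZr : forall (a : R[i]) x y, hdot x (a *: y) = a * hdot x y;
  hdotC : forall x y, hdot y x = (hdot x y)^*;
  hnormE : forall x : H, `|x| ^+ 2 = hdot x x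
}.

#[short(type="hilbertType")]
HB.structure Definition Hilbert (R : realType) :=
  {H of CompleteNormedModule R[i] H & isHilbert R H}.

Lemma quad_bound (C : numClosedFieldType) (m w n : C) : 0 <= m -> 0 <= n ->
  (forall a, 0 <= m + a * w + (a * w)^* + `|a| ^+ 2 * n) -> `|w| ^+ 2 <= m * n.
Proof.
move=> m0 n0 h; have [nz|nn0] := eqVneq n 0; last first.
  have np : 0 < n by rewrite lt_def nn0 n0.
  have cn : n^-1^* = n^-1 by rewrite geC0_conj // invr_ge0.
  have := h (- w^* / n).
  rewrite !rmorphM rmorphN /= conjCK cn.
  rewrite normrM normrN norm_conjC normfV (ger0_norm n0) exprMn exprVn.
  have -> : - w^* / n * w = - (`|w| ^+ 2 / n).
    by rewrite normCK [w * _]mulrC !mulNr mulrAC.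
  have -> : - w / n * w^* = - (`|w| ^+ 2 / n).
    by rewrite normCK !mulNr mulrAC.
  have -> : `|w| ^+ 2 / n ^+ 2 * n = `|w| ^+ 2 / n.
    by rewrite expr2 invfM !mulrA divfK.
  by rewrite subrK subr_ge0 ler_pdivrMr.
rewrite nz mulr0; have [->|wn] := eqVneq w 0; first by rewrite normr0 expr0n.
have w2 : 0 < `|w| ^+ 2 by rewrite exprn_gt0 // normr_gt0.
pose t := (m + 1) / `|w| ^+ 2.
have := h (- t * w^*); rewrite nz mulr0 addr0.
have -> : - t * w^* * w = - (m + 1).
  by rewrite -mulrA [w^* * w]mulrC -normCK mulNr /t divfK // gt_eqF.
rewrite rmorphN rmorphD /= rmorph1 (geC0_conj m0).
have -> : m - (m + 1) - (m + 1) = - (1 + (m + 1)) + m - m by ring.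
rewrite addrK oppr_ge0 => h'.
have : 0 < 1 + (m + 1) by rewrite ltr_wpDr ?addr_ge0 ?ler01.
by move=> /lt_le_trans /(_ h'); rewrite ltxx.
Qed.

Section SemiInner.
Variables (C : numClosedFieldType) (V : Type).
Variables (add : V -> V -> V) (scl : C -> V -> V) (F : V -> V -> C).
Hypothesis FD : forall x y z, F x (add y z) = F x y + F x z.
Hypothesis FZ : forall a x y, F x (scl a y) = a * F x y.
Hypothesis FC : forall x y, F y x = (F x y)^*.
Hypothesis F0 : forall x, 0 <= F x x.

Definition semi_nrm x := sqrtC (F x x).

Lemma semi_Dl x y z : F (add x y) z = F x z + F y z.
Proof. by rewrite FC FD rmorphD /= -!FC. Qed.

Lemma semi_Zl a x y : F (scl a x) y = a^* * F x y.
Proof. by rewrite FC FZ rmorphM /= -FC. Qed.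

Lemma semi_nrm_ge0 x : 0 <= semi_nrm x.
Proof. by rewrite sqrtC_ge0. Qed.

Lemma semi_nrmK x : semi_nrm x ^+ 2 = F x x.
Proof. exact: sqrtCK. Qed.

Lemma semi_quad a x y : 0 <= F x x + a * F x y + (a * F x y)^* + `|a| ^+ 2 * F y y.
Proof.
have := F0 (add x (scl a y)).
rewrite FD !semi_Dl FZ !semi_Zl FZ (FC x y) rmorphM normCK -!mulrA.
by rewrite [a^* * (a * _)]mulrCA !addrA [_ + a^* * _ + _]addrAC.
Qed.

Lemma semi_CS2 x y : `|F x y| ^+ 2 <= F x x * F y y.
Proof. by apply: quad_bound => // a; exact: semi_quad. Qed.

Lemma semi_CS x y : `|F x y| <= semi_nrm x * semi_nrm y.
Proof.
rewrite -(@ler_pXn2r _ 2) ?nnegrE ?mulr_ge0 ?semi_nrm_ge0 //.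
by rewrite exprMn !semi_nrmK semi_CS2.
Qed.

Lemma semi_nrmD x y : semi_nrm (add x y) <= semi_nrm x + semi_nrm y.
Proof.
rewrite -(@ler_pXn2r _ 2) ?nnegrE ?addr_ge0 ?semi_nrm_ge0 //.
rewrite semi_nrmK FD !semi_Dl sqrrD !semi_nrmK -addrA [in leRHS]addrAC -addrA.
rewrite lerD2l [in leRHS]addrC addrA lerD2r [F y x]FC addrC.
rewrite -mulr_natl.
have -> : F x y + (F x y)^* = 2%:R * 'Re (F x y).
  by rewrite ReE mulrC divfK // pnatr_eq0.
rewrite ler_pM2l ?ltr0n //; apply: le_trans (semi_CS x y).
by case: (leif_Re_Creal (F x y)).
Qed.

Lemma semi_nrmZ a x : semi_nrm (scl a x) = `|a| * semi_nrm x.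
Proof.
apply/eqP; rewrite -(@eqrXn2 _ 2) ?mulr_ge0 ?semi_nrm_ge0 //.
by rewrite exprMn !semi_nrmK FZ semi_Zl normCK mulrA.
Qed.

Definition semi_sub x y := add x (scl (-1) y).

Lemma semi_subr v x y : F v (semi_sub x y) = F v x - F v y.
Proof. by rewrite FD FZ mulN1r. Qed.

Lemma semi_subl v x y : F (semi_sub x y) v = F x v - F y v.
Proof. by rewrite semi_Dl semi_Zl rmorphN rmorph1 mulN1r. Qed.

Definition semi_dist x y := semi_nrm (semi_sub x y).

Lemma semi_distC x y : semi_dist x y = semi_dist y x.
Proof.
congr sqrtC; rewrite !semi_subr !semi_subl.
ring.
Qed.

Lemma semi_dist_triangle z x y : semi_dist x y <= semi_dist x z + semi_dist z y.
Proof.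
apply: le_trans (semi_nrmD _ _).
rewrite le_eqVlt; apply/orP; left; apply/eqP; congr sqrtC.
by rewrite !(semi_subr, semi_subl, FD, semi_Dl); ring.
Qed.

End SemiInner.

Section Clim.
Variable C : numClosedFieldType.
Implicit Types (u v : nat -> C).

Definition clim u (l : C) := forall e, 0 < e ->
  exists N, forall n, (N <= n)%N -> `|u n - l| < e.

Lemma clim_cst l : clim (fun=> l) l.
Proof. by move=> e e0; exists 0%N => n _; rewrite subrr normr0. Qed.

Lemma clim_uniq u l l' : clim u l -> clim u l' -> l = l'.
Proof.
move=> hl hl'; apply/eqP; rewrite -subr_eq0 -normr_eq0; apply: contraT => n0.
have n1 : 0 < `|l - l'| by rewrite lt_def n0 normr_ge0.
have e0 : 0 < `|l - l'| / 2 by rewrite divr_gt0 ?ltr0n.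
have [N hN] := hl _ e0; have [N' hN'] := hl' _ e0.
have := ltrD (hN _ (leq_maxl N N')) (hN' _ (leq_maxr N N')).
rewrite -splitr distrC => /(le_lt_trans (ler_distD _ _ _)).
by rewrite ltxx.
Qed.

Lemma climD u v l l' : clim u l -> clim v l' -> clim (fun n => u n + v n) (l + l').
Proof.
move=> hl hl' e e0; have e2 : 0 < e / 2 by rewrite divr_gt0 ?ltr0n.
have [N hN] := hl _ e2; have [N' hN'] := hl' _ e2.
exists (maxn N N') => n; rewrite geq_max => /andP[/hN h /hN' h'].
rewrite opprD addrACA [e]splitr.
exact: le_lt_trans (ler_normD _ _) (ltrD h h').
Qed.

Lemma climZ a u l : clim u l -> clim (fun n => a * u n) (a * l).
Proof.
move=> hl e e0.
have a0 : 0 < `|a| + 1 by rewrite ltr_wpDl ?normr_ge0 ?ltr01.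
have [N hN] := hl _ (divr_gt0 e0 a0).
exists N => n /hN h; rewrite -mulrBr normrM.
apply: le_lt_trans (_ : (`|a| + 1) * `|u n - l| < _).
  by rewrite ler_wpM2r ?normr_ge0 // lerDl ler01.
by rewrite mulrC -ltr_pdivlMr.
Qed.

Lemma climJ u l : clim u l -> clim (fun n => (u n)^*) (l^*).
Proof.
move=> hl e /hl[N hN]; exists N => n /hN.
by rewrite -rmorphB norm_conjC.
Qed.

Lemma clim_le u l N b : b \is Num.real -> clim u l ->
  (forall n, (N <= n)%N -> `|u n| <= b) -> `|l| <= b.
Proof.
move=> br hl hb; rewrite real_leNgt ?normr_real //; apply/negP => lb.
have e0 : 0 < `|l| - b by rewrite subr_gt0.
have [N' hN'] := hl _ e0.
have h := ltr_leD (hN' _ (leq_maxr N N')) (hb _ (leq_maxl N N')).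
rewrite distrC subrK in h.
have := ler_normD (l - u (maxn N N')) (u (maxn N N')).
by rewrite subrK => /le_lt_trans /(_ h); rewrite ltxx.
Qed.

Lemma clim_ge0 u l : clim u l -> (forall n, 0 <= u n) -> 0 <= l.
Proof.
move=> hl u0.
have lr : l \is Num.real.
  apply/CrealP; apply: clim_uniq (climJ hl) _ => e /hl[N hN].
  by exists N => n /hN; rewrite geC0_conj.
rewrite real_leNgt ?rpred0 //; apply/negP => l0.
have e0 : 0 < - l by rewrite oppr_gt0.
have [N /(_ N (leqnn _))] := hl _ e0.
rewrite ger0_norm ?addr_ge0 ?u0 ?(ltW e0) //.
by rewrite gtrDr => /(le_lt_trans (u0 N)); rewrite ltxx.
Qed.

End Clim.

Lemma ccauchy_cvg (R : realType) (u : nat -> R[i]) :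
  (forall e, 0 < e -> exists N, forall m n, (N <= m)%N -> (N <= n)%N ->
     `|u m - u n| < e) -> exists l, clim u l.
Proof.
move=> hu.
have key (p : R[i] -> R) : (forall x, `|p x|%:C%C <= `|x|) ->
    (forall x y, p (x - y) = p x - p y) ->
    exists l, forall e, 0 < e ->
      exists N, forall n, (N <= n)%N -> `|p (u n) - l| < e.
  move=> pn pB.
  have /cauchy_cvg/cvg_ex[l hl] : cauchy ((p \o u) @ \oo).
    apply/cauchy_exP => e e0.
    have [N hN] := hu e%:C%C ltac:(by rewrite ltcR).
    exists (p (u N)); exists N => //= n Nn; rewrite /ball /= -pB.
    by rewrite -ltcR; apply: le_lt_trans (pn _) (hN _ _ (leqnn _) Nn).
  exists l => e e0; move/cvgrPdist_lt: hl => /(_ e e0)[N _ hN].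
  by exists N => n /hN /=; rewrite distrC.
have [a ha] := key (@complex.Re R) (@normc_ge_Re R) ltac:(by move=> [? ?] [? ?]).
have pI (x : R[i]) : `|complex.Im x|%:C%C <= `|x|.
  by rewrite normc_def lecR -sqrtr_sqr ler_wsqrtr // lerDr sqr_ge0.
have [b hb] := key (@complex.Im R) pI ltac:(by move=> [? ?] [? ?]).
exists (Complex a b) => e e0.
have er : (complex.Re e)%:C%C = e by rewrite RRe_real ?gtr0_real.
have e2 : 0 < complex.Re e / 2 by rewrite divr_gt0 ?ltr0n // -ltcR er.
have [N hN] := ha _ e2; have [N' hN'] := hb _ e2.
exists (maxn N N') => n; rewrite geq_max => /andP[/hN h /hN' h'].
have -> : u n - Complex a b = (complex.Re (u n) - a)%:C%C + (complex.Im (u n) - b)%:C%C * 'i%C.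
  by case: (u n) => x y; apply/eqP; rewrite eq_complex /= !(mulr0, mul0r, mulr1, subr0, addr0, add0r, oppr0) !eqxx.
apply: le_lt_trans (ler_normD _ _) _; rewrite normrM.
have -> : `|'i%C : R[i]| = 1 by rewrite normc_def /= expr0n expr1n add0r sqrtr1.
have nr (x : R) : `|x%:C%C| = `|x|%:C%C.
  by rewrite normc_def /= expr0n addr0 sqrtr_sqr.
rewrite mulr1 !nr -rmorphD /= -er ltcR [complex.Re e]splitr.
exact: ltrD h h'.
Qed.

Lemma small_inv (R : realType) (e : R[i]) : 0 < e ->
  exists N, forall n, (N <= n)%N -> n.+1%:R^-1 < e.
Proof.
move=> e0; have er : (complex.Re e)%:C%C = e by rewrite RRe_real ?gtr0_real.
have r0 : 0 < complex.Re e by rewrite -ltcR er.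
exists (Num.truncn (complex.Re e)^-1) => n Nn.
have -> : n.+1%:R^-1 = (n.+1%:R^-1 : R)%:C%C :> R[i] by rewrite fmorphV rmorph_nat.
rewrite -er ltcR invf_plt ?posrE ?ltr0n //.
by apply: lt_le_trans (truncnS_gt _) _; rewrite ler_nat.
Qed.

(* Completion of a semi-inner product F on V: the antilinear functionals on V
   that are pointwise limits of v |-> F v (u n) for u Cauchy.  [add] and [scl]
   only have to be compatible with F, so that V may consist of formal sums. *)
Section Completion.
Variables (R : realType) (V : Type).
Local Notation C := R[i].
Variables (add : V -> V -> V) (scl : C -> V -> V) (F : V -> V -> C) (v0 : V).
Hypothesis FD : forall x y z, F x (add y z) = F x y + F x z.
Hypothesis FZ : forall a x y, F x (scl a y) = a * F x y.
Hypothesis FC : forall x y, F y x = (F x y)^*.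
Hypothesis F0 : forall x, 0 <= F x x.
Local Notation nrm := (semi_nrm F).
Local Notation dist := (semi_dist add scl F).
Local Notation sub := (semi_sub add scl).

Definition vcauchy (u : nat -> V) := forall e, 0 < e ->
  exists N, forall m n, (N <= m)%N -> (N <= n)%N -> dist (u m) (u n) < e.

Definition rep u (f : V -> C) :=
  vcauchy u /\ forall v, clim (fun n => F v (u n)) (f v).

Let nrm0 := semi_nrm_ge0 F0.
Let CS := semi_CS FD FZ FC F0.
Let Fsr := semi_subr FD FZ.
Let Fsl := semi_subl FD FZ FC.
Let Dl := semi_Dl FD FC.
Let Zl := semi_Zl FZ FC.
Let dist0 x y : 0 <= dist x y. Proof. exact: nrm0. Qed.

Lemma vcauchy_bnd u : vcauchy u ->
  exists M N, 0 < M /\ forall n, (N <= n)%N -> nrm (u n) <= M.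
Proof.
move=> /(_ 1 ltr01)[N hN]; exists (1 + nrm (u N)), N; split.
  by rewrite ltr_wpDr ?nrm0 ?ltr01.
move=> n Nn.
have -> : nrm (u n) = nrm (add (sub (u n) (u N)) (u N)).
  by congr sqrtC; rewrite !(FD, Dl, Fsr, Fsl); ring.
apply: le_trans (semi_nrmD FD FZ FC F0 _ _) _.
by rewrite lerD2r ltW // hN.
Qed.

Lemma vcauchy_cst x : vcauchy (fun=> x).
Proof.
move=> e e0; exists 0%N => m n _ _.
by rewrite /semi_dist /semi_nrm Fsr !Fsl !subrr sqrtC0.
Qed.

Lemma vcauchyD u v : vcauchy u -> vcauchy v -> vcauchy (fun n => add (u n) (v n)).
Proof.
move=> hu hv e e0; have e2 : 0 < e / 2 by rewrite divr_gt0 ?ltr0n.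
have [N hN] := hu _ e2; have [N' hN'] := hv _ e2.
exists (maxn N N') => m n; rewrite !geq_max => /andP[m1 m2] /andP[n1 n2].
rewrite [e]splitr; apply: le_lt_trans (ltrD (hN m n m1 n1) (hN' m n m2 n2)).
apply: le_trans (semi_nrmD FD FZ FC F0 _ _).
rewrite le_eqVlt; apply/orP; left; apply/eqP; congr sqrtC.
by rewrite !(FD, Dl, Fsr, Fsl); ring.
Qed.

Lemma vcauchyZ a u : vcauchy u -> vcauchy (fun n => scl a (u n)).
Proof.
move=> hu e e0.
have a0 : 0 < `|a| + 1 by rewrite ltr_wpDl ?normr_ge0 ?ltr01.
have [N hN] := hu _ (divr_gt0 e0 a0).
exists N => m n /hN h /h {}h.
have -> : dist (scl a (u m)) (scl a (u n)) = nrm (scl a (sub (u m) (u n))).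
  by congr sqrtC; rewrite !(FZ, Zl, Fsr, Fsl); ring.
rewrite (semi_nrmZ FZ FC F0).
apply: le_lt_trans (_ : (`|a| + 1) * dist (u m) (u n) < _).
  by rewrite ler_wpM2r ?nrm0 // lerDl ler01.
by rewrite mulrC -ltr_pdivlMr.
Qed.

Lemma rep_cst x : rep (fun=> x) (F^~ x).
Proof. by split; [exact: vcauchy_cst | move=> v; exact: clim_cst]. Qed.

Lemma repD u v f g : rep u f -> rep v g ->
  rep (fun n => add (u n) (v n)) (fun x => f x + g x).
Proof.
move=> [cu hu] [cv hv]; split; first exact: vcauchyD.
move=> x; have := climD (hu x) (hv x).
by congr clim; apply/funext => n; rewrite FD.
Qed.

Lemma repZ a u f : rep u f -> rep (fun n => scl a (u n)) (fun x => a * f x).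
Proof.
move=> [cu hu]; split; first exact: vcauchyZ.
move=> x; have := climZ a (hu x).
by congr clim; apply/funext => n; rewrite FZ.
Qed.

Lemma dot_cvg u v : vcauchy u -> vcauchy v ->
  exists l, clim (fun n => F (u n) (v n)) l.
Proof.
move=> hu hv; apply: ccauchy_cvg => e e0.
have [M [N [M0 hM]]] := vcauchy_bnd hu.
have [M' [N' [M'0 hM']]] := vcauchy_bnd hv.
have e1 : 0 < e / 2 / M' by rewrite !divr_gt0 ?ltr0n.
have e2 : 0 < e / 2 / M by rewrite !divr_gt0 ?ltr0n.
have [K hK] := hu _ e1; have [K' hK'] := hv _ e2.
exists (maxn (maxn N N') (maxn K K')) => m n.
rewrite !geq_max => /andP[/andP[m1 m2] /andP[m3 m4]].
move=> /andP[/andP[n1 n2] /andP[n3 n4]].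
have -> : F (u m) (v m) - F (u n) (v n) =
    F (sub (u m) (u n)) (v m) + F (u n) (sub (v m) (v n)).
  by rewrite Fsl Fsr; ring.
apply: le_lt_trans (ler_normD _ _) _; rewrite [e]splitr.
apply: ltrD.
  apply: le_lt_trans (CS _ _) _.
  apply: le_lt_trans (_ : dist (u m) (u n) * M' < _).
    by rewrite ler_wpM2l ?nrm0 ?hM'.
  by rewrite -ltr_pdivlMr // hK.
apply: le_lt_trans (CS _ _) _.
apply: le_lt_trans (_ : M * dist (v m) (v n) < _).
  by rewrite ler_wpM2r ?nrm0 ?hM.
by rewrite mulrC -ltr_pdivlMr // hK'.
Qed.

Lemma vcauchy_null w : vcauchy w -> (forall v, clim (fun n => F v (w n)) 0) ->
  forall e, 0 < e -> exists N, forall n, (N <= n)%N -> nrm (w n) < e.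
Proof.
move=> hw h0 e e0.
have [M [N [M0 hM]]] := vcauchy_bnd hw.
have ee : 0 < e ^+ 2 / 2 by rewrite divr_gt0 ?exprn_gt0 ?ltr0n.
have [K hK] := hw _ (divr_gt0 ee M0).
have [L hL] := h0 (w (maxn N K)) _ ee.
exists (maxn (maxn N K) L) => n; rewrite !geq_max => /andP[/andP[n1 n2] n3].
rewrite -(@ltr_pXn2r _ 2) ?nnegrE ?nrm0 ?(ltW e0) // (semi_nrmK F).
rewrite -[F _ _]ger0_norm ?F0 //.
have -> : F (w n) (w n) = F (sub (w n) (w (maxn N K))) (w n) + F (w (maxn N K)) (w n).
  by rewrite Fsl subrK.
apply: le_lt_trans (ler_normD _ _) _; rewrite [e ^+ 2]splitr.
apply: ltrD; last by have := hL _ n3; rewrite subr0.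
apply: le_lt_trans (CS _ _) _.
apply: le_lt_trans (_ : dist (w n) (w (maxn N K)) * M < _).
  by rewrite ler_wpM2l ?nrm0 ?hM.
by rewrite -ltr_pdivlMr // hK // leq_maxr.
Qed.

Lemma rep_null u u' f : rep u f -> rep u' f ->
  forall e, 0 < e -> exists N, forall n, (N <= n)%N -> dist (u n) (u' n) < e.
Proof.
move=> r r'; have [cw hw] := repD r (repZ (-1) r').
apply: vcauchy_null => // v.
by have := hw v; rewrite mulN1r subrr.
Qed.

Lemma rep_dot u u' v v' f g l l' : rep u f -> rep u' f -> rep v g -> rep v' g ->
  clim (fun n => F (u n) (v n)) l -> clim (fun n => F (u' n) (v' n)) l' -> l = l'.
Proof.
move=> ru ru' rv rv' hl hl'; apply: clim_uniq hl _.
move=> e e0; have e2 : 0 < e / 2 by rewrite divr_gt0 ?ltr0n.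
have e4 : 0 < e / 2 / 2 by rewrite divr_gt0 ?ltr0n.
have [M [N [M0 hM]]] := vcauchy_bnd rv.1.
have [M' [N' [M'0 hM']]] := vcauchy_bnd ru'.1.
have [K hK] := rep_null ru ru' (divr_gt0 e4 M0).
have [K' hK'] := rep_null rv rv' (divr_gt0 e4 M'0).
have [L hL] := hl' _ e2.
exists (maxn L (maxn (maxn N N') (maxn K K'))) => n.
rewrite !geq_max => /andP[n0 /andP[/andP[n1 n2] /andP[n3 n4]]].
have -> : F (u n) (v n) - l' =
    (F (sub (u n) (u' n)) (v n) + F (u' n) (sub (v n) (v' n))) +
    (F (u' n) (v' n) - l').
  by rewrite Fsl Fsr; ring.
apply: le_lt_trans (ler_normD _ _) _; rewrite [e]splitr.
apply: ltrD (hL _ n0).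
apply: le_lt_trans (ler_normD _ _) _; rewrite [e / 2]splitr.
apply: ltrD.
  apply: le_lt_trans (CS _ _) _.
  apply: le_lt_trans (_ : dist (u n) (u' n) * M < _).
    by rewrite ler_wpM2l ?nrm0 ?hM.
  by rewrite -ltr_pdivlMr // hK.
apply: le_lt_trans (CS _ _) _.
apply: le_lt_trans (_ : M' * dist (v n) (v' n) < _).
  by rewrite ler_wpM2r ?nrm0 ?hM'.
by rewrite mulrC -ltr_pdivlMr // hK'.
Qed.

Definition rdot f g : C := xget 0 [set l | exists u v,
  [/\ rep u f, rep v g & clim (fun n => F (u n) (v n)) l]].

Lemma rdotP u v f g : rep u f -> rep v g ->
  clim (fun n => F (u n) (v n)) (rdot f g).
Proof.
move=> ru rv; have [l hl] := dot_cvg ru.1 rv.1.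
rewrite /rdot; case: xgetP => [l' _ [u' [v' [ru' rv' hl']]]|/(_ l)[]].
  by rewrite (rep_dot ru' ru rv' rv hl' hl).
by exists u, v.
Qed.

Definition repb : {pred V -> C} := fun f => `[< exists u, rep u f >].

Lemma repb_submod : GRing.submod_closed repb.
Proof.
split.
  apply/asboolP; exists (fun n => scl 0 v0).
  have -> : 0 = (fun x => 0 * F x v0) by apply/funext => x; rewrite mul0r.
  exact: repZ (rep_cst v0).
move=> a f g /asboolP[u ru] /asboolP[v rv]; apply/asboolP.
by exists (fun n => add (scl a (u n)) (v n)); exact: repD (repZ a ru) rv.
Qed.

End Completion.

(* [gen_hilbert k] is the Hilbert space generated by elements [gen k x], x : X,
   with inner products k x y (see gen_dotE): the completion of the formal
   linear combinations, modulo null vectors.  When k is not a positive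
   definite kernel no such space exists and [gen_hilbert k] is zero. *)
Section GenHilbert.
Variables (R : realType) (X : Type) (k : X -> X -> R[i]).
Local Notation C := R[i].
Local Notation V := (seq (C * X)).

Definition pos_kernel := (forall x y, k y x = (k x y)^*) /\
  forall s : V, 0 <= \sum_(p <- s) \sum_(q <- s) p.1^* * q.1 * k p.2 q.2.

Definition kform (s t : V) : C := if `[< pos_kernel >] then
  \sum_(p <- s) \sum_(q <- t) p.1^* * q.1 * k p.2 q.2 else 0.

Definition kscale (a : C) (s : V) : V := [seq (a * p.1, p.2) | p <- s].

Lemma kformD s t u : kform s (t ++ u) = kform s t + kform s u.
Proof.
rewrite /kform; case: ifP => _; last by rewrite addr0.
by rewrite -big_split; apply: eq_bigr => p _; rewrite big_cat.
Qed.

Lemma kformZ a s t : kform s (kscale a t) = a * kform s t.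
Proof.
rewrite /kform; case: ifP => _; last by rewrite mulr0.
rewrite mulr_sumr; apply: eq_bigr => p _.
rewrite big_map mulr_sumr; apply: eq_bigr => q _ /=; ring.
Qed.

Lemma kformC s t : kform t s = (kform s t)^*.
Proof.
rewrite /kform; case: ifP => [/asboolP[kC _]|_]; last by rewrite rmorph0.
rewrite rmorph_sum exchange_big; apply: eq_bigr => p _.
rewrite rmorph_sum; apply: eq_bigr => q _.
by rewrite !rmorphM /= conjCK -kC [_^* * _]mulrC.
Qed.

Lemma kform_ge0 s : 0 <= kform s s.
Proof. by rewrite /kform; case: ifP => // /asboolP[_]; exact. Qed.

Definition gen_pred : {pred V -> C^o} :=
  repb cat kscale kform.

Lemma gen_submod : GRing.submod_closed gen_pred.
Proof. exact: (repb_submod [::] kformD kformZ kformC kform_ge0). Qed.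

HB.instance Definition _ := GRing.isSubmodClosed.Build C (V -> C^o) gen_pred gen_submod.

Record gen_hilbert := GenHilbert { gen_val : V -> C^o; _ : gen_val \in gen_pred }.

HB.instance Definition _ := [isSub for gen_val].
HB.instance Definition _ := gen_eqMixin gen_hilbert.
HB.instance Definition _ := gen_choiceMixin gen_hilbert.
HB.instance Definition _ := [SubChoice_isSubLmodule of gen_hilbert by <:].

Local Notation rp := (rep cat kscale kform).

Lemma gen_rep (f : gen_hilbert) : exists u, rp u (gen_val f).
Proof. by case: f => f /= /asboolP. Qed.

Definition gen_dot (f g : gen_hilbert) : C :=
  rdot cat kscale kform (gen_val f) (gen_val g).

Lemma gen_dotP u v (f g : gen_hilbert) : rp u (gen_val f) -> rp v (gen_val g) ->
  clim (fun n => kform (u n) (v n)) (gen_dot f g).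
Proof. exact: (rdotP kformD kformZ kformC kform_ge0). Qed.

Lemma gen_repD u v (f g : gen_hilbert) : rp u (gen_val f) -> rp v (gen_val g) ->
  rp (fun n => u n ++ v n) (gen_val (f + g)).
Proof. exact: (repD kformD kformZ kformC kform_ge0). Qed.

Lemma gen_repZ a u (f : gen_hilbert) : rp u (gen_val f) ->
  rp (fun n => kscale a (u n)) (gen_val (a *: f)).
Proof. exact: (repZ kformD kformZ kformC kform_ge0). Qed.

Lemma gen_dotDr x y z : gen_dot x (y + z) = gen_dot x y + gen_dot x z.
Proof.
have [u ru] := gen_rep x; have [v rv] := gen_rep y; have [w rw] := gen_rep z.
apply: clim_uniq (gen_dotP ru (gen_repD rv rw)) _.
have := climD (gen_dotP ru rv) (gen_dotP ru rw).
by congr clim; apply/funext => n; rewrite kformD.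
Qed.

Lemma gen_dotZr a x y : gen_dot x (a *: y) = a * gen_dot x y.
Proof.
have [u ru] := gen_rep x; have [v rv] := gen_rep y.
apply: clim_uniq (gen_dotP ru (gen_repZ a rv)) _.
have := climZ a (gen_dotP ru rv).
by congr clim; apply/funext => n; rewrite kformZ.
Qed.

Lemma gen_dotC x y : gen_dot y x = (gen_dot x y)^*.
Proof.
have [u ru] := gen_rep x; have [v rv] := gen_rep y.
apply: clim_uniq (gen_dotP rv ru) _.
have := climJ (gen_dotP ru rv).
by congr clim; apply/funext => n; rewrite [RHS]kformC.
Qed.

Lemma gen_dot_ge0 x : 0 <= gen_dot x x.
Proof.
have [u ru] := gen_rep x; apply: clim_ge0 (gen_dotP ru ru) _ => n.
exact: kform_ge0.
Qed.

Definition gen_norm (x : gen_hilbert) : C := semi_nrm gen_dot x.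

Lemma gen_norm0_eq0 x : gen_norm x = 0 -> x = 0.
Proof.
move=> x0; have xx : gen_dot x x = 0.
  by rewrite -(sqrtCK (gen_dot x x)) -/(semi_nrm gen_dot x) -/(gen_norm x) x0 expr0n.
have [u ru] := gen_rep x; apply: val_inj; apply/funext => v /=.
apply: clim_uniq (ru.2 v) _ => e e0.
pose M := semi_nrm kform v + 1.
have M0 : 0 < M by rewrite ltr_wpDl ?semi_nrm_ge0 ?ltr01 //; exact: kform_ge0.
have eM : 0 < e / M by rewrite divr_gt0.
have [N hN] := gen_dotP ru ru (exprn_gt0 2 eM).
exists N => n /hN; rewrite xx !subr0 ger0_norm ?kform_ge0 // -(semi_nrmK kform).
rewrite ltr_pXn2r ?nnegrE ?semi_nrm_ge0 ?(ltW eM) //; last exact: kform_ge0.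
rewrite ltr_pdivlMr // => h; apply: le_lt_trans h.
apply: le_trans (semi_CS kformD kformZ kformC kform_ge0 _ _) _.
by rewrite mulrC ler_wpM2l ?semi_nrm_ge0 ?lerDl ?ler01 //; exact: kform_ge0.
Qed.

Lemma gen_normD x y : gen_norm (x + y) <= gen_norm x + gen_norm y.
Proof. exact: (semi_nrmD gen_dotDr gen_dotZr gen_dotC gen_dot_ge0). Qed.

Lemma gen_normZ a x : gen_norm (a *: x) = `|a| * gen_norm x.
Proof. exact: (semi_nrmZ gen_dotZr gen_dotC gen_dot_ge0). Qed.

HB.instance Definition _ := @Lmodule_isNormed.Build C gen_hilbert
  gen_norm gen_normD gen_normZ gen_norm0_eq0.

Lemma gen_normE (x : gen_hilbert) : `|x| = gen_norm x. Proof. by []. Qed.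

Lemma gen_of_in (s : V) : (kform^~ s : V -> C^o) \in gen_pred.
Proof. by apply/asboolP; exists (fun=> s); exact: (rep_cst kformD kformZ kformC). Qed.

Definition gen_of s : gen_hilbert := GenHilbert (gen_of_in s).

Definition gen (x : X) : gen_hilbert := gen_of [:: (1, x)].

Lemma gen_of_rep s : rp (fun=> s) (gen_val (gen_of s)).
Proof. exact: (rep_cst kformD kformZ kformC). Qed.

Lemma gen_dot_of s t : gen_dot (gen_of s) (gen_of t) = kform s t.
Proof.
exact: clim_uniq (gen_dotP (gen_of_rep s) (gen_of_rep t)) (clim_cst _).
Qed.

Lemma gen_dotE x y : pos_kernel -> gen_dot (gen x) (gen y) = k x y.
Proof.
move=> pk; rewrite gen_dot_of /kform asboolT //.
by rewrite !big_seq1 /= rmorph1 !mul1r.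
Qed.

Lemma gen_approx u (f : gen_hilbert) : rp u (gen_val f) -> forall e, 0 < e ->
  exists N, forall n, (N <= n)%N -> `|f - gen_of (u n)| < e.
Proof.
move=> ru e e0; have e2 : 0 < e / 2 by rewrite divr_gt0 ?ltr0n.
have [N hN] := ru.1 _ e2; exists N => n Nn.
have r1 := gen_repD ru (gen_repZ (-1) (gen_of_rep (u n))).
rewrite scaleN1r in r1.
apply: le_lt_trans (_ : e / 2 < e); last first.
  by rewrite ltr_pdivrMr ?ltr0n // mulr_natr mulr2n ltrDl.
rewrite gen_normE -(@ler_pXn2r _ 2) ?nnegrE ?(ltW e2) //; last first.
  exact/semi_nrm_ge0/gen_dot_ge0.
rewrite (semi_nrmK gen_dot) -[leLHS]ger0_norm ?gen_dot_ge0 //.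
apply: (clim_le (N := N)) (gen_dotP r1 r1) _.
  by rewrite rpredX // gtr0_real.
move=> m Nm; rewrite ger0_norm ?kform_ge0 // -(semi_nrmK kform).
rewrite ler_pXn2r ?nnegrE ?(ltW e2) ?semi_nrm_ge0 //; last exact: kform_ge0.
exact: ltW (hN _ _ Nm Nn).
Qed.

Lemma gen_complete (Fi : set_system gen_hilbert) :
  ProperFilter Fi -> cauchy Fi -> cvg Fi.
Proof.
move=> PF /cauchyP Fc.
have e_ n : 0 < n.+1%:R^-1 :> C by rewrite invr_gt0 ltr0n.
have /choice[f hf] : forall n : nat, exists f : gen_hilbert, Fi (ball f n.+1%:R^-1).
  by move=> n; exact: Fc (e_ n).
have /choice[v hv] : forall n, exists s, `|f n - gen_of s| < n.+1%:R^-1.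
  move=> n; have [u ru] := gen_rep (f n).
  by have [N hN] := gen_approx ru (e_ n); exists (u N); exact: hN.
have dE s t : `|gen_of s - gen_of t| = semi_dist cat kscale kform s t.
  rewrite gen_normE /gen_norm /semi_nrm; congr sqrtC; rewrite -scaleN1r.
  have h := gen_repD (gen_of_rep s) (gen_repZ (-1) (gen_of_rep t)).
  exact: clim_uniq (gen_dotP h h) (clim_cst _).
have ff m n : `|f m - f n| < m.+1%:R^-1 + n.+1%:R^-1.
  have [x [xm xn]] := filter_ex (filterI (hf m) (hf n)).
  apply: le_lt_trans (ler_distD x _ _) _; apply: ltrD; first exact: xm.
  by rewrite distrC; exact: xn.
have vv m n : `|gen_of (v m) - gen_of (v n)| <
    (m.+1%:R^-1 + n.+1%:R^-1) *+ 2.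
  apply: le_lt_trans (ler_distD (f m) _ _) _.
  apply: le_lt_trans (lerD (lexx _) (ler_distD (f n) _ _)) _.
  rewrite distrC mulr2n.
  have -> : m.+1%:R^-1 + n.+1%:R^-1 + (m.+1%:R^-1 + n.+1%:R^-1) =
     m.+1%:R^-1 + ((m.+1%:R^-1 + n.+1%:R^-1) + n.+1%:R^-1) :> C by ring.
  by apply: ltrD => //; apply: ltrD.
have cv : vcauchy cat kscale kform v.
  move=> e e0; have e4 : 0 < e / 4 by rewrite divr_gt0 ?ltr0n.
  have [N hN] := small_inv e4; exists N => m n /hN hm /hN hn; rewrite -dE.
  apply: lt_trans (vv m n) _.
  have -> : e = (e / 4 + e / 4) *+ 2 by field.
  by rewrite ltr_pMn2r // ltrD.
have /choice[g hg] : forall s, exists l, clim (fun n => kform s (v n)) l.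
  move=> s; exact: (dot_cvg kformD kformZ kformC kform_ge0 (vcauchy_cst kformD kformZ kformC s) cv).
have rg : rp v (g : V -> C^o) by split.
have gP : (g : V -> C^o) \in gen_pred by apply/asboolP; exists v.
apply/cvg_ex; exists (GenHilbert gP); apply/cvgrPdist_lt => e e0.
have e3 : 0 < e / 3 by rewrite divr_gt0 ?ltr0n.
have [N hN] := small_inv e3.
have [K hK] := gen_approx (rg : rp v (gen_val (GenHilbert gP))) e3.
pose n := maxn N K.
apply: filterS (hf n) => x xn.
have -> : e = e / 3 + (e / 3 + e / 3) by field.
apply: le_lt_trans (ler_distD (gen_of (v n)) _ _) _.
apply: ltrD; first by apply: hK; rewrite leq_maxr.
apply: le_lt_trans (ler_distD (f n) _ _) _.
have ne : n.+1%:R^-1 < e / 3 by apply: hN; rewrite leq_maxl.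
apply: ltrD; first by rewrite distrC; exact: lt_trans (hv n) ne.
by apply: lt_trans ne; exact: xn.
Qed.

HB.instance Definition _ := Uniform_isComplete.Build gen_hilbert gen_complete.

Lemma gen_hnormE (x : gen_hilbert) : `|x| ^+ 2 = gen_dot x x.
Proof. exact: (semi_nrmK gen_dot). Qed.

HB.instance Definition _ := isHilbert.Build R gen_hilbert
  gen_dotDr gen_dotZr gen_dotC gen_hnormE.

End GenHilbert.


Section BoundedOperators.
Variables (R : realType) (H K : hilbertType R).
Local Notation C := R[i].

Definition bop_pred : {pred H -> K} := fun f => `[< linear f /\
  exists M : C, forall x, `|f x| <= M * `|x| >].

Lemma bop_submod : GRing.submod_closed bop_pred.
Proof.
split.
  apply/asboolP; split=> [a x y|]; first by rewrite scaler0 addr0.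
  by exists 0 => x; rewrite normr0 mul0r.
move=> a f g /asboolP[lf [M hM]] /asboolP[lg [N hN]]; apply/asboolP; split.
  move=> b x y; rewrite !fctE /= lf lg !scalerDr !scalerA mulrC.
  by rewrite addrACA.
exists (`|a| * M + N) => x; rewrite mulrDl -mulrA.
apply: le_trans (ler_normD _ _) _; apply: lerD => //.
by rewrite normrZ ler_wpM2l.
Qed.

HB.instance Definition _ :=
  GRing.isSubmodClosed.Build C (H -> K) bop_pred bop_submod.

Record bop := Bop { bop_fun :> H -> K; _ : bop_fun \in bop_pred }.

HB.instance Definition _ := [isSub for bop_fun].
HB.instance Definition _ := gen_eqMixin bop.
HB.instance Definition _ := gen_choiceMixin bop.
HB.instance Definition _ := [SubChoice_isSubLmodule of bop by <:].

Lemma bop_linear (T : bop) : linear T.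
Proof. by case: T => f /= /asboolP[]. Qed.

HB.instance Definition _ (T : bop) :=
  GRing.isLinear.Build C H K *:%R T (@bop_linear T).

Lemma bop_bounded (T : bop) : exists M : C, forall x, `|T x| <= M * `|x|.
Proof. by case: T => f /= /asboolP[]. Qed.

Lemma bop_ext (S T : bop) : S =1 T -> S = T.
Proof. by move=> h; apply: val_inj; apply/funext. Qed.

(* sup {|T x| : |x| <= 1} *)
Definition opnorm (T : bop) : C :=
  (sup [set complex.Re `|T x| | x in [set x : H | `|x| <= 1]])%:C%C.

Let reN (V : normedZmodType C) (x : V) : (complex.Re `|x|)%:C%C = `|x| :> C.
Proof. by rewrite RRe_real ?normr_real. Qed.

Lemma opnorm_set_sup (T : bop) :
  has_sup [set complex.Re `|T x| | x in [set x : H | `|x| <= 1]].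
Proof.
split; first by exists (complex.Re `|T 0|), 0 => //=; rewrite normr0 ler01.
have [M hM] := bop_bounded T; exists (complex.Re `|M|) => _ [x /= x1 <-].
rewrite -lecR !(reN, RRe_real (normr_real M)); apply: le_trans (hM x) _.
have [->|x0] := eqVneq x 0; first by rewrite normr0 mulr0 normr_ge0.
have xp : 0 < `|x| by rewrite normr_gt0.
have M0 : 0 <= M by rewrite -(pmulr_lge0 _ xp); exact: le_trans (normr_ge0 _) (hM x).
by rewrite (ger0_norm M0) ler_piMr.
Qed.

Lemma opnorm_ge0 T : 0 <= opnorm T.
Proof.
rewrite lecR; apply: (@le_trans _ _ (complex.Re `|T 0|)).
  by rewrite -lecR reN; exact: normr_ge0.
by apply: ub_le_sup; [exact: (opnorm_set_sup T).2 | exists 0 => //=; rewrite normr0 ler01].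
Qed.

Lemma le_opnorm (T : bop) x : `|T x| <= opnorm T * `|x|.
Proof.
have [->|x0] := eqVneq x 0; first by rewrite linear0 !normr0 mulr0.
have xp : 0 < `|x| by rewrite normr_gt0.
rewrite -ler_pdivrMr //.
have -> : `|T x| / `|x| = `|T (`|x|^-1 *: x)|.
  by rewrite linearZ /= normrZ normfV normr_id mulrC.
rewrite -reN lecR; apply: ub_le_sup; first exact: (opnorm_set_sup T).2.
by exists (`|x|^-1 *: x) => //=; rewrite normrZ normfV normr_id mulVf // gt_eqF.
Qed.

Lemma opnorm_le (T : bop) b : 0 <= b -> (forall x, `|T x| <= b * `|x|) ->
  opnorm T <= b.
Proof.
move=> b0 h; have br : (complex.Re b)%:C%C = b by rewrite RRe_real ?ger0_real.
rewrite -br lecR; apply: ge_sup; first exact: (opnorm_set_sup T).1.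
move=> _ [x /= x1 <-]; rewrite -lecR reN br; apply: le_trans (h x) _.
by rewrite ler_piMr.
Qed.

Lemma opnormD S T : opnorm (S + T) <= opnorm S + opnorm T.
Proof.
apply: opnorm_le => [|x]; first by rewrite addr_ge0 ?opnorm_ge0.
rewrite mulrDl; apply: le_trans (ler_normD _ _) _.
by apply: lerD; exact: le_opnorm.
Qed.

Lemma opnormZ_le a T : opnorm (a *: T) <= `|a| * opnorm T.
Proof.
apply: opnorm_le => [|x]; first by rewrite mulr_ge0 ?opnorm_ge0.
by rewrite -mulrA normrZ ler_wpM2l // le_opnorm.
Qed.

Lemma opnorm0_eq0 T : opnorm T = 0 -> T = 0.
Proof.
move=> T0; apply: bop_ext => x; apply/eqP; rewrite -normr_le0.
by have := le_opnorm T x; rewrite T0 mul0r.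
Qed.

Lemma opnormZ a T : opnorm (a *: T) = `|a| * opnorm T.
Proof.
apply/eqP; rewrite eq_le opnormZ_le /=.
have [->|a0] := eqVneq a 0; first by rewrite normr0 mul0r opnorm_ge0.
have ap : 0 < `|a| by rewrite normr_gt0.
rewrite -ler_pdivlMl // -normfV.
by rewrite -{1}[T]scale1r -(mulVf a0) -scalerA opnormZ_le.
Qed.

HB.instance Definition _ := @Lmodule_isNormed.Build C bop
  opnorm opnormD opnormZ opnorm0_eq0.

End BoundedOperators.

Notation "''L' ( H , K )" := (bop H K) (at level 8, format "''L' ( H ,  K )").

Section Composition.
Variables (R : realType) (H K L : hilbertType R).

Lemma bcomp_subproof (T : 'L(K, L)) (S : 'L(H, K)) : T \o S \in @bop_pred R H L.
Proof.
apply/asboolP; split=> [a x y /=|]; first by rewrite !linearP.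
exists (opnorm T * opnorm S) => x /=; rewrite -mulrA.
apply: le_trans (le_opnorm T _) _; rewrite ler_wpM2l ?opnorm_ge0 //.
exact: le_opnorm.
Qed.

Definition bcomp (T : 'L(K, L)) (S : 'L(H, K)) : 'L(H, L) := Bop (bcomp_subproof T S).

Lemma bid_subproof : idfun \in @bop_pred R H H.
Proof. by apply/asboolP; split => //; exists 1 => x; rewrite mul1r. Qed.

Definition bid : 'L(H, H) := Bop bid_subproof.

Definition adj (T : 'L(H, K)) : 'L(K, H) :=
  xget 0 [set S : 'L(K, H) | forall x y, hdot (T x) y = hdot x (S y)].
End Composition.

Section Riesz.
Variables (R : realType) (H : hilbertType R).
Local Notation C := R[i].

Lemma hdotDl (x y z : H) : hdot (x + y) z = hdot x z + hdot y z.
Proof. exact: (semi_Dl hdotDr hdotC). Qed.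

Lemma hdotZl (a : C) (x y : H) : hdot (a *: x) y = a^* * hdot x y.
Proof. exact: (semi_Zl hdotZr hdotC). Qed.

Lemma hdotBl (x y z : H) : hdot (x - y) z = hdot x z - hdot y z.
Proof. by rewrite -scaleN1r hdotDl hdotZl rmorphN rmorph1 mulN1r. Qed.

Lemma hdot_ge0 (x : H) : 0 <= hdot x x.
Proof. by rewrite -hnormE exprn_ge0. Qed.

Lemma hdot_CS (x y : H) : `|hdot x y| <= `|x| * `|y|.
Proof.
rewrite -(@ler_pXn2r _ 2) ?nnegrE ?mulr_ge0 // exprMn !hnormE.
exact: (semi_CS2 hdotDr hdotZr hdotC hdot_ge0).
Qed.

Lemma hdot_inj (x y : H) : (forall z, hdot x z = hdot y z) -> x = y.
Proof.
move=> h; apply/eqP; rewrite -subr_eq0 -normr_eq0 -sqrf_eq0 hnormE.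
by rewrite hdotBl h subrr.
Qed.

Lemma riesz (f : H -> C) (M : C) : (forall x y, f (x + y) = f x + f y) ->
    (forall a x, f (a *: x) = a * f x) -> (forall x, `|f x| <= M * `|x|) ->
  exists z, forall x, f x = hdot z x.
Proof.
move=> fD fZ fM.
have fM' x : `|f x| <= `|M| * `|x|.
  apply: le_trans (fM x) _.
  have [->|x0] := eqVneq x 0; first by rewrite !normr0 !mulr0.
  have xp : 0 < `|x| by rewrite normr_gt0.
  have M0 : 0 <= M by rewrite -(pmulr_lge0 _ xp); exact: le_trans (fM x).
  by rewrite (ger0_norm M0).
pose q x : C := `|x| ^+ 2 - (f x + (f x)^*).
have qr x : (complex.Re (q x))%:C%C = q x.
  rewrite RRe_real // rpredB ?rpredX ?normr_real //.
  by apply/CrealP; rewrite rmorphD /= conjCK addrC.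
have qb x : - `|M| ^+ 2 <= q x.
  have -> : q x = (`|x| - `|M|) ^+ 2 - `|M| ^+ 2 +
      (2%:R * (`|M| * `|x|) - (f x + (f x)^*)) by rewrite /q; ring.
  rewrite -[leLHS]add0r -[leLHS]addr0; apply: lerD.
    rewrite lerD2r real_exprn_even_ge0 // realB ?normr_real //.
  rewrite subr_ge0.
  have -> : f x + (f x)^* = 2%:R * 'Re (f x).
    by rewrite ReE mulrC divfK // pnatr_eq0.
  rewrite ler_pM2l ?ltr0n //; apply: le_trans (fM' x).
  by case: (leif_Re_Creal (f x)).
pose D := [set complex.Re (q x) | x in [set: H]].
have infD : has_inf D.
  split; first by exists (complex.Re (q 0)), 0.
  exists (complex.Re (- `|M| ^+ 2)) => _ [x _ <-].
  rewrite -lecR qr RRe_real // rpredN rpredX // normr_real.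
  done.
pose d := inf D.
have qd x : d%:C%C <= q x.
  by rewrite -qr lecR; apply: ge_inf; [exact: infD.2 | exists x].
have qexp x y a : q (x + a *: y) =
    q x + (a * (hdot x y - f y) + (a * (hdot x y - f y))^*) + `|a| ^+ 2 * `|y| ^+ 2.
  rewrite /q !hnormE !(hdotDr, hdotDl, hdotZr, hdotZl) fD fZ normCK.
  rewrite !(rmorphD, rmorphM, rmorphB, rmorphN) /= -(hdotC x y); ring.
have /choice[u hu] : forall n : nat, exists x, forall y,
    `|hdot x y - f y| <= n.+1%:R^-1 * `|y|.
  move=> n; have e0 : 0 < n.+1%:R^-1 ^+ 2 :> R by rewrite exprn_gt0 ?invr_gt0 ?ltr0n.
  have [_ [x _ <-] hx] := inf_adherent e0 infD.
  have {}hx : q x <= d%:C%C + n.+1%:R^-1 ^+ 2.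
    rewrite -qr; apply: ltW; rewrite -ltcR in hx; apply: lt_le_trans hx _.
    by rewrite rmorphD rmorphXn fmorphV rmorph_nat.
  exists x => y; rewrite -(@ler_pXn2r _ 2) ?nnegrE ?mulr_ge0 ?invr_ge0 ?ler0n //.
  rewrite exprMn; apply: quad_bound; rewrite ?exprn_ge0 ?invr_ge0 ?ler0n // => a.
  have := le_trans (qd (x + a *: y)) (_ : _ <= _); rewrite qexp.
  move=> /(_ _ (lerD (lerD hx (lexx _)) (lexx _))).
  by rewrite -subr_ge0 !addrA [_ - _]addrC !addrA addNr add0r.
have uu m n : `|u m - u n| <= m.+1%:R^-1 + n.+1%:R^-1.
  have [->|un] := eqVneq (u m - u n) 0.
    by rewrite normr0 addr_ge0 ?invr_ge0 ?ler0n.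
  have up : 0 < `|u m - u n| by rewrite normr_gt0.
  rewrite -(ler_pM2r up) -expr2 hnormE -[leLHS]ger0_norm ?hdot_ge0 //.
  rewrite {1}hdotBl.
  have -> : hdot (u m) (u m - u n) - hdot (u n) (u m - u n) =
    (hdot (u m) (u m - u n) - f (u m - u n)) - (hdot (u n) (u m - u n) - f (u m - u n))
    by ring.
  apply: le_trans (ler_normB _ _) _; rewrite mulrDl.
  by apply: lerD; exact: hu.
have /cauchy_cvg/cvg_ex[z hz] : cauchy (u @ \oo).
  apply/cauchy_exP => e e0.
  have e2 : 0 < e / 2 by rewrite divr_gt0 ?ltr0n.
  have [N hN] := small_inv e2.
  exists (u N); exists N => // n Nn.
  rewrite /= -ball_normE /=; apply: le_lt_trans (uu N n) _.
  by rewrite [e]splitr; apply: ltrD; apply: hN => //=.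
exists z => y; apply/eqP; rewrite eq_sym -subr_eq0 -normr_le0.
apply/ler_addgt0Pr => e e0; rewrite add0r.
have y0 : 0 < `|y| + 1 by rewrite ltr_wpDl ?normr_ge0 ?ltr01.
have e2 : 0 < e / 2 / (`|y| + 1) by rewrite !divr_gt0 ?ltr0n.
have [N hN] := small_inv e2.
move/cvgrPdist_lt: hz => /(_ _ e2)[N' _ hN'].
pose n := maxn N N'.
have h1 := hN n (leq_maxl _ _); have h2 := hN' n (leq_maxr _ _).
have -> : hdot z y - f y = hdot (z - u n) y + (hdot (u n) y - f y).
  by rewrite hdotBl; ring.
apply: le_trans (ler_normD _ _) _; rewrite [e]splitr.
have yy (r : C) : 0 <= r -> r < e / 2 / (`|y| + 1) -> r * `|y| <= e / 2.
  move=> r0; rewrite ltr_pdivlMr // => /ltW; apply: le_trans.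
  by rewrite ler_wpM2l // lerDl ler01.
apply: lerD; first by apply: le_trans (hdot_CS _ _) (yy _ _ _).
by apply: le_trans (hu n y) (yy _ _ _); rewrite ?invr_ge0 ?ler0n.
Qed.
End Riesz.

Lemma adjP (R : realType) (H K : hilbertType R) (T : 'L(H, K)) x y :
  hdot (T x) y = hdot x (adj T y).
Proof.
have /choice[S hS] : forall y, exists z, forall x, hdot y (T x) = hdot z x.
  move=> {x y} y; apply: (@riesz R H (fun x => hdot y (T x)) (`|y| * opnorm T)).
  - by move=> x x'; rewrite linearD hdotDr.
  - by move=> a x; rewrite linearZ hdotZr.
  - move=> x; rewrite -mulrA; apply: le_trans (hdot_CS _ _) _.
    by rewrite ler_wpM2l // le_opnorm.
have SP : S \in @bop_pred R K H.
  apply/asboolP; split.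
    move=> a v w; apply: hdot_inj => z.
    by rewrite hdotDl hdotZl -!hS hdotDl hdotZl.
  exists (opnorm T) => v; have [->|Sv] := eqVneq (S v) 0.
    by rewrite normr0 mulr_ge0 ?opnorm_ge0.
  rewrite -(ler_pM2r (_ : 0 < `|S v|)) ?normr_gt0 // -expr2 hnormE -hS.
  rewrite -[leLHS]ger0_norm; last by rewrite hS hdot_ge0.
  apply: le_trans (hdot_CS _ _) _.
  by rewrite [opnorm T * _]mulrC -mulrA ler_wpM2l // le_opnorm.
rewrite /adj; case: xgetP => [S' _ -> //|/(_ (Bop SP))[] x' y'] /=.
by rewrite hdotC hS -hdotC.
Qed.

Notation "T ** S" := (bcomp T S) (at level 40, left associativity).

Section Spans.
Variable R : realType.
Local Notation C := R[i].

Definition lspan (V : lmodType C) (A : set V) : set V :=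
  [set v | exists2 s : seq (C * V),
    (forall p, p \in s -> A p.2) & v = \sum_(p <- s) p.1 *: p.2].

Definition cspan (V : normedModType C) (A : set V) : set V := closure (lspan A).

Definition closed_subspace (V : normedModType C) (A : set V) :=
  [/\ closed A, A 0 & forall (a : C) x y, A x -> A y -> A (a *: x + y)].

Definition omul (H K L : hilbertType R) (A : set 'L(K, L)) (B : set 'L(H, K)) :
  set 'L(H, L) := [set T ** S | T in A & S in B].

Definition oapp (H K : hilbertType R) (A : set 'L(H, K)) (X : set H) : set K :=
  [set T x | T in A & x in X].

Definition oadj (H K : hilbertType R) (A : set 'L(H, K)) : set 'L(K, H) :=
  @adj R H K @` A.

Definition unitary (H K : hilbertType R) (T : 'L(H, K)) :=
  adj T ** T = bid H /\ T ** adj T = bid K.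

Definition cstar_alg (H : hilbertType R) (A : set 'L(H, H)) :=
  [/\ closed_subspace A, omul A A `<=` A & oadj A `<=` A].

Definition nondegenerate (H : hilbertType R) (A : set 'L(H, H)) :=
  cspan (oapp A setT) = setT.

Definition star_hom (H K : hilbertType R) (A : set 'L(H, H)) (B : set 'L(K, K))
    (pi : 'L(H, H) -> 'L(K, K)) :=
  [/\ pi @` A `<=` B,
      forall (c : C) a a', A a -> A a' -> pi (c *: a + a') = c *: pi a + pi a',
      forall a a', A a -> A a' -> pi (a ** a') = pi a ** pi a' &
      forall a, A a -> pi (adj a) = adj (pi a)].

End Spans.

Section Modules.
Variables (R : realType) (Z : hilbertType R).

(* The triple (Z, alg, algd); the axioms of a C*-base are in cstar_base. *)
Record obase := OBase { alg : set 'L(Z, Z); algd : set 'L(Z, Z) }.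

Definition dagger (b : obase) := OBase (algd b) (alg b).

Definition cstar_base (b : obase) :=
  [/\ cstar_alg (alg b) /\ nondegenerate (alg b),
      cstar_alg (algd b) /\ nondegenerate (algd b) &
      forall x y, alg b x -> algd b y -> x ** y = y ** x].

Definition cmodule (b : obase) (H : hilbertType R) (alpha : set 'L(Z, H)) :=
  [/\ closed_subspace alpha, cspan (oapp alpha setT) = setT,
      cspan (omul alpha (alg b)) = alpha &
      cspan (omul (oadj alpha) alpha) = alg b].

(* Operators "determined by" equations are selected by xget, with value 0 when
   no bounded operator satisfies the equations. *)
Definition rho (H : hilbertType R) (alpha : set 'L(Z, H)) (x : 'L(Z, Z)) : 'L(H, H) :=
  xget 0 [set T : 'L(H, H) | forall xi, alpha xi -> T ** xi = xi ** x].

Definition rho_alg (b : obase) (H : hilbertType R) (alpha : set 'L(Z, H)) :=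
  rho alpha @` algd b.

Definition cbimodule (b1 b2 : obase) (H : hilbertType R) (alpha1 alpha2 : set 'L(Z, H)) :=
  [/\ cmodule b1 alpha1, cmodule b2 alpha2,
      cspan (omul (rho_alg b1 alpha1) alpha2) = alpha2 &
      cspan (omul (rho_alg b2 alpha2) alpha1) = alpha1].

Definition ctrimodule (b1 b2 b3 : obase) (H : hilbertType R)
    (alpha1 alpha2 alpha3 : set 'L(Z, H)) :=
  [/\ cbimodule b1 b2 alpha1 alpha2, cbimodule b1 b3 alpha1 alpha3 &
      cbimodule b2 b3 alpha2 alpha3].

Definition semi_morphism (H K : hilbertType R) (alpha : set 'L(Z, H))
    (beta : set 'L(Z, K)) (T : 'L(H, K)) := forall xi, alpha xi -> beta (T ** xi).

Definition morphism (H K : hilbertType R) (alpha : set 'L(Z, H))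
    (beta : set 'L(Z, K)) (T : 'L(H, K)) :=
  semi_morphism alpha beta T /\ semi_morphism beta alpha (adj T).

End Modules.

Section RelativeTensor.
Variables (R : realType) (Z : hilbertType R).

(* Generators xi (x) zeta (x) eta are indexed by all triples of operators and
   vectors; those with xi outside beta or eta outside gamma become 0. *)
Definition rt_kernel (H K : hilbertType R) (beta : set 'L(Z, H)) (gamma : set 'L(Z, K))
    (p q : 'L(Z, H) * Z * 'L(Z, K)) : R[i] :=
  let: (xi, zeta, eta) := p in let: (xi', zeta', eta') := q in
  if `[< [/\ beta xi, gamma eta, beta xi' & gamma eta'] >]
  then hdot zeta ((adj xi ** xi' ** adj eta ** eta') zeta') else 0.

Definition rt (H K : hilbertType R) (beta : set 'L(Z, H)) (gamma : set 'L(Z, K)) :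
  hilbertType R := gen_hilbert (rt_kernel beta gamma).

Definition tens (H K : hilbertType R) (beta : set 'L(Z, H)) (gamma : set 'L(Z, K))
    xi zeta eta : rt beta gamma := gen (rt_kernel beta gamma) (xi, zeta, eta).

Definition ket1 (H K : hilbertType R) (beta : set 'L(Z, H)) (gamma : set 'L(Z, K))
    (xi : 'L(Z, H)) : 'L(K, rt beta gamma) :=
  xget 0 [set T : 'L(K, rt beta gamma) |
    forall eta zeta, gamma eta -> T (eta zeta) = tens beta gamma xi zeta eta].

Definition ket2 (H K : hilbertType R) (beta : set 'L(Z, H)) (gamma : set 'L(Z, K))
    (eta : 'L(Z, K)) : 'L(H, rt beta gamma) :=
  xget 0 [set T : 'L(H, rt beta gamma) |
    forall xi zeta, beta xi -> T (xi zeta) = tens beta gamma xi zeta eta].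

(* ltri beta gamma alpha is "alpha <| gamma" and rtri beta gamma delta is
   "beta |> delta", as spaces of operators into rt beta gamma. *)
Definition ltri (H K : hilbertType R) (beta : set 'L(Z, H)) (gamma : set 'L(Z, K))
    (alpha : set 'L(Z, H)) : set 'L(Z, rt beta gamma) :=
  cspan (omul (ket2 beta gamma @` gamma) alpha).
#[global] Arguments ltri {H K} beta gamma alpha _ : rename.

Definition rtri (H K : hilbertType R) (beta : set 'L(Z, H)) (gamma : set 'L(Z, K))
    (delta : set 'L(Z, K)) : set 'L(Z, rt beta gamma) :=
  cspan (omul (ket1 beta gamma @` beta) delta).
#[global] Arguments rtri {H K} beta gamma delta _ : rename.

(* opl, opr and otens are S (x) id, id (x) T and S (x) T. *)
Definition opl (H H' K : hilbertType R) (beta : set 'L(Z, H)) (beta' : set 'L(Z, H'))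
    (gamma : set 'L(Z, K)) (S : 'L(H, H')) : 'L(rt beta gamma, rt beta' gamma) :=
  xget 0 [set X : 'L(rt beta gamma, rt beta' gamma) |
    forall eta, gamma eta -> X ** ket2 beta gamma eta = ket2 beta' gamma eta ** S].

Definition opr (H K K' : hilbertType R) (beta : set 'L(Z, H)) (gamma : set 'L(Z, K))
    (gamma' : set 'L(Z, K')) (T : 'L(K, K')) : 'L(rt beta gamma, rt beta gamma') :=
  xget 0 [set X : 'L(rt beta gamma, rt beta gamma') |
    forall xi, beta xi -> X ** ket1 beta gamma xi = ket1 beta gamma' xi ** T].

Definition otens (H H' K K' : hilbertType R)
    (beta : set 'L(Z, H)) (beta' : set 'L(Z, H'))
    (gamma : set 'L(Z, K)) (gamma' : set 'L(Z, K'))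
    (S : 'L(H, H')) (T : 'L(K, K')) : 'L(rt beta gamma, rt beta' gamma') :=
  xget 0 [set X : 'L(rt beta gamma, rt beta' gamma') |
    forall xi zeta eta, beta xi -> gamma eta ->
      X (tens beta gamma xi zeta eta) = tens beta' gamma' (S ** xi) zeta (T ** eta)].

Definition flip (H K : hilbertType R) (beta : set 'L(Z, H)) (gamma : set 'L(Z, K)) :
    'L(rt beta gamma, rt gamma beta) :=
  xget 0 [set X : 'L(rt beta gamma, rt gamma beta) |
    forall xi zeta eta, beta xi -> gamma eta ->
      X (tens beta gamma xi zeta eta) = tens gamma beta eta zeta xi].

(* (H (x) K) (x) L -> H (x) (K (x) L), where beta and gamma are used for the
   first product and delta and epsilon for the second. *)
Definition assoc (H K L : hilbertType R) (beta : set 'L(Z, H))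
    (gamma delta : set 'L(Z, K)) (epsilon : set 'L(Z, L)) :
    'L(rt (rtri beta gamma delta) epsilon, rt beta (ltri delta epsilon gamma)) :=
  xget 0 [set X : 'L(rt (rtri beta gamma delta) epsilon,
                     rt beta (ltri delta epsilon gamma)) |
    forall xi omega, beta xi -> epsilon omega ->
      X ** ket2 (rtri beta gamma delta) epsilon omega ** ket1 beta gamma xi =
      ket1 beta (ltri delta epsilon gamma) xi ** ket2 delta epsilon omega].

(* (H (x) K) (x) L -> (H (x) L) (x) K, where H carries beta for the product with
   K (along gamma) and delta for the product with L (along epsilon). *)
Definition flip23 (H K L : hilbertType R) (beta delta : set 'L(Z, H))
    (gamma : set 'L(Z, K)) (epsilon : set 'L(Z, L)) :
    'L(rt (ltri beta gamma delta) epsilon, rt (ltri delta epsilon beta) gamma) :=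
  xget 0 [set X : 'L(rt (ltri beta gamma delta) epsilon,
                     rt (ltri delta epsilon beta) gamma) |
    forall eta omega, gamma eta -> epsilon omega ->
      X ** ket2 (ltri beta gamma delta) epsilon omega ** ket2 beta gamma eta =
      ket2 (ltri delta epsilon beta) gamma eta ** ket2 delta epsilon omega].

End RelativeTensor.

Section HopfBimodules.
Variables (R : realType) (Z : hilbertType R).

Definition cbialgebra (b1 b2 : obase Z) (H : hilbertType R)
    (A : set 'L(H, H)) (alpha1 alpha2 : set 'L(Z, H)) :=
  [/\ cbimodule b1 b2 alpha1 alpha2, cstar_alg A,
      omul (rho_alg b1 alpha1) A `<=` A & omul (rho_alg b2 alpha2) A `<=` A].

Definition intertwines (H K : hilbertType R) (A : set 'L(H, H))
    (pi : 'L(H, H) -> 'L(K, K)) (T : 'L(H, K)) :=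
  forall a, A a -> T ** a = pi a ** T.

Definition semi_intertwiners (H K : hilbertType R) (A : set 'L(H, H))
    (alpha1 alpha2 : set 'L(Z, H)) (gamma1 gamma2 : set 'L(Z, K))
    (pi : 'L(H, H) -> 'L(K, K)) : set 'L(H, K) :=
  [set T | [/\ semi_morphism alpha1 gamma1 T, semi_morphism alpha2 gamma2 T &
               intertwines A pi T]].

Definition intertwiners (H K : hilbertType R) (A : set 'L(H, H))
    (alpha1 alpha2 : set 'L(Z, H)) (gamma1 gamma2 : set 'L(Z, K))
    (pi : 'L(H, H) -> 'L(K, K)) : set 'L(H, K) :=
  [set T | [/\ morphism alpha1 gamma1 T, morphism alpha2 gamma2 T &
               intertwines A pi T]].

Definition jointly_normal (b1 b2 : obase Z) (H K : hilbertType R)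
    (A : set 'L(H, H)) (alpha1 alpha2 : set 'L(Z, H))
    (B : set 'L(K, K)) (gamma1 gamma2 : set 'L(Z, K))
    (pi : 'L(H, H) -> 'L(K, K)) :=
  let Lpi := intertwiners A alpha1 alpha2 gamma1 gamma2 pi in
  [/\ cbialgebra b1 b2 A alpha1 alpha2, cbialgebra b1 b2 B gamma1 gamma2,
      star_hom A B pi, cspan (omul Lpi alpha1) = gamma1 &
      cspan (omul Lpi alpha2) = gamma2].

Definition fiber (H K : hilbertType R) (beta : set 'L(Z, H)) (gamma : set 'L(Z, K))
    (A : set 'L(H, H)) (B : set 'L(K, K)) : set 'L(rt beta gamma, rt beta gamma) :=
  let B1 := cspan (omul (ket1 beta gamma @` beta) B) in
  let A2 := cspan (omul (ket2 beta gamma @` gamma) A) in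
  [set x | [/\ omul [set x] (ket1 beta gamma @` beta) `<=` B1,
               omul [set adj x] (ket1 beta gamma @` beta) `<=` B1,
               omul [set x] (ket2 beta gamma @` gamma) `<=` A2 &
               omul [set adj x] (ket2 beta gamma @` gamma) `<=` A2]].
#[global] Arguments fiber {H K} beta gamma A B _ : rename.

(* phi * psi, where LS and LT are the semi-intertwiners of phi and psi. *)
Definition fiber_map (H H' K K' : hilbertType R)
    (beta : set 'L(Z, H)) (beta' : set 'L(Z, H'))
    (gamma : set 'L(Z, K)) (gamma' : set 'L(Z, K'))
    (LS : set 'L(H, H')) (LT : set 'L(K, K')) (x : 'L(rt beta gamma, rt beta gamma)) :
    'L(rt beta' gamma', rt beta' gamma') :=
  xget 0 [set y : 'L(rt beta' gamma', rt beta' gamma') | forall S T, LS S -> LT T ->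
    y ** otens beta beta' gamma gamma' S T = otens beta beta' gamma gamma' S T ** x].

#[global] Arguments fiber_map {H H' K K'} beta beta' gamma gamma' LS LT x.

Definition coassociative (H : hilbertType R) (A : set 'L(H, H))
    (beta alpha : set 'L(Z, H)) (Delta : 'L(H, H) -> 'L(rt alpha beta, rt alpha beta)) :=
  let bb := ltri alpha beta beta in
  let aa := rtri alpha beta alpha in
  let Lid := semi_intertwiners A beta alpha beta alpha id in
  let LDelta := semi_intertwiners A beta alpha bb aa Delta in
  let Delta_id := fiber_map alpha aa beta beta LDelta Lid in
  let id_Delta := fiber_map alpha alpha beta bb Lid LDelta in
  forall a, A a ->
    assoc alpha beta alpha beta ** Delta_id (Delta a) =
    id_Delta (Delta a) ** assoc alpha beta alpha beta.
#[global] Arguments coassociative {H} A beta alpha Delta.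

End HopfBimodules.

Section Unitaries.
Variables (R : realType) (Z : hilbertType R).

Definition hopf_bimodule (b : obase Z) (H : hilbertType R) (A : set 'L(H, H))
    (beta alpha : set 'L(Z, H)) (Delta : 'L(H, H) -> 'L(rt alpha beta, rt alpha beta)) :=
  [/\ cstar_base b,
      jointly_normal (dagger b) b A beta alpha
        (fiber alpha beta A A) (ltri alpha beta beta) (rtri alpha beta alpha) Delta &
      coassociative A beta alpha Delta].

#[global] Arguments hopf_bimodule b {H} A beta alpha Delta.

Variables (H : hilbertType R) (hbeta alpha beta : set 'L(Z, H)).
Implicit Type V : 'L(rt hbeta alpha, rt alpha beta).

(* [adj (assoc _ _ _ _)] is the inverse of the associativity unitary. *)
Definition V13 V :
    'L(rt hbeta (rtri alpha beta alpha), rt (ltri hbeta alpha alpha) beta) :=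
  flip23 alpha hbeta beta alpha
  ** opl (rtri hbeta alpha beta) (ltri alpha beta hbeta) alpha V
  ** adj (assoc hbeta alpha beta alpha)
  ** opr hbeta (rtri alpha beta alpha) (ltri beta alpha alpha) (flip alpha beta).

(* V23 V12 = V12 V13 V23, read as operators from ((H (x) H) (x) H) to
   (H (x) (H (x) H)) by inserting the associativity unitaries. *)
Definition pentagon V :=
  opr alpha (ltri hbeta alpha beta) (ltri alpha beta beta) V
  ** assoc alpha beta hbeta alpha
  ** opl (rtri hbeta alpha hbeta) (rtri alpha beta hbeta) alpha V
  = assoc alpha beta alpha beta
    ** opl (ltri hbeta alpha alpha) (rtri alpha beta alpha) beta V
    ** V13 V
    ** opr hbeta (ltri hbeta alpha alpha) (rtri alpha beta alpha) V
    ** assoc hbeta alpha hbeta alpha.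

Definition cpmu (b : obase Z) V :=
  [/\ cstar_base b, ctrimodule (dagger b) b (dagger b) hbeta alpha beta, unitary V,
      [/\ omul [set V] (ltri hbeta alpha alpha) = rtri alpha beta alpha,
          omul [set V] (rtri hbeta alpha beta) = ltri alpha beta hbeta,
          omul [set V] (rtri hbeta alpha hbeta) = rtri alpha beta hbeta &
          omul [set V] (ltri hbeta alpha beta) = ltri alpha beta beta] &
      pentagon V].

Definition semi_regular V :=
  cspan (omul alpha (oadj alpha)) `<=`
  cspan (omul (oadj (ket1 alpha beta @` alpha)) (omul [set V] (ket2 hbeta alpha @` alpha))).

Definition hatA V : set 'L(H, H) :=
  cspan (omul (oadj (ket2 alpha beta @` beta)) (omul [set V] (ket2 hbeta alpha @` alpha))).

Definition legA V : set 'L(H, H) :=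
  cspan (omul (oadj (ket1 alpha beta @` alpha)) (omul [set V] (ket1 hbeta alpha @` hbeta))).

(* Total functions; only their values on hatA V and legA V are used. *)
Definition hatDelta V (y : 'L(H, H)) : 'L(rt hbeta alpha, rt hbeta alpha) :=
  adj V ** opr alpha beta beta y ** V.

Definition legDelta V (z : 'L(H, H)) : 'L(rt alpha beta, rt alpha beta) :=
  V ** opl hbeta hbeta alpha z ** adj V.

End Unitaries.

(* Main.v *)
(* Let C = [<al|_1 V |al>_2], with al, be, hb for alpha, beta, hbeta.  Slicing the pentagon
   equation V_23 V_12 = V_12 V_13 V_23 in different ways gives A_V A_V <= A_V and
   [<al|_1 V (1 (x) C) V^* |al>_1] <= C.  As [al al^*] <= C, the latter contains C C^*,
   so C C^* <= C; the same for V^* with the legs exchanged gives C^* C <= C^*.  This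
   forces C = C^*: for T = x^* x / M the element x is the limit of x - x (1 - T)^n,
   and these lie in C^*.  Since A_V^* = [<hb|_1 V^* (C (x) 1) V |hb>_1], it follows
   that A_V = A_V^*.  Two more slices place V (a (x) 1) V^* in the fiber product.
   The V |f>_2, f in al, are morphisms intertwining Delta_V and their images are
   total, which is joint normality, and both iterated comultiplications of a equal
   V_12 V_13 (a (x) 1 (x) 1) (V_12 V_13)^* = V_23 V_12 (a (x) 1 (x) 1) (V_23 V_12)^*.
   The assertion for hatA_V is the one for A of the opposite unitary.

   All relative tensor products and operators between them exist because the Schur
   product of two positive operator matrices with commuting entries is positive. *)

From mathcomp Require Import all_boot all_order all_algebra complex.
From mathcomp Require Import boolp classical_sets functions reals topology.
From mathcomp Require Import normedtype sequences.
From mathcomp Require Import ring.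
Require Import Defs.

Set Implicit Arguments.
Unset Strict Implicit.
Unset Printing Implicit Defensive.
Import Order.TTheory GRing.Theory Num.Theory.
Import numFieldNormedType.Exports.
Local Open Scope classical_set_scope.
Local Open Scope ring_scope.

(** * Closed spans and bounded operators *)

(** The two assertions are exchanged by replacing V with its adjoint and reversing the order of the
    legs. In the given definitions this changes all spaces: a flip relates [rt al be] and
    [rt be al], and associators separate the bracketings of a threefold product, so each slice
    computation would be needed twice and drown in identifications. Hence the computations take
    place in abstract data: any space with two suitable families of kets is a relative tensor
    product ([rtp]), one space carries both bracketings ([triple]), and [pdata] lists a unitary
    together with its amplifications. Passing to the opposite unitary then only renames kets, and
    flips and associators are absorbed once, when [cmu_data] builds the data of V. The second
    obstacle is that kets, [rho] and amplifications are chosen by xget and are known to be linear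
    and bounded only on modules or semi-morphisms. Inductions over closed spans therefore carry
    membership in that domain as part of their predicate; this is the reason for the many goals of
    the form P x /\ Q (f x), from which only Q is kept. *)

Section ClosedSpans.
Variable R : realType.
Local Notation C := R[i].

Lemma closure_normP (V : normedModType C) (A : set V) p :
  closure A p <-> forall e, 0 < e -> exists2 x, A x & `|p - x| < e.
Proof.
split=> [h e e0|h B /nbhs_ballP[e /= e0 eB]].
  have [x [Ax xB]] := h _ (nbhsx_ballx p _ e0).
  by exists x => //; rewrite -ball_normE in xB.
have [x Ax px] := h e e0; exists x; split=> //; apply: eB.
by rewrite -ball_normE.
Qed.

Section LinearSpan.
Variable V : lmodType C.
Implicit Types (A : set V) (x y : V).

Lemma lspan0 A : lspan A 0.
Proof. by exists [::] => //; rewrite big_nil. Qed.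

Lemma lspan_sub A : A `<=` lspan A.
Proof.
move=> x Ax; exists [:: (1, x)]; last by rewrite big_seq1 scale1r.
by move=> p; rewrite inE => /eqP->.
Qed.

Lemma lspanP A a x y : lspan A x -> lspan A y -> lspan A (a *: x + y).
Proof.
move=> [s sA ->] [t tA ->].
exists ([seq (a * p.1, p.2) | p <- s] ++ t); last first.
  rewrite big_cat big_map /= scaler_sumr; congr (_ + _).
  by apply: eq_bigr => p _; rewrite scalerA.
move=> p; rewrite mem_cat => /orP[/mapP[q qs ->]|]; last exact: tA.
exact: (sA q).
Qed.

Lemma lspan_min A (P : set V) : P 0 ->
  (forall a x y, P x -> P y -> P (a *: x + y)) -> A `<=` P -> lspan A `<=` P.
Proof.
move=> P0 PD AP x [s sA ->].
elim: s sA => [|p s IHs] sA; first by rewrite big_nil.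
rewrite big_cons; apply: PD.
  by apply/AP/sA; rewrite inE eqxx.
by apply: IHs => q qs; apply: sA; rewrite inE qs orbT.
Qed.

End LinearSpan.

Section ClosedSubspaces.
Variable V : normedModType C.
Implicit Types (A P : set V) (x y : V).

Lemma cspan_closed A : closed_subspace (cspan A).
Proof.
split; first exact: closed_closure.
  exact/subset_closure/lspan0.
move=> a x y /closure_normP hx /closure_normP hy; apply/closure_normP => e e0.
have a0 : 0 < `|a| + 1 by rewrite ltr_wpDl ?normr_ge0 ?ltr01.
have e2 : 0 < e / 2 by rewrite divr_gt0 ?ltr0n.
have [x' Ax' xx'] := hx _ (divr_gt0 e2 a0).
have [y' Ay' yy'] := hy _ e2.
exists (a *: x' + y'); first exact: lspanP.
rewrite opprD addrACA -scalerBr [e]splitr.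
apply: le_lt_trans (ler_normD _ _) _; apply: ltrD => //.
rewrite normrZ; apply: le_lt_trans (_ : (`|a| + 1) * `|x - x'| < _).
  by rewrite ler_wpM2r ?normr_ge0 // lerDl ler01.
by rewrite mulrC -ltr_pdivlMr.
Qed.

Lemma cspan_sub A : A `<=` cspan A.
Proof. by move=> x /lspan_sub/subset_closure. Qed.

Lemma cspan_min A P : closed_subspace P -> A `<=` P -> cspan A `<=` P.
Proof.
move=> [cP P0 PD] AP; have := closureS (lspan_min P0 PD AP).
by move/closure_id: cP => <-.
Qed.

Lemma cspan_mono A P : A `<=` P -> cspan A `<=` cspan P.
Proof.
move=> AP; apply: cspan_min; first exact: cspan_closed.
exact: subset_trans AP (@cspan_sub P).
Qed.

Lemma csub0 A : closed_subspace A -> A 0.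
Proof. by case. Qed.

Lemma csubD A x y : closed_subspace A -> A x -> A y -> A (x + y).
Proof. by move=> [_ _ h] Ax Ay; rewrite -[x]scale1r; exact: h. Qed.

Lemma csubZ A a x : closed_subspace A -> A x -> A (a *: x).
Proof. by move=> [_ A0 h] Ax; rewrite -[_ *: _]addr0; exact: h. Qed.

Lemma csubB A x y : closed_subspace A -> A x -> A y -> A (x - y).
Proof. by move=> cA Ax Ay; apply: csubD => //; rewrite -scaleN1r; exact: csubZ. Qed.

Lemma csub_closure A x : closed_subspace A ->
  (forall e, 0 < e -> exists2 y, A y & `|x - y| < e) -> A x.
Proof.
by move=> [cA _ _] h; move/closure_id: cA => ->; apply/closure_normP.
Qed.

Lemma csubI A P : closed_subspace A -> closed_subspace P -> closed_subspace (A `&` P).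
Proof.
move=> [cA A0 AD] [cP P0 PD]; split; first exact: closedI.
  by split.
by move=> a x y [Ax Px] [Ay Py]; split; [exact: AD|exact: PD].
Qed.

Lemma csub_all (I : Type) (D : set I) (F : I -> set V) :
  (forall i, D i -> closed_subspace (F i)) ->
  closed_subspace [set x | forall i, D i -> F i x].
Proof.
move=> cF; split.
- apply/closure_id/seteqP; split; first exact: subset_closure.
  move=> x /closure_normP hx i Di; apply: (csub_closure (cF i Di)) => e /hx[y hy xy].
  by exists y => //; exact: hy.
- by move=> i /cF; exact: csub0.
- by move=> a x y hx hy i Di; have [_ _ h] := cF i Di; apply: h; [exact: hx|exact: hy].
Qed.

Lemma csubT : closed_subspace [set: V].
Proof. by split=> //; exact: closedT. Qed.

End ClosedSubspaces.

(* [f] is only required to be (semi)linear and bounded on [D], since most maps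
   below are given by xget and are meaningless outside a closed subspace. *)
Lemma csub_preim_on (V W : normedModType C) (D : set V) (P : set W) (f : V -> W)
    (g : C -> C) (M : C) :
  closed_subspace D -> closed_subspace P ->
  (forall a x y, D x -> D y -> f (a *: x + y) = g a *: f x + f y) ->
  (forall x, D x -> `|f x| <= M * `|x|) ->
  closed_subspace [set x | D x /\ P (f x)].
Proof.
move=> cD cP fL fM; have [clD D0 DL] := cD.
have f0 : f 0 = 0.
  by apply/eqP; rewrite -normr_le0; have := fM 0 D0; rewrite normr0 mulr0.
split; last first.
- move=> a x y [Dx Px] [Dy Py]; split; first exact: DL.
  rewrite fL //; have [_ _ PL] := cP; exact: PL.
- by split=> //; rewrite f0; exact: csub0.
apply/closure_id/seteqP; split; first exact: subset_closure.
move=> x /closure_normP hx.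
have Dx : D x.
  by apply: csub_closure => // e /hx[y [Dy _] xy]; exists y.
split=> //; apply: csub_closure => // e e0.
have M0 : 0 < `|M| + 1 by rewrite ltr_wpDl ?normr_ge0 ?ltr01.
have [y [Dy Py] xy] := hx _ (divr_gt0 e0 M0).
exists (f y) => //.
have fB : f x - f y = f (x - y).
  have h := fL 1 (x - y) y; rewrite scale1r subrK in h.
  have Dxy : D (x - y) by exact: csubB.
  (* [g] is arbitrary, so g 1 = 1 is not known; the linearity hypothesis with second argument 0
     shows that g 1 fixes this vector. *)
  have f1 : g 1 *: f (x - y) = f (x - y).
    by have := fL 1 (x - y) 0 Dxy D0; rewrite scale1r !addr0 f0 addr0.
  by rewrite h // f1 addrK.
rewrite fB.
have Dxy : D (x - y) by exact: csubB.
apply: le_lt_trans (fM _ Dxy) _.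
apply: le_lt_trans (_ : (`|M| + 1) * `|x - y| < _); last first.
  by rewrite mulrC -ltr_pdivlMr.
(* [M] is any complex number; at a nonzero argument the bound itself forces M >= 0. *)
have [->|n0] := eqVneq `|x - y| 0; first by rewrite !mulr0.
have np : 0 < `|x - y| by rewrite lt_def n0 normr_ge0.
have : 0 <= M * `|x - y| by apply: le_trans (fM _ Dxy).
rewrite pmulr_lge0 // => MM; rewrite ler_wpM2r // (ger0_norm MM).
by rewrite lerDl ler01.
Qed.

Lemma csub_preim (V W : normedModType C) (P : set W) (f : V -> W)
    (g : C -> C) (M : C) : closed_subspace P ->
  (forall a x y, f (a *: x + y) = g a *: f x + f y) ->
  (forall x, `|f x| <= M * `|x|) -> closed_subspace [set x | P (f x)].
Proof.
move=> cP fL fM.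
have -> : [set x | P (f x)] = [set x | [set: V] x /\ P (f x)].
  by apply/seteqP; split=> x // [].
apply: (csub_preim_on (g := g) (M := M)) => //; exact: csubT.
Qed.

End ClosedSpans.

Section Operators.
Variable R : realType.
Local Notation C := R[i].
Implicit Types H K L M : hilbertType R.

Lemma hdotBr H (x y z : H) : hdot x (y - z) = hdot x y - hdot x z.
Proof. by rewrite -scaleN1r hdotDr hdotZr mulN1r. Qed.

Lemma hdot0r H (x : H) : hdot x 0 = 0.
Proof. by rewrite -(scale0r x) hdotZr mul0r. Qed.

Lemma hdot0l H (x : H) : hdot 0 x = 0.
Proof. by rewrite hdotC hdot0r rmorph0. Qed.

Lemma hdot_sumr H (x : H) (I : Type) (s : seq I) (f : I -> H) :
  hdot x (\sum_(i <- s) f i) = \sum_(i <- s) hdot x (f i).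
Proof.
by elim/big_rec2: _ => [|i a b _ <-]; rewrite ?hdot0r ?hdotDr.
Qed.

Lemma hdot_suml H (x : H) (I : Type) (s : seq I) (f : I -> H) :
  hdot (\sum_(i <- s) f i) x = \sum_(i <- s) hdot (f i) x.
Proof.
by elim/big_rec2: _ => [|i a b _ <-]; rewrite ?hdot0l ?hdotDl.
Qed.

Lemma adjPl H K (T : 'L(H, K)) x y : hdot (adj T y) x = hdot y (T x).
Proof. by rewrite hdotC -adjP -hdotC. Qed.

Lemma adj_uniq H K (T : 'L(H, K)) (S : 'L(K, H)) :
  (forall x y, hdot (T x) y = hdot x (S y)) -> adj T = S.
Proof.
move=> h; apply: bop_ext => y; apply: hdot_inj => x.
by rewrite adjPl [in LHS]hdotC h -hdotC.
Qed.

Lemma adjK H K (T : 'L(H, K)) : adj (adj T) = T.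
Proof. by apply: adj_uniq => x y; rewrite adjPl. Qed.

Lemma adj_comp H K L (S : 'L(K, L)) (T : 'L(H, K)) : adj (S ** T) = adj T ** adj S.
Proof. by apply: adj_uniq => x y; rewrite /= -!adjP. Qed.

Lemma bopDE H K (S T : 'L(H, K)) x : (S + T) x = S x + T x.
Proof. by []. Qed.

Lemma bopZE H K (a : C) (T : 'L(H, K)) x : (a *: T) x = a *: T x.
Proof. by []. Qed.

Lemma bop0E H K x : (0 : 'L(H, K)) x = 0.
Proof. by []. Qed.

Lemma bopBE H K (S T : 'L(H, K)) x : (S - T) x = S x - T x.
Proof. by []. Qed.

Lemma adjL H K (a : C) (S T : 'L(H, K)) : adj (a *: S + T) = a^* *: adj S + adj T.
Proof.
apply: adj_uniq => x y.
by rewrite !bopDE !bopZE hdotDl hdotZl hdotDr hdotZr !adjP.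
Qed.

Lemma adjZ H K (a : C) (S : 'L(H, K)) : adj (a *: S) = a^* *: adj S.
Proof.
by apply: adj_uniq => x y; rewrite !bopZE hdotZl hdotZr !adjP.
Qed.

Lemma adjB H K (S T : 'L(H, K)) : adj (S - T) = adj S - adj T.
Proof.
by apply: adj_uniq => x y; rewrite !bopBE hdotBl hdotBr !adjP.
Qed.

Lemma app_scale H K (T : 'L(H, K)) a x : a *: T x = T (a *: x).
Proof. by rewrite linearZ. Qed.

Lemma app_sub H K (T : 'L(H, K)) x y : T (x - y) = T x - T y.
Proof. by rewrite linearB. Qed.

Lemma adjD H K (S T : 'L(H, K)) : adj (S + T) = adj S + adj T.
Proof.
by apply: adj_uniq => x y; rewrite !bopDE hdotDl hdotDr !adjP.
Qed.

Lemma adj0 H K : adj (0 : 'L(H, K)) = 0.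
Proof. by apply: adj_uniq => x y; rewrite !bop0E hdot0l hdot0r. Qed.

Lemma adj_id H : adj (bid H) = bid H.
Proof. by apply: adj_uniq. Qed.

Lemma compA H K L M (S : 'L(L, M)) (T : 'L(K, L)) (U : 'L(H, K)) :
  S ** (T ** U) = S ** T ** U.
Proof. exact: bop_ext. Qed.

Lemma compDl H K L (S S' : 'L(K, L)) (T : 'L(H, K)) : (S + S') ** T = S ** T + S' ** T.
Proof. exact: bop_ext. Qed.

Lemma compBl H K L (S S' : 'L(K, L)) (T : 'L(H, K)) : (S - S') ** T = S ** T - S' ** T.
Proof. exact: bop_ext. Qed.

Lemma compDr H K L (S : 'L(K, L)) (T T' : 'L(H, K)) : S ** (T + T') = S ** T + S ** T'.
Proof. by apply: bop_ext => x; rewrite /= linearD. Qed.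

Lemma compBr H K L (S : 'L(K, L)) (T T' : 'L(H, K)) : S ** (T - T') = S ** T - S ** T'.
Proof. by apply: bop_ext => x; rewrite /= linearB. Qed.

Lemma compZl H K L a (S : 'L(K, L)) (T : 'L(H, K)) : (a *: S) ** T = a *: (S ** T).
Proof. exact: bop_ext. Qed.

Lemma compZr H K L a (S : 'L(K, L)) (T : 'L(H, K)) : S ** (a *: T) = a *: (S ** T).
Proof. by apply: bop_ext => x; rewrite /= linearZ. Qed.

Lemma comp1l H K (S : 'L(H, K)) : bid K ** S = S.
Proof. exact: bop_ext. Qed.

Lemma comp1r H K (S : 'L(H, K)) : S ** bid H = S.
Proof. exact: bop_ext. Qed.

Lemma comp0l H K L (T : 'L(H, K)) : (0 : 'L(K, L)) ** T = 0.
Proof. exact: bop_ext. Qed.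

Lemma comp_norm H K L (S : 'L(K, L)) (T : 'L(H, K)) : `|S ** T| <= `|S| * `|T|.
Proof.
apply: opnorm_le => [|x]; first by rewrite mulr_ge0 ?opnorm_ge0.
rewrite -mulrA; apply: le_trans (le_opnorm S _) _.
by rewrite ler_wpM2l ?opnorm_ge0 // le_opnorm.
Qed.

Lemma adj_norm_le H K (T : 'L(H, K)) : `|adj T| <= `|T|.
Proof.
apply: opnorm_le => [|y]; first exact: opnorm_ge0.
have [->|Sv] := eqVneq (adj T y) 0; first by rewrite normr0 mulr_ge0.
rewrite -(ler_pM2r (_ : 0 < `|adj T y|)) ?normr_gt0 // -expr2 hnormE adjPl.
rewrite -[leLHS]ger0_norm; last by rewrite -adjPl hdot_ge0.
apply: le_trans (hdot_CS _ _) _.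
by rewrite [`|T| * _]mulrC -mulrA ler_wpM2l // le_opnorm.
Qed.

Lemma adj_norm H K (T : 'L(H, K)) : `|adj T| = `|T|.
Proof. by apply/eqP; rewrite eq_le adj_norm_le -{1}(adjK T) adj_norm_le. Qed.

Lemma csub_compl H K L (T : 'L(K, L)) (P : set 'L(H, L)) : closed_subspace P ->
  closed_subspace [set S | P (T ** S)].
Proof.
move=> cP; apply: (csub_preim (g := id) (M := `|T|) (f := fun S => T ** S)) => //.
  by move=> a x y; rewrite compDr compZr.
by move=> x; exact: comp_norm.
Qed.

Lemma csub_compr H K L (T : 'L(H, K)) (P : set 'L(H, L)) : closed_subspace P ->
  closed_subspace [set S : 'L(K, L) | P (S ** T)].
Proof.
move=> cP; apply: (csub_preim (g := id) (M := `|T|) (f := fun S => S ** T)) => //.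
  by move=> a x y; rewrite compDl compZl.
by move=> x /=; rewrite mulrC; exact: comp_norm.
Qed.

Lemma csub_adj H K (P : set 'L(K, H)) : closed_subspace P ->
  closed_subspace [set S : 'L(H, K) | P (adj S)].
Proof.
move=> cP; apply: (csub_preim (g := fun a => a^*) (M := 1) (f := @adj R H K)) => //.
  by move=> a x y; rewrite adjL.
by move=> x; rewrite mul1r adj_norm.
Qed.

Lemma csub_app H K (T : 'L(H, K)) (P : set K) : closed_subspace P ->
  closed_subspace [set x | P (T x)].
Proof.
move=> cP; apply: (csub_preim (g := id) (M := `|T|) (f := T)) => //.
  by move=> a x y; rewrite linearP.
exact: le_opnorm.
Qed.

(** With P = {0} the preimage lemmas make solution sets of linear equations closed subspaces, so
    that identities between bounded operators can be proved on generators. *)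
Lemma csub_single0 (V : normedModType C) : closed_subspace [set 0 : V].
Proof.
split=> //; last by move=> a x y -> ->; rewrite scaler0 addr0.
apply/closure_id/seteqP; split; first exact: subset_closure.
move=> x /closure_normP h; apply/eqP; rewrite -normr_le0.
have [-> //|n0] := eqVneq `|x| 0.
have np : 0 < `|x| by rewrite lt_def n0 normr_ge0.
by have [y -> ] := h _ np; rewrite subr0 ltxx.
Qed.

Lemma total_ext H K (X : set H) (S T : 'L(H, K)) : cspan X = setT ->
  (forall x, X x -> S x = T x) -> S = T.
Proof.
move=> XT h; apply: bop_ext => x; apply/eqP; rewrite -subr_eq0 -bopBE; apply/eqP.
have : cspan X x by rewrite XT.
apply: cspan_min (csub_app (S - T) (csub_single0 K)) _ x => x /h e /=.
by apply/eqP; rewrite subr_eq0; apply/eqP.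
Qed.

Lemma total_omul H K L (A : set 'L(K, L)) (B : set 'L(H, K)) :
  cspan (oapp A setT) = setT -> cspan (oapp B setT) = setT ->
  cspan (oapp (omul A B) setT) = setT.
Proof.
move=> At Bt; apply/seteqP; split=> // x _.
have : cspan (oapp A setT) x by rewrite At.
apply: cspan_min (cspan_closed _) _ _ => _ [S AS [y _ <-]].
have : cspan (oapp B setT) y by rewrite Bt.
apply: cspan_min (csub_app S (cspan_closed _)) _ _ => _ [T BT [z _ <-]] /=.
apply: cspan_sub; exists (S ** T); last by exists z.
by exists S => //; exists T.
Qed.

Lemma unitary_comp H K L (S : 'L(K, L)) (T : 'L(H, K)) :
  unitary S -> unitary T -> unitary (S ** T).
Proof.
move=> [s1 s2] [t1 t2]; split; rewrite adj_comp.
  by rewrite compA -[_ ** adj S ** S]compA s1 comp1r.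
by rewrite compA -[_ ** T ** adj T]compA t2 comp1r.
Qed.

Lemma unitary_adj H K (T : 'L(H, K)) : unitary T -> unitary (adj T).
Proof. by move=> [t1 t2]; split; rewrite adjK. Qed.

Lemma total_unitary H K (X : set H) (T : 'L(H, K)) : unitary T -> cspan X = setT ->
  cspan (T @` X) = setT.
Proof.
move=> [t1 t2] XT; apply/seteqP; split=> // y _.
have -> : y = T (adj T y) by rewrite -[RHS]/((T ** adj T) y) t2.
have : cspan X (adj T y) by rewrite XT.
apply: cspan_min (csub_app T (cspan_closed _)) _ _ => x Xx /=.
by apply: cspan_sub; exists x.
Qed.

End Operators.

(** * Positivity and extension of operators *)

Section CommutingPositive.
Variables (R : realType).
Local Notation C := R[i].
Variables (W : lmodType C) (F : W -> W -> C).
Hypothesis FD : forall x y z, F x (y + z) = F x y + F x z.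
Hypothesis FZ : forall a x y, F x (a *: y) = a * F x y.
Hypothesis FC : forall x y, F y x = (F x y)^*.
Hypothesis F0 : forall x, 0 <= F x x.

Let FBr x y z : F x (y - z) = F x y - F x z.
Proof. by rewrite -scaleN1r FD FZ mulN1r. Qed.

Let FBl x y z : F (y - z) x = F y x - F z x.
Proof. by rewrite FC FBr rmorphB /= -!FC. Qed.

Variable B : W -> W.
Hypothesis Bsub : {morph B : x y / x - y}.
Hypothesis B0 : forall x, 0 <= F x (B x).

Let good (A : W -> W) := [/\ {morph A : x y / x - y},
  forall x y, F x (A y) = F (A x) y, forall x, 0 <= F x (A x) <= F x x &
  forall x, A (B x) = B (A x)].

Let step (A : W -> W) x := A x - A (A x).

Let step_ge0 A x : good A -> 0 <= F x (step A x).
Proof.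
move=> [As Ay A0 _].
(* A - A^2 = A (1 - A) A + (1 - A) A (1 - A), where A <= 1 controls the first term and A >= 0 the
   second. *)
have -> : F x (step A x) = (F (A x) (A x) - F (A x) (A (A x))) +
   F (x - A x) (A (x - A x)).
  by rewrite /step As !FBr !FBl -!Ay; ring.
rewrite addr_ge0 ?subr_ge0 //; first by have /andP[] := A0 (A x).
by have /andP[] := A0 (x - A x).
Qed.

Let good_step A : good A -> good (step A).
Proof.
move=> gA; have [As Ay A0 Ac] := gA; split.
- move=> x y; rewrite /step !As !opprB [A (A y) - A (A x)]addrC addrACA.
  by rewrite [- A y + _]addrC.
- by move=> x y; rewrite /step FBr FBl -!Ay.
- move=> x; rewrite step_ge0 //= /step FBr -subr_ge0.
  have -> : F x x - (F x (A x) - F x (A (A x))) =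
    (F x x - F x (A x)) + F (A x) (A x) by rewrite -Ay; ring.
  by rewrite addr_ge0 // subr_ge0; have /andP[] := A0 x.
- by move=> x; rewrite /step Bsub !Ac.
Qed.

Let step_norm A x : good A -> F (step A x) (step A x) <= F (A x) (A x).
Proof.
move=> gA; have [As Ay A0 _] := gA; rewrite /step.
set y := A x; rewrite FBr !FBl -subr_ge0.
(* A^2 - (A - A^2)^2 = A (A + (A - A^2)) A, evaluated with y = A x. *)
have -> : F y y - (F y y - F (A y) y - (F y (A y) - F (A y) (A y))) =
   F y (A y) + F y (step A y) by rewrite /step FBr -!Ay; ring.
by rewrite addr_ge0 ?step_ge0 //; have /andP[] := A0 y.
Qed.

(* Riesz-Nagy: with A_0 = A and A_(n+1) = A_n - A_n^2, one has A = sum_n A_n^2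
   strongly, so that A B = sum_n A_n B A_n. *)
Lemma commuting_pos1 (A : W -> W) x : {morph A : x y / x - y} ->
  (forall x y, F x (A y) = F (A x) y) -> (forall x, 0 <= F x (A x) <= F x x) ->
  (forall x, A (B x) = B (A x)) -> 0 <= F x (A (B x)).
Proof.
move=> As Ay A0 Ac; pose An n := iter n step A.
have gA n : good (An n) by elim: n => [|n]; [split|exact: good_step].
have AnS n y : An n.+1 y = An n y - An n (An n y) by [].
have tel (B' : W -> W) n : (forall k y, An k (B' y) = B' (An k y)) ->
    F x (A (B' x)) = \sum_(k < n) F (An k x) (B' (An k x)) + F x (An n (B' x)).
  move=> Bc; elim: n => [|n IH]; first by rewrite big_ord0 add0r.
  rewrite big_ord_recr IH -addrA; congr (_ + _).
  have [_ Ay' _ _] := gA n.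
  by rewrite AnS FBr [F x (An n (An n (B' x)))]Ay' Bc addrC subrK.
pose t k := F (An k x) (An k x).
have tS k : t k.+1 <= t k by exact: step_norm.
have tle k n : (k <= n)%N -> t n <= t k.
  by move=> /subnK<-; elim: (n - k)%N => // m; apply: le_trans; exact: tS.
have St n : \sum_(k < n) t k <= F x (A x).
  rewrite (tel id n) // lerDl; have [_ _ h _] := gA n.
  by have /andP[] := h x.
(* The t k decrease and the first n + 1 of them sum to at most <x, A x>, so the last one is at most
   their mean. *)
have tn n : t n <= n.+1%:R^-1 * F x (A x).
  rewrite -ler_pdivrMl ?invr_gt0 ?ltr0n // invrK; apply: le_trans (St n.+1).
  rewrite mulr_natl -[n.+1 in leLHS]card_ord -sumr_const.
  by apply: ler_sum => k _; apply: tle; rewrite -ltnS.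
(* By Cauchy-Schwarz the remainder satisfies |<x, A_n B x>|^2 <= t n <B x, B x> <= c / (n + 1). *)
pose c := F x (A x) * F (B x) (B x).
have c0 : 0 <= c by rewrite mulr_ge0 //; have /andP[] := A0 x.
have c1 : 0 < c + 1 by rewrite ltr_wpDl ?ltr01.
pose u n := \sum_(k < n) F (An k x) (B (An k x)).
apply: (@clim_ge0 _ u); last by move=> n; apply: sumr_ge0.
move=> e e0; have [N hN] := small_inv (divr_gt0 (exprn_gt0 2 e0) c1).
exists N => n /hN{}hN; have [_ An_sym _ _] := gA n.
have -> : u n - F x (A (B x)) = - F x (An n (B x)).
  rewrite (tel B n) ?opprD ?addrA ?subrr ?add0r // => k y.
  by have [_ _ _ ->] := gA k.
rewrite normrN -(@ltr_pXn2r _ 2) ?nnegrE ?(ltW e0) // An_sym.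
apply: le_lt_trans (semi_CS2 FD FZ FC F0 _ _) _.
apply: le_lt_trans (_ : n.+1%:R^-1 * c < _).
  by rewrite mulrA; apply: ler_wpM2r; [exact: F0 | exact: tn].
apply: le_lt_trans (_ : n.+1%:R^-1 * (c + 1) < _).
  by rewrite ler_wpM2l ?invr_ge0 ?ler0n // lerDl ler01.
by rewrite -ltr_pdivlMr.
Qed.

Lemma commuting_pos (A : W -> W) (M : C) x : linear A ->
  (forall x y, F x (A y) = F (A x) y) -> (forall x, 0 <= F x (A x) <= M * F x x) ->
  (forall a x, B (a *: x) = a *: B x) -> (forall x, A (B x) = B (A x)) ->
  0 <= F x (A (B x)).
Proof.
move=> Al Ay A0 BZ Ac.
have A00 : A 0 = 0 by have := Al (-1) 0 0; rewrite scaleN1r oppr0 addr0 scaleN1r addNr.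
have AZ a y : A (a *: y) = a *: A y by have := Al a y 0; rewrite A00 !addr0.
(* Rescaling by N turns 0 <= A <= M into 0 <= A <= 1; the added 1 keeps N invertible when M = 0. *)
pose N := `|M| + 1; have N0 : 0 < N by rewrite ltr_wpDl ?ltr01.
have Ni : 0 < N^-1 by rewrite invr_gt0.
have N1r : (N^-1)^* = N^-1 by rewrite geC0_conj // ltW.
have FZl a y z : F (a *: y) z = a^* * F y z by rewrite FC FZ rmorphM /= -FC.
have := @commuting_pos1 (fun y => N^-1 *: A y) x.
rewrite FZ pmulr_rge0 //; apply.
- by move=> y z /=; rewrite [y - z]addrC -scaleN1r Al scaleN1r addrC scalerBr.
- by move=> y z; rewrite FZ FZl N1r Ay.
- move=> y; rewrite FZ; have /andP[h1 h2] := A0 y.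
  rewrite mulr_ge0 ?(ltW Ni) //= ler_pdivrMl //.
  apply: (le_trans h2); have [-> |n0] := eqVneq (F y y) 0; first by rewrite !mulr0.
  have np : 0 < F y y by rewrite lt_def n0 F0.
  have M0 : 0 <= M by rewrite -(pmulr_lge0 _ np); apply: le_trans h1 h2.
  by rewrite ler_wpM2r ?F0 // /N (ger0_norm M0) lerDl ler01.
- by move=> y; rewrite Ac BZ.
Qed.

End CommutingPositive.

Section Schur.
Variables (R : realType) (Z : hilbertType R) (I : finType).
Implicit Types (b c : I -> I -> 'L(Z, Z)).

Definition pos_matrix b := (forall i j, adj (b i j) = b j i) /\
  forall z : I -> Z, 0 <= \sum_i \sum_j hdot (z i) (b i j (z j)).

Lemma pos_matrix_bound b : pos_matrix b -> exists M, forall z : I -> Z,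
  \sum_i \sum_j hdot (z i) (b i j (z j)) <= M * \sum_i hdot (z i) (z i).
Proof.
move=> [_ b0]; exists (\sum_i \sum_j `|b i j|) => z.
rewrite -[leLHS]ger0_norm //; apply: le_trans (ler_norm_sum _ _ _) _.
rewrite mulr_suml; apply: ler_sum => i _.
apply: le_trans (ler_norm_sum _ _ _) _; rewrite mulr_suml; apply: ler_sum => j _.
have zle k : `|z k| ^+ 2 <= \sum_i hdot (z i) (z i).
  by rewrite (bigD1 k) //= -hnormE lerDl sumr_ge0 // => l _; rewrite hdot_ge0.
have S0 : 0 <= \sum_i hdot (z i) (z i) by rewrite sumr_ge0 // => k _; rewrite hdot_ge0.
apply: le_trans (hdot_CS _ _) _.
apply: le_trans (_ : `|z i| * (`|b i j| * `|z j|) <= _).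
  by rewrite ler_wpM2l // le_opnorm.
rewrite mulrCA ler_wpM2l // -(@ler_pXn2r _ 2) ?nnegrE ?mulr_ge0 //.
by rewrite exprMn [leRHS]expr2 ler_pM ?exprn_ge0.
Qed.

(* The Schur product is the compression to the diagonal of the product of the
   commuting positive operators b (x) 1 and 1 (x) c on I x I copies of Z. *)
Lemma schur_product b c : pos_matrix b -> pos_matrix c ->
  (forall i j k l, b i j ** c k l = c k l ** b i j) ->
  forall z : I -> Z, 0 <= \sum_i \sum_j hdot (z i) (b i j (c i j (z j))).
Proof.
move=> pb pc bc z; have [M hM] := pos_matrix_bound pb.
have [bs b0] := pb; have [cs c0] := pc.
pose W := {ffun I * I -> Z}.
pose F (x y : W) := \sum_p hdot (x p) (y p).
pose A (x : W) : W := [ffun p => \sum_j b p.1 j (x (j, p.2))].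
pose B (x : W) : W := [ffun p => \sum_l c p.2 l (x (p.1, l))].
have FD x y v : F x (y + v) = F x y + F x v.
  by rewrite -big_split; apply: eq_bigr => p _; rewrite ffunE hdotDr.
have FZ a x y : F x (a *: y) = a * F x y.
  by rewrite mulr_sumr; apply: eq_bigr => p _; rewrite ffunE hdotZr.
have FC x y : F y x = (F x y)^*.
  by rewrite rmorph_sum; apply: eq_bigr => p _; rewrite hdotC.
have F0 x : 0 <= F x x by apply: sumr_ge0 => p _; exact: hdot_ge0.
have FAE x y : F x (A y) = \sum_k \sum_i \sum_j hdot (x (i, k)) (b i j (y (j, k))).
  rewrite exchange_big pair_big; apply: eq_bigr => -[i k] _.
  by rewrite ffunE hdot_sumr.
have FBE x y : F x (B y) = \sum_i \sum_k \sum_l hdot (x (i, k)) (c k l (y (i, l))).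
  rewrite pair_big; apply: eq_bigr => -[i k] _.
  by rewrite ffunE hdot_sumr.
pose x : W := [ffun p => if p.1 == p.2 then z p.1 else 0].
have -> : \sum_i \sum_j hdot (z i) (b i j (c i j (z j))) = F x (A (B x)).
  rewrite FAE; apply: eq_bigr => i _.
  rewrite [RHS](bigD1 i) //= [X in _ = _ + X]big1 ?addr0; last first.
    move=> k ki; rewrite big1 // => j _.
    by rewrite ffunE /= (negbTE ki) hdot0l.
  apply: eq_bigr => j _; rewrite !ffunE /= eqxx.
  rewrite (bigD1 j) //= big1 ?addr0; first by rewrite ffunE eqxx.
  by move=> l lj; rewrite ffunE /= eq_sym (negbTE lj) linear0.
apply: (@commuting_pos _ _ F FD FZ FC F0 B _ _ A M x).
- move=> u v; apply/ffunP => p; rewrite !ffunE -sumrB; apply: eq_bigr => l _.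
  by rewrite !ffunE linearB.
- move=> u; rewrite FBE; apply: sumr_ge0 => i _.
  exact: (c0 (fun k => u (i, k))).
- move=> a u v; apply/ffunP => p; rewrite !ffunE scaler_sumr -big_split.
  by apply: eq_bigr => l _; rewrite !ffunE linearP.
- move=> u v; rewrite FAE [RHS]FC FAE rmorph_sum; apply: eq_bigr => k _.
  rewrite rmorph_sum exchange_big; apply: eq_bigr => j _.
  rewrite rmorph_sum; apply: eq_bigr => i _ /=.
  by rewrite -hdotC adjP bs.
- move=> u; rewrite FAE; apply/andP; split.
    by apply: sumr_ge0 => k _; exact: (b0 (fun i => u (i, k))).
  apply: le_trans (_ : \sum_k (M * \sum_i hdot (u (i, k)) (u (i, k))) <= _).
    by apply: ler_sum => k _; exact: (hM (fun i => u (i, k))).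
  rewrite -mulr_sumr exchange_big pair_big /F le_eqVlt; apply/orP; left.
  by apply/eqP; congr (_ * _); apply: eq_bigr => -[].
- move=> a u; apply/ffunP => p; rewrite !ffunE scaler_sumr.
  by apply: eq_bigr => l _; rewrite !ffunE linearZ.
- move=> u; apply/ffunP => -[i k]; rewrite !ffunE /=.
  under eq_bigr do rewrite ffunE linear_sum.
  under [RHS]eq_bigr do rewrite ffunE linear_sum.
  rewrite exchange_big; apply: eq_bigr => l _; apply: eq_bigr => j _ /=.
  by rewrite -[LHS]/((b i j ** c k l) _) bc.
Qed.

Lemma gram_pos_matrix (H : hilbertType R) (xi : I -> 'L(Z, H)) :
  pos_matrix (fun i j => adj (xi i) ** xi j).
Proof.
split=> [i j|z]; first by rewrite adj_comp adjK.
have -> : \sum_i \sum_j hdot (z i) ((adj (xi i) ** xi j) (z j)) =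
    hdot (\sum_i xi i (z i)) (\sum_i xi i (z i)).
  rewrite hdot_suml; apply: eq_bigr => i _; rewrite hdot_sumr.
  by apply: eq_bigr => j _; rewrite /= -adjP.
exact: hdot_ge0.
Qed.

(** This is |S|^2 - S^* S >= 0 compressed by the row of the xi. In this form the boundedness of S
    survives Schur multiplication by another Gram matrix. *)
Lemma contract_pos_matrix (H K : hilbertType R) (xi : I -> 'L(Z, H)) (S : 'L(H, K)) :
  pos_matrix (fun i j => `|S| ^+ 2 *: (adj (xi i) ** xi j) -
                         adj (S ** xi i) ** (S ** xi j)).
Proof.
split=> [i j|z].
  rewrite adjB adjZ !adj_comp !adjK geC0_conj ?exprn_ge0 //.
set v := \sum_i xi i (z i).
have -> : \sum_i \sum_j hdot (z i) ((`|S| ^+ 2 *: (adj (xi i) ** xi j) -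
    adj (S ** xi i) ** (S ** xi j)) (z j)) = `|S| ^+ 2 * hdot v v - hdot (S v) (S v).
  rewrite /v linear_sum !hdot_suml mulr_sumr -sumrB; apply: eq_bigr => i _.
  rewrite !hdot_sumr mulr_sumr -sumrB; apply: eq_bigr => j _.
  by rewrite bopBE bopZE hdotBr hdotZr /= -!adjP.
by rewrite subr_ge0 -!hnormE -exprMn ler_pXn2r ?nnegrE ?mulr_ge0 // le_opnorm.
Qed.

End Schur.

Section Extension.
Variables (R : realType) (X Y : hilbertType R).
Local Notation C := R[i].

(** The closure [G] of the graph spanned by the pairs (f i, g i) is linear and inherits the bound,
    hence is single-valued; the bound and the completeness of Y give it a value everywhere. *)
Lemma extend_operator (I : eqType) (D : set I) (f : I -> X) (g : I -> Y) (M : C) :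
  0 <= M -> cspan (f @` D) = setT ->
  (forall s : seq (C * I), (forall p, p \in s -> D p.2) ->
    `|\sum_(p <- s) p.1 *: g p.2| <= M * `|\sum_(p <- s) p.1 *: f p.2|) ->
  exists T : 'L(X, Y), (forall i, D i -> T (f i) = g i) /\ `|T| <= M.
Proof.
move=> M0 fT fM.
pose E : set (X * Y)%type := [set p | exists2 s : seq (C * I),
  (forall p, p \in s -> D p.2) &
  p = (\sum_(p <- s) p.1 *: f p.2, \sum_(p <- s) p.1 *: g p.2)].
pose G x y := forall e, 0 < e ->
  exists2 p, E p & `|x - p.1| < e /\ `|y - p.2| < e.
have EL a p q : E p -> E q -> E (a *: p.1 + q.1, a *: p.2 + q.2).
  move=> [s sD ->] [t tD ->] /=; exists ([seq (a * r.1, r.2) | r <- s] ++ t).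
    move=> r; rewrite mem_cat => /orP[/mapP[r' r's ->]|]; last exact: tD.
    exact: (sD r').
  by rewrite !big_cat !big_map /=; congr (_ + _, _ + _);
    rewrite scaler_sumr; apply: eq_bigr => r _; rewrite scalerA.
have Ele p : E p -> `|p.2| <= M * `|p.1| by move=> [s sD ->]; exact: fM.
have GL a x y x' y' : G x y -> G x' y' -> G (a *: x + x') (a *: y + y').
  move=> h h' e e0.
  have a0 : 0 < `|a| + 1 by rewrite ltr_wpDl ?normr_ge0 ?ltr01.
  have e2 : 0 < e / 2 by rewrite divr_gt0 ?ltr0n.
  have [p Ep [p1 p2]] := h _ (divr_gt0 e2 a0).
  have [q Eq [q1 q2]] := h' _ e2.
  exists (a *: p.1 + q.1, a *: p.2 + q.2); first exact: EL.
  have key (V : normedModType C) (u u' w w' : V) : `|u - u'| < e / 2 / (`|a| + 1) ->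
      `|w - w'| < e / 2 -> `|a *: u + w - (a *: u' + w')| < e.
    move=> hu hw; rewrite opprD addrACA -scalerBr [e]splitr.
    apply: le_lt_trans (ler_normD _ _) _; apply: ltrD => //.
    rewrite normrZ; apply: le_lt_trans (_ : (`|a| + 1) * `|u - u'| < _).
      by rewrite ler_wpM2r ?normr_ge0 // lerDl ler01.
    by rewrite mulrC -ltr_pdivlMr.
  by split; exact: key.
have Gle x y : G x y -> `|y| <= M * `|x|.
  move=> h; apply/ler_addgt0Pr => e e0.
  have M1 : 0 < 1 + M by rewrite ltr_wpDr ?ltr01.
  have [p Ep [p1 p2]] := h _ (divr_gt0 e0 M1).
  have h1 : `|y| <= e / (1 + M) + `|p.2|.
    by rewrite -{1}(subrK p.2 y); apply: le_trans (ler_normD _ _) _; rewrite lerD2r ltW.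
  have h2 : `|p.1| <= `|x| + e / (1 + M).
    rewrite -{1}(subrK x p.1) addrC; apply: le_trans (ler_normD _ _) _.
    by rewrite lerD2l distrC ltW.
  apply: le_trans h1 _; apply: le_trans (lerD (lexx _) (Ele p Ep)) _.
  apply: le_trans (lerD (lexx _) (ler_wpM2l M0 h2)) _.
  have -> : e / (1 + M) + M * (`|x| + e / (1 + M)) =
    M * `|x| + (1 + M) * (e / (1 + M)) by ring.
  by rewrite [(1 + M) * _]mulrC divfK ?gt_eqF.
have Guniq x y y' : G x y -> G x y' -> y = y'.
  move=> h h'; apply/eqP; rewrite -subr_eq0 -normr_le0.
  have := Gle _ _ (GL (-1) _ _ _ _ h' h).
  by rewrite !scaleN1r addNr normr0 mulr0 addrC.
have lE v : lspan (f @` D) v -> exists2 p, E p & p.1 = v.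
  apply: (@lspan_min _ _ _ [set v | exists2 p, E p & p.1 = v]) => //.
  - by exists (0, 0) => //; exists [::] => //; rewrite !big_nil.
  - move=> a _ _ [p Ep <-] [q Eq <-].
    by exists (a *: p.1 + q.1, a *: p.2 + q.2); [exact: EL|].
  - move=> _ [i Di <-]; exists (f i, g i) => //; exists [:: (1, i)].
      by move=> p; rewrite inE => /eqP->.
    by rewrite !big_seq1 !scale1r.
have EB p q : E p -> E q -> `|p.2 - q.2| <= M * `|p.1 - q.1|.
  move=> Ep Eq; have := Ele _ (EL (-1) _ _ Eq Ep) => /=.
  by rewrite !scaleN1r ![- _ + _]addrC.
have Gex x : exists y, G x y.
  have xc : cspan (f @` D) x by rewrite fT.
  have /choice[u hu] : forall n : nat, exists p, E p /\ `|x - p.1| < n.+1%:R^-1.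
    move=> n; have n0 : 0 < n.+1%:R^-1 :> C by rewrite invr_gt0 ltr0n.
    have /closure_normP/(_ _ n0)[v /lE[p Ep <-] xv] := xc.
    by exists p.
  have M1 : 0 < 1 + M by rewrite ltr_wpDr ?ltr01.
  have small e : 0 < e -> exists N, forall n m, (N <= n)%N -> (N <= m)%N ->
      `|(u n).2 - (u m).2| < e /\ `|x - (u n).1| < e.
    (* Two distances of e / (1 + M) / 2 add up to e / (1 + M), and M times that stays below e. *)
    move=> e0; have e1 : 0 < e / (1 + M) / 2 by rewrite !divr_gt0 ?ltr0n.
    have [N hN] := small_inv e1; have [N' hN'] := small_inv e0.
    exists (maxn N N') => n m; rewrite !geq_max => /andP[n1 n2] /andP[m1 m2].
    split; last exact: lt_trans (hu n).2 (hN' _ n2).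
    apply: le_lt_trans (EB _ _ (hu n).1 (hu m).1) _.
    apply: le_lt_trans (_ : M * (e / (1 + M)) < _).
      rewrite ler_wpM2l //; apply: le_trans (ler_distD x _ _) _.
      rewrite [leRHS]splitr; apply: lerD.
        rewrite distrC; exact: ltW (lt_trans (hu n).2 (hN _ n1)).
      exact: ltW (lt_trans (hu m).2 (hN _ m1)).
    rewrite mulrC mulrAC ltr_pdivrMr // ltr_pM2l //.
    by rewrite ltrDr ltr01.
  have /cauchy_cvg/cvg_ex[y hy] : cauchy ((fun n => (u n).2) @ \oo).
    apply/cauchy_exP => e e0; have [N hN] := small _ e0.
    exists (u N).2; exists N => // n Nn; rewrite /= -ball_normE /=.
    by have [] := hN N n (leqnn _) Nn.
  exists y => e e0; have [N hN] := small _ e0.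
  move/cvgrPdist_lt: hy => /(_ _ e0)[N' _ hN'].
  exists (u (maxn N N')); first exact: (hu _).1.
  split; last by apply: hN' => /=; rewrite leq_maxr.
  by have [] := hN _ _ (leq_maxl N N') (leqnn N).
have /choice[T hT] := Gex.
have TP : T \in @bop_pred R X Y.
  apply/asboolP; split; last by exists M => x; exact: Gle.
  by move=> a x y; apply: Guniq (hT _) _; exact: GL.
exists (Bop TP); split; last by apply: opnorm_le => // x; exact: Gle.
move=> i Di; apply: Guniq (hT _) _ => e e0.
exists (f i, g i); last by rewrite /= !subrr !normr0.
exists [:: (1, i)]; last by rewrite !big_seq1 !scale1r.
by move=> p; rewrite inE => /eqP->.
Qed.

End Extension.

(** * A criterion for self-adjointness of a closed subspace *)

Section StarClosed.
Variables (R : realType) (H : hilbertType R).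

(* x (1 - T)^n -> 0 in norm for T = x* x / M, so that x is the limit of the
   x - x (1 - T)^n, which are polynomials in x* x multiplied by x x* x. *)
Lemma star_closed (X : set 'L(H, H)) : closed_subspace X ->
  (forall x y, X x -> X y -> X (x ** adj y)) ->
  (forall x y, X x -> X y -> X (adj x ** y)) ->
  forall x, X x -> X (adj x).
Proof.
move=> cX Xr Xl x Xx; pose M := `|x| ^+ 2 + 1.
have M0 : 0 < M by rewrite ltr_wpDl ?ltr01 ?exprn_ge0.
have Mi : 0 <= M^-1 by rewrite invr_ge0 ltW.
pose T := M^-1 *: (adj x ** x); pose D := bid H - T.
have M0r : (M^-1)^* = M^-1 by rewrite geC0_conj.
have aT : adj T = T by rewrite adjZ M0r adj_comp adjK.
have aD : adj D = D by rewrite adjB adj_id aT.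
pose Dp k := iter k (fun S => S ** D) (bid H).
have DpD m n : Dp (m + n)%N = Dp m ** Dp n.
  elim: n => [|n IH]; first by rewrite addn0 comp1r.
  by rewrite addnS /= -/(Dp _) IH compA.
have aDp k : adj (Dp k) = Dp k.
  elim: k => [|k IH]; first exact: adj_id.
  rewrite /= -/(Dp k) adj_comp IH aD.
  have D1 : D = Dp 1%N by rewrite /= comp1l.
  by rewrite {1}D1 -DpD add1n.
pose d k u := hdot u (Dp k u).
have dD m n u : hdot (Dp m u) (Dp n u) = d (m + n)%N u.
  by rewrite -[Dp m u]/((Dp m) u) -{1}(aDp m) adjPl /d DpD.
have D0 u : 0 <= hdot u (D u).
  rewrite bopBE bopZE hdotBr hdotZr /= -adjP -!hnormE subr_ge0.
  rewrite ler_pdivrMl //; apply: le_trans (_ : (`|x| * `|u|) ^+ 2 <= _).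
    by rewrite ler_pXn2r ?nnegrE ?mulr_ge0 // le_opnorm.
  by rewrite exprMn ler_wpM2r ?exprn_ge0 // lerDl ler01.
have d0 k u : 0 <= d k u.
  rewrite -(odd_double_half k) -addnn; set m := k./2.
  case: (odd k); last by rewrite add0n -dD hdot_ge0.
  have -> : (true + (m + m))%N = (m.+1 + m)%N by [].
  rewrite /d DpD /= -/(Dp m) -[Dp m (D _)]/((Dp m) (D (Dp m u))) -{1}(aDp m).
  by rewrite -adjP; exact: D0.
(* e k = <u, T (1 - T)^k u> decreases in k, and its sum telescopes to d 0 - d n <= |u|^2. Hence e n
   <= |u|^2 / (n + 1), a bound uniform over the unit ball, which gives convergence in norm. *)
pose e k u := hdot u (T (Dp k u)).
have eE k u : e k u = d k u - d k.+1 u.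
  have -> : d k.+1 u = hdot u ((Dp 1%N ** Dp k) u) by rewrite -DpD add1n.
  by rewrite /e /d /= hdotBr opprB addrC subrK.
have eS k u : e k.+1 u <= e k u.
  rewrite -subr_ge0 !eE.
  have -> : d k u - d k.+1 u - (d k.+1 u - d k.+2 u) = d k (T u).
    have TE : T u = u - Dp 1%N u by rewrite /= opprB addrC subrK.
    have h1 : hdot (Dp 1%N u) (Dp k u) = d k.+1 u by rewrite dD add1n.
    have h2 : hdot u (Dp k (Dp 1%N u)) = d k.+1 u by rewrite /d -addn1 DpD.
    have h3 : hdot (Dp 1%N u) (Dp k (Dp 1%N u)) = d k.+2 u.
      by rewrite -[Dp k _]/((Dp k ** Dp 1%N) u) -DpD dD addn1 add1n.
    rewrite [d k (T u)]/d TE; move: (Dp 1%N u) h1 h2 h3 => w h1 h2 h3.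
    by rewrite (linearB (Dp k)) hdotBr !hdotBl h1 h2 h3.
  exact: d0.
have ele k n u : (k <= n)%N -> e n u <= e k u.
  by move=> /subnK<-; elim: (n - k)%N => // m; apply: le_trans; exact: eS.
have sume n u : \sum_(k < n) e k u = d 0%N u - d n u.
  elim: n => [|n IH]; first by rewrite big_ord0 subrr.
  by rewrite big_ord_recr /= IH eE addrA subrK.
have en n u : e n u <= n.+1%:R^-1 * `|u| ^+ 2.
  rewrite -ler_pdivrMl ?invr_gt0 ?ltr0n // invrK hnormE.
  apply: le_trans (_ : \sum_(k < n.+1) e k u <= _); last first.
    by rewrite sume lerBlDr lerDl d0.
  rewrite mulr_natl -[n.+1 in leLHS]card_ord -sumr_const.
  by apply: ler_sum => k _; apply: ele; rewrite -ltnS.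
pose xn n := x ** Dp n.
(* Each step subtracts y^* x / M with y = x x_n^* in X; the adjoint x^* y / M lies in X as well. *)
have xnP n : X (xn n) /\ X (adj (x - xn n)).
  elim: n => [|n [IH1 IH2]].
    rewrite /xn comp1r subrr adj0; split=> //; exact: csub0.
  have h1 : X (adj (x ** adj (xn n)) ** x) by apply: Xl => //; exact: Xr.
  have h2 : X (adj x ** (x ** adj (xn n))) by apply: Xl => //; exact: Xr.
  have xE : xn n.+1 = xn n - M^-1 *: (adj (x ** adj (xn n)) ** x).
    by rewrite /xn /= -/(Dp n) compA compBr comp1r compZr !adj_comp !adjK !compA.
  split; first by rewrite xE; apply: csubB => //; exact: csubZ.
  rewrite xE opprB addrCA addrC adjD adjZ M0r; apply: csubD => //.
  apply: csubZ => //.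
  by rewrite adj_comp adjK.
have xn_norm n : `|xn n| ^+ 2 <= n.+1%:R^-1 * M.
  have nM0 : 0 <= n.+1%:R^-1 * M by rewrite mulr_ge0 ?(ltW M0) ?invr_ge0 ?ler0n.
  rewrite -[leRHS]sqrtCK ler_pXn2r ?nnegrE ?sqrtC_ge0 //.
  apply: opnorm_le => [|u]; first by rewrite sqrtC_ge0.
  rewrite -(@ler_pXn2r _ 2) ?nnegrE ?mulr_ge0 ?sqrtC_ge0 // exprMn sqrtCK.
  (* |x_n u|^2 = <u, (1 - T)^n x^* x (1 - T)^n u>, and x^* x = M T commutes with 1 - T. *)
  have -> : `|xn n u| ^+ 2 = M * e (n + n)%N u.
    rewrite hnormE /xn /= adjP /e DpD.
    rewrite -[adj x (x _)]/((adj x ** x) (Dp n u)) -[RHS]hdotZr.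
    rewrite -[_ *: T _]/((M *: T) _) /T scalerA divff ?gt_eqF // scale1r.
    have cT : adj x ** x ** Dp n = Dp n ** (adj x ** x).
      have TD : T ** Dp n = Dp n ** T.
        have -> : T = bid H - Dp 1%N by rewrite /= comp1l opprB addrC subrK.
        by rewrite compBl compBr comp1l comp1r -!DpD addnC.
      have -> : adj x ** x = M *: T by rewrite scalerA divff ?gt_eqF // scale1r.
      by rewrite compZl compZr TD.
    rewrite -[(adj x ** x) ((Dp n ** Dp n) u)]/((adj x ** x ** Dp n) (Dp n u)).
    by rewrite cT -[RHS]/(hdot u (Dp n ((adj x ** x) (Dp n u)))) -[RHS]adjPl aDp.
  rewrite -mulrA mulrCA ler_pM2l // .
  apply: le_trans (en _ _) _; rewrite ler_wpM2r ?exprn_ge0 //.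
  by rewrite lef_pV2 ?posrE ?ltr0n // ler_nat ltnS leq_addr.
apply: csub_closure => // r r0.
have [N hN] := small_inv (divr_gt0 (exprn_gt0 2 r0) M0).
exists (adj (x - xn N)); first by have [] := xnP N.
rewrite -adjB opprB addrC subrK adj_norm.
rewrite -(@ltr_pXn2r _ 2) ?nnegrE ?(ltW r0) //.
apply: le_lt_trans (xn_norm N) _.
by rewrite -ltr_pdivlMr // hN.
Qed.

End StarClosed.

(** * Modules over C*-bases *)

(** The coefficients stay inside the vectors and the sums run over a finite type, so that the
    hypothesis has the shape produced by [gram_schur]. *)
Lemma extend_gram (R : realType) (X Y : hilbertType R) (I : eqType) (D : set I)
    (f : I -> X) (g : I -> Y) (M : R[i]) :
  0 <= M -> cspan (f @` D) = setT ->
  (forall (J : finType) (i : J -> I) (c : J -> R[i]), (forall j, D (i j)) ->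
    0 <= \sum_j \sum_k (M ^+ 2 * hdot (c j *: f (i j)) (c k *: f (i k))
                        - hdot (c j *: g (i j)) (c k *: g (i k)))) ->
  exists T : 'L(X, Y), (forall i, D i -> T (f i) = g i) /\ `|T| <= M.
Proof.
move=> M0 fT h; apply: (extend_operator M0 fT) => s sD.
rewrite -(@ler_pXn2r _ 2) ?nnegrE ?mulr_ge0 // exprMn !hnormE -subr_ge0.
have {}h := h _ (fun j => (tnth (in_tuple s) j).2) (fun j => (tnth (in_tuple s) j).1).
have E (V : hilbertType R) (u : I -> V) : hdot (\sum_(p <- s) p.1 *: u p.2)
    (\sum_(p <- s) p.1 *: u p.2) = \sum_j \sum_k
    hdot ((tnth (in_tuple s) j).1 *: u (tnth (in_tuple s) j).2)
         ((tnth (in_tuple s) k).1 *: u (tnth (in_tuple s) k).2).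
  rewrite big_tnth hdot_suml; apply: eq_bigr => j _; exact: hdot_sumr.
rewrite !E mulr_sumr -sumrB.
under eq_bigr do rewrite mulr_sumr -sumrB.
by apply: h => j /=; apply: sD; exact: (mem_tnth j (in_tuple s)).
Qed.

Section ModuleTheory.
Variables (R : realType) (Z : hilbertType R).
Implicit Types (b : obase Z).

Lemma dagger_base b : cstar_base b -> cstar_base (dagger b).
Proof. by move=> [h1 h2 h3]; split=> // x y hx hy; rewrite (h3 y x). Qed.

Section Module.
Variables (b : obase Z) (H : hilbertType R) (alpha : set 'L(Z, H)).
Hypothesis mA : cmodule b alpha.

Lemma cm_closed : closed_subspace alpha. Proof. by case: mA. Qed.

Lemma cm_total : cspan (oapp alpha setT) = setT. Proof. by case: mA. Qed.

Lemma cm_mul xi x : alpha xi -> alg b x -> alpha (xi ** x).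
Proof.
move=> hxi hx; case: mA => _ _ <- _; apply: cspan_sub.
by exists xi => //; exists x.
Qed.

Lemma cm_gram xi xi' : alpha xi -> alpha xi' -> alg b (adj xi ** xi').
Proof.
move=> h h'; case: mA => _ _ _ <-; apply: cspan_sub.
by exists (adj xi); [exists xi|exists xi'].
Qed.

Lemma cm_ext (K : hilbertType R) (S T : 'L(H, K)) :
  (forall xi, alpha xi -> S ** xi = T ** xi) -> S = T.
Proof.
move=> h; apply: (total_ext cm_total) => _ [xi hxi [z _ <-]].
by rewrite -[LHS]/((S ** xi) z) h.
Qed.

Lemma cm_ext_adj (K : hilbertType R) (S T : 'L(K, H)) :
  (forall xi, alpha xi -> adj xi ** S = adj xi ** T) -> S = T.
Proof.
move=> h; rewrite -(adjK S) -(adjK T); congr adj; apply: cm_ext => xi hxi.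
by rewrite -(adjK xi) -!adj_comp h.
Qed.

End Module.

Variable b : obase Z.
Hypothesis bB : cstar_base b.

Lemma cm_gram_comm (H : hilbertType R) (beta : set 'L(Z, H)) xi xi' y :
  cmodule b beta -> beta xi -> beta xi' -> algd b y ->
  adj xi ** xi' ** y = y ** (adj xi ** xi').
Proof.
move=> mB hx hx' hy; case: bB => _ _; apply => //; exact: (cm_gram mB).
Qed.

Lemma algd_adj x : algd b x -> algd b (adj x).
Proof. by move=> hx; case: bB => _ [[_ _ h] _] _; apply: h; exists x. Qed.

Lemma alg_adj x : alg b x -> alg b (adj x).
Proof. by move=> hx; case: bB => [[[_ _ h] _]] _ _; apply: h; exists x. Qed.

Lemma alg_algd x y : alg b x -> algd b y -> x ** y = y ** x.
Proof. by case: bB => _ _; exact. Qed.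

(** The instance of the Schur product behind the existence of kets, of [rho] and of tensor products
    of operators: Gram elements of a [cmodule b] lie in [alg b], so it is enough that the entries of
    M commute with [alg b]. *)
Lemma gram_schur (K : hilbertType R) (gamma : set 'L(Z, K)) (J : finType)
    (M : J -> J -> 'L(Z, Z)) (eta : J -> 'L(Z, K)) (z : J -> Z) :
  cmodule b gamma -> pos_matrix M ->
  (forall j k y, alg b y -> M j k ** y = y ** M j k) ->
  (forall j, gamma (eta j)) ->
  0 <= \sum_j \sum_k hdot (z j) (M j k (adj (eta j) (eta k (z k)))).
Proof.
move=> mG pM cM hg.
apply: (@schur_product _ _ J M (fun j k => adj (eta j) ** eta k)) => //.
  exact: gram_pos_matrix.
by move=> i j k l; apply: cM; exact: (cm_gram mG).
Qed.

End ModuleTheory.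

Section Rho.
Variables (R : realType) (Z H : hilbertType R) (b : obase Z) (alpha : set 'L(Z, H)).
Hypothesis bB : cstar_base b.
Hypothesis mA : cmodule b alpha.

Lemma total_pairs : cspan ((fun p : 'L(Z, H) * Z => p.1 p.2) @` [set p | alpha p.1]) = setT.
Proof.
rewrite -(cm_total mA); congr cspan; apply/seteqP; split.
  by move=> _ [p hp <-]; exists p.1 => //; exists p.2.
by move=> _ [xi hxi [z _ <-]]; exists (xi, z).
Qed.

Lemma rho_ex x : algd b x ->
  (forall xi, alpha xi -> rho alpha x ** xi = xi ** x) /\ `|rho alpha x| <= `|x|.
Proof.
move=> hx.
have [T [hT0 nT]] : exists T : 'L(H, H),
    (forall p : 'L(Z, H) * Z, alpha p.1 -> T (p.1 p.2) = p.1 (x p.2)) /\ `|T| <= `|x|.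
  apply: (extend_gram (f := fun p : 'L(Z, H) * Z => p.1 p.2)
           (g := fun p : 'L(Z, H) * Z => p.1 (x p.2)) (D := [set p | alpha p.1]))
           => //; first exact: total_pairs.
  move=> J p c hp.
  (* With the constant family of identities every entry is |x|^2 - x^* x. Its Schur product with the
     Gram matrix of the xi is the required form, because x commutes with the Gram elements. *)
  have := @gram_schur _ _ b H alpha J _
    (fun j => (p j).1) (fun j => c j *: (p j).2) mA (contract_pos_matrix (fun=> bid Z) x).
  move=> h; apply: le_trans (h _ hp) _; last first.
    apply: ler_sum => j _; apply: ler_sum => k _.
    have cx := cm_gram_comm bB mA (hp j) (hp k) hx.
    rewrite !comp1r adj_id bopBE bopZE hdotBr hdotZr.
    rewrite !app_scale; set u := c j *: _; set v := c k *: _.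
    rewrite (adjP (p j).1 u) (adjP (p j).1 (x u)) (adjP x u).
    have -> : adj (p j).1 ((p k).1 (x v)) = x (adj (p j).1 ((p k).1 v)) by
      rewrite -[RHS]/((x ** (adj (p j).1 ** (p k).1)) v) -cx.
    by [].
  move=> j k y hy; rewrite !comp1r adj_id.
  have hxx : algd b (adj x ** x).
    by case: bB => _ [[_ h' _] _] _; apply: h'; exists (adj x); [exact: (algd_adj bB)|exists x].
  rewrite compBl compBr compZl compZr comp1l comp1r.
  by rewrite (alg_algd bB hy hxx).
have hT xi : alpha xi -> T ** xi = xi ** x.
  by move=> hxi; apply: bop_ext => z; exact: (hT0 (xi, z)).
rewrite /rho; case: xgetP => [T' _ h|/(_ T)[]//].
by split=> //; have -> : T' = T by apply: (cm_ext mA) => xi hxi; rewrite h // hT.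
Qed.

Lemma rhoE x xi : algd b x -> alpha xi -> rho alpha x ** xi = xi ** x.
Proof. by move=> /rho_ex[h _]; exact: h. Qed.

Lemma rho_norm x : algd b x -> `|rho alpha x| <= `|x|.
Proof. by move=> /rho_ex[]. Qed.

Lemma rho_uniq x T : algd b x -> (forall xi, alpha xi -> T ** xi = xi ** x) ->
  T = rho alpha x.
Proof. by move=> hx h; apply: (cm_ext mA) => xi hxi; rewrite h // rhoE. Qed.

Lemma rho_lin a x y : algd b x -> algd b y ->
  rho alpha (a *: x + y) = a *: rho alpha x + rho alpha y.
Proof.
move=> hx hy; apply/esym/rho_uniq.
  by case: bB => _ [[cB _ _] _] _; case: cB => _ _; exact.
by move=> xi hxi; rewrite compDl compZl !rhoE // compDr compZr.
Qed.

Lemma rho_adj x : algd b x -> adj (rho alpha x) = rho alpha (adj x).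
Proof.
move=> hx; have hx' := algd_adj bB hx.
apply: rho_uniq => // xi' h'; apply: (cm_ext_adj mA) => xi h.
rewrite compA -adj_comp rhoE // adj_comp.
by rewrite -compA -(cm_gram_comm bB mA h h' hx') compA.
Qed.

End Rho.

(** * Relative tensor products *)

Section RelativeTensorProducts.
Variables (R : realType) (Z : hilbertType R).

(* X with k1, k2 is a relative tensor product of (H, beta) and (K, gamma), k1 and
   k2 being the maps xi |-> |xi>_1 and eta |-> |eta>_2.  Exchanging (beta, k1)
   and (gamma, k2) gives the flipped product, on the same space. *)
Definition rtp (H K X : hilbertType R) (beta : set 'L(Z, H)) (gamma : set 'L(Z, K))
    (k1 : 'L(Z, H) -> 'L(K, X)) (k2 : 'L(Z, K) -> 'L(H, X)) :=
  [/\ forall xi eta, beta xi -> gamma eta -> k1 xi ** eta = k2 eta ** xi,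
      forall xi xi' eta eta', beta xi -> beta xi' -> gamma eta -> gamma eta' ->
        adj (k1 xi ** eta) ** (k1 xi' ** eta') = adj xi ** xi' ** (adj eta ** eta') &
      cspan (oapp (omul (k1 @` beta) gamma) setT) = setT].

Section Basic.
Variables (b : obase Z) (H K X : hilbertType R).
Variables (beta : set 'L(Z, H)) (gamma : set 'L(Z, K)).
Variables (k1 : 'L(Z, H) -> 'L(K, X)) (k2 : 'L(Z, K) -> 'L(H, X)).
Hypothesis bB : cstar_base b.
Hypothesis mB : cmodule b beta.
Hypothesis mG : cmodule (dagger b) gamma.
Hypothesis P : rtp beta gamma k1 k2.

Lemma rtpE xi eta : beta xi -> gamma eta -> k1 xi ** eta = k2 eta ** xi.
Proof. by case: P => h _ _; exact: h. Qed.

Lemma rtp_gram xi xi' eta eta' : beta xi -> beta xi' -> gamma eta -> gamma eta' ->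
  adj (k1 xi ** eta) ** (k1 xi' ** eta') = adj xi ** xi' ** (adj eta ** eta').
Proof. by case: P => _ h _; exact: h. Qed.

Lemma rtp_total : cspan ((fun p : 'L(Z, H) * Z * 'L(Z, K) => k1 p.1.1 (p.2 p.1.2)) @`
  [set p | beta p.1.1 /\ gamma p.2]) = setT.
Proof.
case: P => _ _ <-; congr cspan; apply/seteqP; split.
  move=> _ [[[xi z] eta] [/= h h'] <-]; exists (k1 xi ** eta); last by exists z.
  by exists (k1 xi); [exists xi|exists eta].
move=> _ [_ [_ [xi h <-] [eta h' <-]] [z _ <-]].
by exists (xi, z, eta).
Qed.

Lemma rtp_ext (Y : hilbertType R) (S T : 'L(X, Y)) :
  (forall xi eta, beta xi -> gamma eta ->
     S ** (k1 xi ** eta) = T ** (k1 xi ** eta)) -> S = T.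
Proof.
move=> h; apply: (total_ext rtp_total) => _ [[[xi z] eta] [/= h1 h2] <-].
by rewrite -[LHS]/((S ** (k1 xi ** eta)) z) h.
Qed.

Lemma rtp_ext1 (Y : hilbertType R) (S T : 'L(X, Y)) :
  (forall xi, beta xi -> S ** k1 xi = T ** k1 xi) -> S = T.
Proof. by move=> h; apply: rtp_ext => xi eta h1 h2; rewrite !compA h. Qed.

Lemma rtp_ext2 (Y : hilbertType R) (S T : 'L(X, Y)) :
  (forall eta, gamma eta -> S ** k2 eta = T ** k2 eta) -> S = T.
Proof. by move=> h; apply: rtp_ext => xi eta h1 h2; rewrite rtpE // !compA h. Qed.

Lemma rtp_comm xi xi' eta eta' : beta xi -> beta xi' -> gamma eta -> gamma eta' ->
  adj xi ** xi' ** (adj eta ** eta') = adj eta ** eta' ** (adj xi ** xi').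
Proof.
move=> h1 h2 h3 h4; apply: (alg_algd bB); first exact: (cm_gram mB).
exact: (cm_gram mG).
Qed.

(** Between eta^* and eta' the Gram condition of [rtp] gives xi^* xi' eta^* eta'; commuting the two
    factors yields eta^* eta' xi^* xi', which is the defining property of [rho gamma]. Through this
    identity a bra meeting a ket becomes an element of the base acting on K. *)
Lemma rtp_gram1 xi xi' : beta xi -> beta xi' ->
  adj (k1 xi) ** k1 xi' = rho gamma (adj xi ** xi').
Proof.
move=> h h'; apply: (rho_uniq (dagger_base bB) mG); first exact: (cm_gram mB).
move=> eta' g'; apply: (cm_ext_adj mG) => eta g.
by rewrite -compA compA -adj_comp rtp_gram // rtp_comm // -compA.
Qed.

Lemma rtp_k1_gram xi xi' eta : beta xi -> beta xi' -> gamma eta ->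
  adj (k1 xi) ** k1 xi' ** eta = eta ** (adj xi ** xi').
Proof.
move=> h h' g; rewrite rtp_gram1 //; apply: (rhoE (dagger_base bB) mG) => //.
exact: (cm_gram mB).
Qed.

Lemma rtp_norm1 xi : beta xi -> `|k1 xi| <= `|xi|.
Proof.
move=> h; apply: opnorm_le => // v.
rewrite -(@ler_pXn2r _ 2) ?nnegrE ?mulr_ge0 // hnormE adjP.
rewrite -[adj _ _]/((adj (k1 xi) ** k1 xi) v) rtp_gram1 //.
set r := rho _ _.
have nr : `|r| <= `|xi| ^+ 2.
  apply: le_trans (rho_norm (dagger_base bB) mG _) _; first exact: (cm_gram mB).
  by apply: le_trans (comp_norm _ _) _; rewrite adj_norm expr2.
rewrite -[leLHS]ger0_norm; last first.
  by rewrite /r -rtp_gram1 //= -adjP hdot_ge0.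
apply: le_trans (hdot_CS _ _) _.
apply: le_trans (_ : `|v| * (`|r| * `|v|) <= _).
  by rewrite ler_wpM2l // le_opnorm.
by rewrite mulrCA -expr2 exprMn ler_wpM2r ?exprn_ge0.
Qed.

Lemma rtp_lin1 a xi xi' : beta xi -> beta xi' -> k1 (a *: xi + xi') = a *: k1 xi + k1 xi'.
Proof.
move=> h h'; have [_ _ bL] := cm_closed mB.
apply: (cm_ext mG) => eta g.
by rewrite compDl compZl !rtpE ?compDr ?compZr //; exact: bL.
Qed.

Lemma csub_k1 (S : set 'L(K, X)) : closed_subspace S ->
  closed_subspace [set xi | beta xi /\ S (k1 xi)].
Proof.
move=> cS; apply: (csub_preim_on (g := id) (M := 1)) => //.
- exact: (cm_closed mB).
- exact: rtp_lin1.
- by move=> xi h; rewrite mul1r; exact: rtp_norm1.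
Qed.

Lemma k1_mul xi x : beta xi -> alg b x -> k1 (xi ** x) = k1 xi ** rho gamma x.
Proof.
move=> h hx; apply: (cm_ext mG) => eta g.
rewrite -compA (rhoE (dagger_base bB) mG) // compA !rtpE ?compA //.
exact: (cm_mul mB).
Qed.

(** The Gram condition is symmetric in the two legs because [alg b] commutes with [algd b]. *)
Lemma rtp_swap : rtp gamma beta k2 k1.
Proof.
split.
- by move=> eta xi g h; rewrite rtpE.
- by move=> eta eta' xi xi' g g' h h'; rewrite -!rtpE // rtp_gram // rtp_comm.
- case: P => _ _ <-; congr cspan; apply/seteqP; split.
    move=> _ [_ [_ [eta g <-] [xi h <-]] [z _ <-]].
    exists (k1 xi ** eta); last by exists z => //; rewrite rtpE.
    by exists (k1 xi); [exists xi|exists eta].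
  move=> _ [_ [_ [xi h <-] [eta g <-]] [z _ <-]].
  exists (k2 eta ** xi); last by exists z => //; rewrite rtpE.
  by exists (k2 eta); [exists eta|exists xi].
Qed.

End Basic.

Section Otens.
Variables (b : obase Z) (H K X H' K' X' : hilbertType R).
Variables (beta : set 'L(Z, H)) (gamma : set 'L(Z, K)).
Variables (k1 : 'L(Z, H) -> 'L(K, X)) (k2 : 'L(Z, K) -> 'L(H, X)).
Variables (beta' : set 'L(Z, H')) (gamma' : set 'L(Z, K')).
Variables (k1' : 'L(Z, H') -> 'L(K', X')) (k2' : 'L(Z, K') -> 'L(H', X')).
Hypothesis bB : cstar_base b.
Hypothesis mB : cmodule b beta.
Hypothesis mG : cmodule (dagger b) gamma.
Hypothesis mB' : cmodule b beta'.
Hypothesis mG' : cmodule (dagger b) gamma'.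
Hypothesis P : rtp beta gamma k1 k2.
Hypothesis P' : rtp beta' gamma' k1' k2'.

Lemma otens_ex (S : 'L(H, H')) (T : 'L(K, K')) :
  semi_morphism beta beta' S -> semi_morphism gamma gamma' T ->
  exists Y : 'L(X, X'), (forall xi eta, beta xi -> gamma eta ->
    Y ** (k1 xi ** eta) = k1' (S ** xi) ** (T ** eta)) /\ `|Y| <= `|S| * `|T|.
Proof.
move=> hS hT.
have [Y [hY nY]] : exists Y : 'L(X, X'), (forall p : 'L(Z, H) * Z * 'L(Z, K),
    beta p.1.1 /\ gamma p.2 ->
    Y (k1 p.1.1 (p.2 p.1.2)) = k1' (S ** p.1.1) ((T ** p.2) p.1.2)) /\
    `|Y| <= `|S| * `|T|.
  apply: (extend_gram (D := [set p : 'L(Z, H) * Z * 'L(Z, K) | beta p.1.1 /\ gamma p.2])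
           (f := fun p => k1 p.1.1 (p.2 p.1.2))
           (g := fun p => k1' (S ** p.1.1) ((T ** p.2) p.1.2))) => //.
  - by rewrite mulr_ge0.
  - exact: (rtp_total P).
  move=> J p c hp.
  pose xi j := (p j).1.1; pose eta j := (p j).2; pose z j := c j *: (p j).1.2.
  have hxi j : beta (xi j) by have [] := hp j.
  have heta j : gamma (eta j) by have [] := hp j.
  pose M1 j k := `|S| ^+ 2 *: (adj (xi j) ** xi k) - adj (S ** xi j) ** (S ** xi k).
  pose M2 j k := `|T| ^+ 2 *: (adj (eta j) ** eta k) - adj (T ** eta j) ** (T ** eta k).
  have M1a j k : alg b (M1 j k).
    have cA : closed_subspace (alg b) by case: bB => [[[]]].
    by apply: csubB => //; [apply: csubZ => //; exact: (cm_gram mB)|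
      apply: (cm_gram mB'); exact: hS].
  have M2a j k : algd b (M2 j k).
    have cA : closed_subspace (algd b) by case: bB => _ [[]].
    by apply: csubB => //; [apply: csubZ => //; exact: (cm_gram mG)|
      apply: (cm_gram mG'); exact: hT].
  (* Let G, G' be the Gram matrices of the xi and the eta, and G_S, G'_T those of their images. With
     entrywise products the required form is |S|^2 |T|^2 G G' - G_S G'_T = |T|^2 (|S|^2 G - G_S) G'
     + G_S (|T|^2 G' - G'_T), a sum of Schur products of positive matrices. Semi-morphisms keep G_S
     and G'_T in the two commuting algebras. *)
  have s1 : 0 <= \sum_j \sum_k hdot (z j) (M1 j k (adj (eta j) (eta k (z k)))) := @gram_schur _ _ (dagger b) K gamma J M1 eta z mG
    (contract_pos_matrix xi S) (fun j k y hy => alg_algd bB (M1a j k) hy) heta.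
  have s2 : 0 <= \sum_j \sum_k hdot (z j)
    ((adj (S ** xi j) ** (S ** xi k)) (M2 j k (z k))) := @schur_product _ _ J (fun j k => adj (S ** xi j) ** (S ** xi k)) M2
    (gram_pos_matrix (fun j => S ** xi j)) (contract_pos_matrix eta T)
    (fun i j k l => alg_algd bB (cm_gram mB' (hS _ (hxi i)) (hS _ (hxi j))) (M2a k l)) z.
  apply: le_trans (addr_ge0 (mulr_ge0 (exprn_ge0 2 (normr_ge0 T)) s1) s2) _.
  rewrite mulr_sumr -big_split; apply: ler_sum => j _.
  rewrite mulr_sumr -big_split; apply: ler_sum => k _.
  rewrite !app_scale -/(xi j) -/(xi k) -/(eta j) -/(eta k) -/(z j) -/(z k).
  have g1 : hdot (k1 (xi j) (eta j (z j))) (k1 (xi k) (eta k (z k))) =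
      hdot (z j) ((adj (xi j) ** xi k) (adj (eta j) (eta k (z k)))).
    rewrite -[k1 _ (eta j _)]/((k1 (xi j) ** eta j) (z j)) adjP.
    rewrite -[adj _ _]/((adj (k1 (xi j) ** eta j) ** (k1 (xi k) ** eta k)) (z k)).
    by rewrite (rtp_gram P).
  have g2 : hdot (k1' (S ** xi j) ((T ** eta j) (z j))) (k1' (S ** xi k) ((T ** eta k) (z k))) =
      hdot (z j) ((adj (S ** xi j) ** (S ** xi k)) ((adj (T ** eta j) ** (T ** eta k)) (z k))).
    rewrite -[k1' _ ((T ** eta j) _)]/((k1' (S ** xi j) ** (T ** eta j)) (z j)) adjP.
    rewrite -[adj _ (k1' _ _)]/((adj (k1' (S ** xi j) ** (T ** eta j)) **
       (k1' (S ** xi k) ** (T ** eta k))) (z k)).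
    by rewrite (rtp_gram P') //; [exact: hS|exact: hS|exact: hT|exact: hT].
  have m1 w : hdot (z j) (M1 j k w) = `|S| ^+ 2 * hdot (z j) ((adj (xi j) ** xi k) w)
      - hdot (z j) ((adj (S ** xi j) ** (S ** xi k)) w).
    by rewrite /M1 bopBE bopZE hdotBr hdotZr.
  have m2 (A : 'L(Z, Z)) : hdot (z j) (A (M2 j k (z k))) =
      `|T| ^+ 2 * hdot (z j) (A (adj (eta j) (eta k (z k)))) -
      hdot (z j) (A ((adj (T ** eta j) ** (T ** eta k)) (z k))).
    set u := adj (eta j) _; set w := (adj (T ** eta j) ** _) _.
    have -> : M2 j k (z k) = `|T| ^+ 2 *: u - w by [].
    by rewrite app_sub hdotBr -(app_scale A) hdotZr.
  rewrite g1 g2 m1 m2.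
  rewrite le_eqVlt; apply/orP; left; apply/eqP; rewrite exprMn.
  rewrite -[(adj (xi j) ** xi k) _]/(adj (xi j) (xi k _)).
  by rewrite /=; ring.
exists Y; split=> // xi eta h g; apply: bop_ext => z.
exact: (hY (xi, z, eta)).
Qed.

End Otens.

(** * The concrete relative tensor product *)

Section ConcreteTensor.
Variables (b : obase Z) (H K : hilbertType R).
Variables (beta : set 'L(Z, H)) (gamma : set 'L(Z, K)).
Hypothesis bB : cstar_base b.
Hypothesis mB : cmodule b beta.
Hypothesis mG : cmodule (dagger b) gamma.

Let valid (p : 'L(Z, H) * Z * 'L(Z, K)) := beta p.1.1 /\ gamma p.2.

Let kerE p q : valid p -> valid q -> rt_kernel beta gamma p q =
  hdot p.1.2 ((adj p.1.1 ** q.1.1) ((adj p.2 ** q.2) q.1.2)).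
Proof.
case: p q => [[xi z] eta] [[xi' z'] eta'] [/= h1 h2] [/= h3 h4].
by rewrite asboolT.
Qed.

Let ker0 p q : ~ (valid p /\ valid q) -> rt_kernel beta gamma p q = 0.
Proof.
case: p q => [[xi z] eta] [[xi' z'] eta'] /= h.
by rewrite asboolF // => -[h1 h2 h3 h4]; apply: h.
Qed.

Let comm xi xi' eta eta' : beta xi -> beta xi' -> gamma eta -> gamma eta' ->
  adj xi ** xi' ** (adj eta ** eta') = adj eta ** eta' ** (adj xi ** xi').
Proof.
move=> h1 h2 h3 h4; apply: (alg_algd bB); first exact: (cm_gram mB).
exact: (cm_gram mG).
Qed.

Lemma rt_pos_kernel : pos_kernel (rt_kernel beta gamma).
Proof.
split=> [p q|s].
  have [[vp vq]|nv] := pselect (valid p /\ valid q); last first.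
    by rewrite !ker0 ?rmorph0 // => -[? ?]; exact: nv.
  rewrite !kerE // -hdotC; case: vp vq => [h1 h2] [h3 h4].
  rewrite -[(_ ** _) ((_ ** _) _)]/((adj q.1.1 ** p.1.1 ** (adj q.2 ** p.2)) p.1.2).
  by rewrite comm //= adjPl adjP adjPl adjP.
pose J := 'I_(size s); pose t (j : J) := tnth (in_tuple s) j.
(* Invalid generators have zero kernel entries; replacing their data by 0 gives families inside beta
   and gamma with the same quadratic form. *)
pose xi j := if `[< valid (t j).2 >] then (t j).2.1.1 else 0.
pose eta j := if `[< valid (t j).2 >] then (t j).2.2 else 0.
pose z j := if `[< valid (t j).2 >] then (t j).1 *: (t j).2.1.2 else 0.
have hxi j : beta (xi j).
  by rewrite /xi; case: asboolP => [[]//|_]; exact: (csub0 (cm_closed mB)).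
have heta j : gamma (eta j).
  by rewrite /eta; case: asboolP => [[]//|_]; exact: (csub0 (cm_closed mG)).
have h := @gram_schur _ _ (dagger b) K gamma J _ eta z mG (gram_pos_matrix xi)
   (fun j k y hy => alg_algd bB (cm_gram mB (hxi j) (hxi k)) hy) heta.
apply: le_trans h _; rewrite le_eqVlt; apply/orP; left; apply/eqP.
rewrite [RHS]big_tnth.
apply: eq_bigr => j _.
rewrite [RHS]big_tnth; apply: eq_bigr => k _.
rewrite /z -/(t j) -/(t k) /xi /eta.
case: asboolP => [vj|nj]; last by rewrite hdot0l ker0 ?mulr0 // => -[].
case: asboolP => [vk|nk]; last by rewrite !linear0 hdot0r ker0 ?mulr0 // => -[].
by rewrite kerE // hdotZl /= !linearZ hdotZr mulrA.
Qed.

Lemma hdot_tens xi z eta xi' z' eta' : beta xi -> gamma eta -> beta xi' -> gamma eta' ->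
  hdot (tens beta gamma xi z eta) (tens beta gamma xi' z' eta') =
  hdot z ((adj xi ** xi') ((adj eta ** eta') z')).
Proof.
move=> h1 h2 h3 h4; rewrite -[LHS]/(gen_dot _ _) gen_dotE; last exact: rt_pos_kernel.
by rewrite (kerE (p := (xi, z, eta)) (q := (xi', z', eta'))).
Qed.

End ConcreteTensor.
End RelativeTensorProducts.

Section GenTotal.
Variables (R : realType) (X : Type) (k : X -> X -> R[i]).

Lemma gen_of_cat s t : gen_of k (s ++ t) = gen_of k s + gen_of k t.
Proof. by apply: val_inj; apply/funext => v /=; rewrite kformD. Qed.

Lemma gen_of_scale a s : gen_of k (kscale a s) = a *: gen_of k s.
Proof. by apply: val_inj; apply/funext => v /=; rewrite kformZ. Qed.

Lemma gen_total : cspan (range (gen k)) = setT.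
Proof.
apply/seteqP; split=> // x _; have [u ru] := gen_rep x.
apply: csub_closure (cspan_closed _) _ => e e0.
have [N hN] := gen_approx ru e0; exists (gen_of k (u N)); last exact: hN.
elim: (u N) => [|[a y] s IH].
  have -> : gen_of k [::] = 0; last exact: csub0 (cspan_closed _).
  exact: etrans (gen_of_scale 0 [::]) (scale0r _).
have -> : (a, y) :: s = kscale a [:: (1, y)] ++ s by rewrite /kscale /= mulr1.
rewrite gen_of_cat gen_of_scale; apply: csubD IH; first exact: cspan_closed.
by apply: (csubZ a (cspan_closed _)); apply: cspan_sub; exists y.
Qed.

End GenTotal.

Section ConcreteKets.
Variables (R : realType) (Z : hilbertType R).
Variables (b : obase Z) (H K : hilbertType R).
Variables (beta : set 'L(Z, H)) (gamma : set 'L(Z, K)).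
Hypothesis bB : cstar_base b.
Hypothesis mB : cmodule b beta.
Hypothesis mG : cmodule (dagger b) gamma.

Lemma tens_total : cspan ((fun p : 'L(Z, H) * Z * 'L(Z, K) =>
  tens beta gamma p.1.1 p.1.2 p.2) @` [set p | beta p.1.1 /\ gamma p.2]) = setT.
Proof.
apply/seteqP; split=> // x _.
have : cspan (range (gen (rt_kernel beta gamma))) x by rewrite gen_total.
apply: cspan_min (cspan_closed _) _ _ => _ [p _ <-].
have [vp|nv] := pselect (beta p.1.1 /\ gamma p.2).
  apply: cspan_sub; exists p; first exact: vp.
  by case: p {vp} => [[xi z] eta].
have -> : gen (rt_kernel beta gamma) p = 0; last exact: csub0 (cspan_closed _).
apply/eqP; rewrite -normr_eq0 -sqrf_eq0 hnormE; apply/eqP.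
rewrite -[LHS]/(gen_dot _ _) gen_dotE; last exact: (rt_pos_kernel bB mB mG).
case: p nv => [[xi z] eta] /= nv; rewrite asboolF // => -[h1 h2 _ _].
exact: nv.
Qed.

(** eta z |-> xi (x) z (x) eta is bounded by |xi|: its Gram matrix is that of the eta with entries
    multiplied by xi^* xi, and |xi|^2 - xi^* xi is positive and commutes with the Gram elements of
    gamma. So the choice in [ket1] is not the default 0. *)
Lemma ket1E xi eta : beta xi -> gamma eta ->
  forall z, ket1 beta gamma xi (eta z) = tens beta gamma xi z eta.
Proof.
move=> hx hg.
have [T [hT _]] : exists T : 'L(K, rt beta gamma),
    (forall p : 'L(Z, K) * Z, gamma p.1 -> T (p.1 p.2) = tens beta gamma xi p.2 p.1) /\
    `|T| <= `|xi|.
  apply: (extend_gram (f := fun p : 'L(Z, K) * Z => p.1 p.2)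
    (g := fun p : 'L(Z, K) * Z => tens beta gamma xi p.2 p.1)
    (D := [set p | gamma p.1])) => //; first exact: (total_pairs mG).
  move=> J p c hp.
  have := @gram_schur _ _ (dagger b) K gamma J _
    (fun j => (p j).1) (fun j => c j *: (p j).2) mG (contract_pos_matrix (fun=> bid Z) xi).
  move=> h; apply: le_trans (h _ hp) _; last first.
    apply: ler_sum => j _; apply: ler_sum => k _.
    rewrite !comp1r adj_id bopBE bopZE hdotBr hdotZr.
    have -> : hdot (c j *: tens beta gamma xi (p j).2 (p j).1)
        (c k *: tens beta gamma xi (p k).2 (p k).1) =
        hdot (c j *: (p j).2) ((adj xi ** xi ** (adj (p j).1 ** (p k).1)) (c k *: (p k).2)).
      rewrite !hdotZl !hdotZr (hdot_tens bB mB mG) //; [|exact: hp|exact: hp].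
      by rewrite -app_scale hdotZr.
    rewrite !app_scale (adjP (p j).1).
    by rewrite le_eqVlt; apply/orP; left; apply/eqP.
  move=> j k y hy; rewrite !comp1r adj_id.
  by rewrite compBl compBr compZl compZr comp1l comp1r (cm_gram_comm bB mB).
have hT' : forall eta z, gamma eta -> T (eta z) = tens beta gamma xi z eta.
  by move=> eta' z g; exact: (hT (eta', z)).
rewrite /ket1; case: xgetP => [T' _ h z|/(_ T)[]//]; exact: h.
Qed.

Lemma ket2E xi eta : beta xi -> gamma eta ->
  forall z, ket2 beta gamma eta (xi z) = tens beta gamma xi z eta.
Proof.
move=> hx hg.
have [T [hT _]] : exists T : 'L(H, rt beta gamma),
    (forall p : 'L(Z, H) * Z, beta p.1 -> T (p.1 p.2) = tens beta gamma p.1 p.2 eta) /\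
    `|T| <= `|eta|.
  apply: (extend_gram (f := fun p : 'L(Z, H) * Z => p.1 p.2)
    (g := fun p : 'L(Z, H) * Z => tens beta gamma p.1 p.2 eta)
    (D := [set p | beta p.1])) => //; first exact: (total_pairs mB).
  move=> J p c hp.
  have := @gram_schur _ _ b H beta J _
    (fun j => (p j).1) (fun j => c j *: (p j).2) mB (contract_pos_matrix (fun=> bid Z) eta).
  move=> h; apply: le_trans (h _ hp) _; last first.
    apply: ler_sum => j _; apply: ler_sum => k _.
    rewrite !comp1r adj_id bopBE bopZE hdotBr hdotZr.
    have -> : hdot (c j *: tens beta gamma (p j).1 (p j).2 eta)
        (c k *: tens beta gamma (p k).1 (p k).2 eta) =
        hdot (c j *: (p j).2) ((adj eta ** eta ** (adj (p j).1 ** (p k).1)) (c k *: (p k).2)).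
      rewrite !hdotZl !hdotZr (hdot_tens bB mB mG) //; [|exact: hp|exact: hp].
      by rewrite -app_scale hdotZr
        (cm_gram_comm (dagger_base bB) mG hg hg (cm_gram mB (hp j) (hp k))).
    rewrite !app_scale (adjP (p j).1).
    by rewrite le_eqVlt; apply/orP; left; apply/eqP.
  move=> j k y hy; rewrite !comp1r adj_id.
  by rewrite compBl compBr compZl compZr comp1l comp1r
    (cm_gram_comm (dagger_base bB) mG).
have hT' : forall xi z, beta xi -> T (xi z) = tens beta gamma xi z eta.
  by move=> xi' z g; exact: (hT (xi', z)).
rewrite /ket2; case: xgetP => [T' _ h z|/(_ T)[]//]; exact: h.
Qed.

(** The bridge from the chosen kets to the abstract notion; afterwards elementary tensors reappear
    only where [flip] and [otens] are identified. *)
Lemma rt_rtp : rtp beta gamma (ket1 beta gamma) (ket2 beta gamma).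
Proof.
split.
- by move=> xi eta h g; apply: bop_ext => z /=; rewrite ket1E // ket2E.
- move=> xi xi' eta eta' h h' g g'; apply: bop_ext => z; apply: hdot_inj => y.
  rewrite adjPl /= !ket1E // [LHS]hdotC (hdot_tens bB mB mG) //.
  by rewrite -[LHS]hdotC.
- rewrite -tens_total; congr cspan; apply/seteqP; split.
    move=> _ [_ [_ [xi h <-] [eta g <-]] [z _ <-]].
    by exists (xi, z, eta) => //=; rewrite ket1E.
  move=> _ [[[xi z] eta] [/= h g] <-].
  exists (ket1 beta gamma xi ** eta); last by exists z => //=; rewrite ket1E.
  by exists (ket1 beta gamma xi); [exists xi|exists eta].
Qed.

End ConcreteKets.

Section UnitaryGram.
Variables (R : realType) (X Y L : hilbertType R) (I : eqType) (D : set I).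
Variables (F : I -> 'L(L, X)) (G : I -> 'L(L, Y)).

(** Equal Gram operators make F i z |-> G i z isometric, and totality of the G i makes it onto. The
    flip, the associator and [flip23] all arise in this way. *)
Lemma unitary_gram : cspan (oapp (F @` D) setT) = setT ->
  cspan (oapp (G @` D) setT) = setT ->
  (forall i j, D i -> D j -> adj (F i) ** F j = adj (G i) ** G j) ->
  exists T : 'L(X, Y), unitary T /\ forall i, D i -> T ** F i = G i.
Proof.
move=> Ft Gt FG.
have FtP : cspan ((fun p : I * L => F p.1 p.2) @` [set p | D p.1]) = setT.
  rewrite -Ft; congr cspan; apply/seteqP; split.
    by move=> _ [p Dp <-]; exists (F p.1); [exists p.1|exists p.2].
  by move=> _ [_ [i Di <-] [z _ <-]]; exists (i, z).
have [T [hT _]] : exists T : 'L(X, Y),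
    (forall p : I * L, D p.1 -> T (F p.1 p.2) = G p.1 p.2) /\ `|T| <= 1.
  apply: (extend_gram (f := fun p : I * L => F p.1 p.2) (g := fun p => G p.1 p.2)
    (D := [set p | D p.1])) => //.
  move=> J p c hp; apply: sumr_ge0 => j _; apply: sumr_ge0 => k _.
  rewrite expr1n mul1r !app_scale !adjP -[adj _ (F _ _)]/((adj _ ** F _) _).
  by rewrite FG ?subrr //; exact: hp.
have TF i : D i -> T ** F i = G i.
  by move=> Di; apply: bop_ext => z; exact: (hT (i, z)).
have TT : adj T ** T = bid X.
  apply: (total_ext Ft) => _ [_ [j Dj <-] [z _ <-]].
  apply: hdot_inj => y.
  have -> : (adj T ** T) (F j z) = adj T (G j z) by rewrite -(TF j Dj).
  rewrite adjPl -[bid X _]/(F j z).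
  have : cspan (oapp (F @` D) setT) y by rewrite Ft.
  have cS : closed_subspace [set y | hdot (G j z) (T y) - hdot (F j z) y = 0].
    have -> : [set y | hdot (G j z) (T y) - hdot (F j z) y = 0] =
              [set y | [set (0 : R[i]^o)] (hdot (adj T (G j z) - F j z) y)].
      apply/seteqP; split=> u /=; rewrite hdotBl adjPl //.
    apply: (csub_preim (g := id) (M := `|adj T (G j z) - F j z|)
      (f := fun y => hdot (adj T (G j z) - F j z) y : R[i]^o)).
    - exact: csub_single0.
    - by move=> a u v; rewrite hdotDr hdotZr.
    - by move=> u; exact: hdot_CS.
  move=> /(cspan_min cS) h; apply/eqP; rewrite -subr_eq0; apply/eqP; apply: h.
  move=> _ [_ [i Di <-] [w _ <-]] /=.
  rewrite -[T (F i w)]/((T ** F i) w) TF // !adjP.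
  by rewrite -[adj _ (F _ _)]/((adj _ ** F _) _) FG // subrr.
exists T; split=> //; split=> //.
apply: (total_ext Gt) => _ [_ [i Di <-] [z _ <-]].
by rewrite -(TF i Di) -[LHS]/((T ** (adj T ** T) ** F i) z) TT comp1r.
Qed.

End UnitaryGram.

(** * Amplified operators and product modules *)

Section SliceDefs.
Variables (R : realType) (Z : hilbertType R).

(** By conversion [rtri] is the case of the kets |.>_1 and [ltri] that of the kets |.>_2. *)
Definition tri (H K X : hilbertType R) (k : 'L(Z, H) -> 'L(K, X)) (beta : set 'L(Z, H))
    (delta : set 'L(Z, K)) : set 'L(Z, X) := cspan (omul (k @` beta) delta).

(** S (x) id when k2 and k2' are second kets. With first kets in their place it is id (x) S, so
    [opl] and [opr] are both instances. *)
Definition lop (H H' K X X' : hilbertType R) (gamma : set 'L(Z, K))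
    (k2 : 'L(Z, K) -> 'L(H, X)) (k2' : 'L(Z, K) -> 'L(H', X')) (S : 'L(H, H')) :
    'L(X, X') :=
  xget 0 [set Y : 'L(X, X') | forall eta, gamma eta -> Y ** k2 eta = k2' eta ** S].

Lemma csub_semi (H H' : hilbertType R) (beta : set 'L(Z, H)) (beta' : set 'L(Z, H')) :
  closed_subspace beta' -> closed_subspace [set S | semi_morphism beta beta' S].
Proof. by move=> cB; apply: csub_all => xi _; exact: csub_compr. Qed.

Lemma tri_sub (H K X : hilbertType R) (k : 'L(Z, H) -> 'L(K, X)) beta delta xi d :
  beta xi -> delta d -> tri k beta delta (k xi ** d).
Proof. by move=> h h'; apply: cspan_sub; exists (k xi); [exists xi|exists d]. Qed.

Lemma tri_min (H K X : hilbertType R) (k : 'L(Z, H) -> 'L(K, X)) beta delta P :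
  closed_subspace P -> (forall xi d, beta xi -> delta d -> P (k xi ** d)) ->
  tri k beta delta `<=` P.
Proof. by move=> cP h; apply: cspan_min => // _ [_ [xi hx <-] [d hd <-]]; exact: h. Qed.

End SliceDefs.

(** The induction predicate is read off the goal, which leaves its closedness and the case of a
    generator. *)
Ltac span_ind := lazymatch goal with
  |- forall w, _ w -> @?Q w => refine (@cspan_min _ _ _ Q _ _) end.

Ltac tri_ind := lazymatch goal with
  |- forall w, _ w -> @?Q w => refine (@tri_min _ _ _ _ _ _ _ _ Q _ _) end.

Section Slices.
Variables (R : realType) (Z : hilbertType R).

Lemma rho_semi (b : obase Z) (H : hilbertType R) (alpha beta : set 'L(Z, H)) x xi :
  cspan (omul (rho_alg b alpha) beta) = beta -> algd b x -> beta xi ->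
  beta (rho alpha x ** xi).
Proof.
move=> h hx hxi; rewrite -h; apply: cspan_sub; exists (rho alpha x); last by exists xi.
by exists x.
Qed.

Section Lop.
Variables (b : obase Z) (H K X H' X' : hilbertType R).
Variables (beta : set 'L(Z, H)) (gamma : set 'L(Z, K)).
Variables (k1 : 'L(Z, H) -> 'L(K, X)) (k2 : 'L(Z, K) -> 'L(H, X)).
Variables (beta' : set 'L(Z, H')).
Variables (k1' : 'L(Z, H') -> 'L(K, X')) (k2' : 'L(Z, K) -> 'L(H', X')).
Hypothesis bB : cstar_base b.
Hypothesis mB : cmodule b beta.
Hypothesis mG : cmodule (dagger b) gamma.
Hypothesis mB' : cmodule b beta'.
Hypothesis P : rtp beta gamma k1 k2.
Hypothesis P' : rtp beta' gamma k1' k2'.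
Notation lopS := (lop gamma k2 k2').

Lemma lop_ex S : semi_morphism beta beta' S ->
  (forall eta, gamma eta -> lopS S ** k2 eta = k2' eta ** S) /\ `|lopS S| <= `|S|.
Proof.
move=> hS.
have [|Y [hY nY]] := otens_ex bB mB mG mB' mG P P' hS (T := bid K).
  by move=> eta g; rewrite comp1l.
have {}hY eta : gamma eta -> Y ** k2 eta = k2' eta ** S.
  move=> g; apply: (cm_ext mB) => xi h.
  rewrite -compA -(rtpE P) // hY // comp1l (rtpE P') ?compA //; exact: hS.
rewrite /lop; case: xgetP => [Y' _ h|/(_ Y)[]//]; split=> //.
have -> : Y' = Y by apply: (rtp_ext2 P) => eta g; rewrite h // hY.
apply: le_trans nY _; rewrite -[leRHS]mulr1 ler_wpM2l //.
by apply: opnorm_le => // x; rewrite mul1r.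
Qed.

Lemma lopE S eta : semi_morphism beta beta' S -> gamma eta ->
  lopS S ** k2 eta = k2' eta ** S.
Proof. by move=> /lop_ex[h _]; exact: h. Qed.

Lemma lop_k1 S xi : semi_morphism beta beta' S -> beta xi ->
  lopS S ** k1 xi = k1' (S ** xi).
Proof.
move=> hS h; apply: (cm_ext mG) => eta g.
by rewrite -compA (rtpE P) // compA lopE // -compA (rtpE P') //; exact: hS.
Qed.

Lemma lop_uniq S Y : semi_morphism beta beta' S ->
  (forall eta, gamma eta -> Y ** k2 eta = k2' eta ** S) -> Y = lopS S.
Proof. by move=> hS h; apply: (rtp_ext2 P) => eta g; rewrite h // lopE. Qed.

Lemma lop_lin a S T : semi_morphism beta beta' S -> semi_morphism beta beta' T ->
  lopS (a *: S + T) = a *: lopS S + lopS T.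
Proof.
move=> hS hT; apply/esym/lop_uniq.
  by have [_ _ h] := csub_semi beta (cm_closed mB'); exact: h.
by move=> eta g; rewrite compDl compZl !lopE // compDr compZr.
Qed.

Lemma csub_lop (Q : set 'L(X, X')) : closed_subspace Q ->
  closed_subspace [set S | semi_morphism beta beta' S /\ Q (lopS S)].
Proof.
move=> cQ; apply: (csub_preim_on (g := id) (M := 1)) => //.
- exact: (csub_semi _ (cm_closed mB')).
- exact: lop_lin.
- by move=> S hS; rewrite mul1r; have [] := lop_ex hS.
Qed.

End Lop.

Section LopAdj.
Variables (b : obase Z) (H K X H' X' : hilbertType R).
Variables (beta : set 'L(Z, H)) (gamma : set 'L(Z, K)).
Variables (k1 : 'L(Z, H) -> 'L(K, X)) (k2 : 'L(Z, K) -> 'L(H, X)).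
Variables (beta' : set 'L(Z, H')).
Variables (k1' : 'L(Z, H') -> 'L(K, X')) (k2' : 'L(Z, K) -> 'L(H', X')).
Hypothesis bB : cstar_base b.
Hypothesis mB : cmodule b beta.
Hypothesis mG : cmodule (dagger b) gamma.
Hypothesis mB' : cmodule b beta'.
Hypothesis P : rtp beta gamma k1 k2.
Hypothesis P' : rtp beta' gamma k1' k2'.

Lemma lop_adj S : morphism beta beta' S ->
  adj (lop gamma k2 k2' S) = lop gamma k2' k2 (adj S).
Proof.
move=> [hS hS']; apply: (lop_uniq bB mB' mG mB P' P hS') => eta g.
apply: (cm_ext mB') => xi' h'; rewrite -!compA.
rewrite -(rtpE P') // -(rtpE P) //; last exact: hS'.

have E : adj (lop gamma k2 k2' S) ** (k1' xi' ** eta) = k1 (adj S ** xi') ** eta.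
  rewrite -[LHS]adjK -[RHS]adjK; congr adj; apply: (rtp_ext P) => xi'' eta'' h g'.
  rewrite adj_comp adjK -!compA (compA (lop _ _ _ _)).
  rewrite (lop_k1 bB mB mG mB' P P') // (rtp_gram P') //; last exact: hS.
  rewrite (rtp_gram P) //; last exact: hS'.
  by rewrite adj_comp adjK -!compA.
by rewrite E.
Qed.

End LopAdj.

Section Tri.
Variables (b c : obase Z) (H K X : hilbertType R).
Variables (beta : set 'L(Z, H)) (gamma delta : set 'L(Z, K)).
Variables (k1 : 'L(Z, H) -> 'L(K, X)) (k2 : 'L(Z, K) -> 'L(H, X)).
Hypothesis bB : cstar_base b.
Hypothesis cB : cstar_base c.
Hypothesis mB : cmodule b beta.
Hypothesis mG : cmodule (dagger b) gamma.
Hypothesis mD : cmodule c delta.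
Hypothesis P : rtp beta gamma k1 k2.
Hypothesis gd : cspan (omul (rho_alg (dagger b) gamma) delta) = delta.

(** <xi|_1 |xi'>_1 = rho gamma (xi^* xi'), and [rho gamma] preserves delta. Thus bras lead back from
    product modules, which turns the module axioms on V into invariance under its slices. *)
Lemma k1_adj_tri xi w : beta xi -> tri k1 beta delta w -> delta (adj (k1 xi) ** w).
Proof.
move=> h; apply: (tri_min (P := [set w | delta (adj (k1 xi) ** w)])).
  exact/csub_compl/(cm_closed mD).
move=> xi' d h' hd /=; rewrite compA (rtp_gram1 bB mB mG P) //.
exact: (rho_semi gd (cm_gram mB h h') hd).
Qed.

Lemma tri_cmodule : cmodule c (tri k1 beta delta).
Proof.
split; first exact: cspan_closed.
- apply/seteqP; split=> // x _.
  have : cspan (oapp (omul (k1 @` beta) delta) setT) x.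
    rewrite (total_omul _ (cm_total mD)) //.
    have := rtp_total P; rewrite -subTset => h; apply/seteqP; split=> // y /h.
    apply: cspan_mono => _ [[[xi z] eta] [/= h1 h2] <-].
    by exists (k1 xi); [exists xi|exists (eta z)].
  apply: cspan_mono => _ [T hT [z _ <-]]; exists T; last by exists z.
  exact: cspan_sub.
- apply/seteqP; split.
    apply: cspan_min; first exact: cspan_closed.
    move=> _ [w hw [x hx <-]]; move: w hw.
    tri_ind; first exact: csub_compr (cspan_closed _).
    move=> xi d h hd /=; rewrite -compA; apply: tri_sub => //; exact: (cm_mul mD).
  apply: tri_min; first exact: cspan_closed.
  move=> xi d h.
  have -> : delta d = cspan (omul delta (alg c)) d by case: mD => _ _ ->.
  move: d.
  span_ind; first exact: csub_compl (cspan_closed _).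
  move=> _ [d hd [x hx <-]] /=; apply: cspan_sub; exists (k1 xi ** d).
    exact: tri_sub.
  by exists x => //; rewrite compA.
- have cA : closed_subspace (alg c) by case: cB => [[[]]].
  apply/seteqP; split.
    apply: cspan_min => // _ [_ [w hw <-] [w' hw' <-]].
    move: w' hw'; tri_ind; first exact: csub_compl.
    move=> xi' d' h' hd' /=; rewrite compA.
    rewrite -[_ ** k1 xi']adjK adj_comp adjK.
    by apply: (cm_gram mD) => //; exact: k1_adj_tri.
  have -> : alg c = cspan (omul (oadj delta) delta) by case: mD.
  apply: cspan_min; first exact: cspan_closed.
  move=> _ [_ [d hd <-] [d' hd' <-]].
  (* [gd] writes d' with factors rho gamma x, and for x = xi^* xi' such a factor is <xi|_1 |xi'>_1;
     then d^* (rho gamma x) d' is a Gram element of the product module. *)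
  move: hd'; rewrite -{1}gd; move: d'.
  span_ind; first exact: csub_compl (cspan_closed _).
  move=> _ [_ [x hx <-] [d' hd' <-]] /=.
  have hx' : cspan (omul (oadj beta) beta) x by case: mB => _ _ _ ->.
  suff [] : [set x | alg b x /\ cspan (omul (oadj (tri k1 beta delta))
      (tri k1 beta delta)) (adj d ** (rho gamma x ** d'))] x by [].
  move: x hx' {hx}; apply: cspan_min.
    apply: (csub_preim_on (g := id) (M := `|adj d| * `|d'|)
      (f := fun x => adj d ** (rho gamma x ** d'))).
    - by case: bB => [[[]]].
    - exact: cspan_closed.
    - move=> a x y hx hy; rewrite (rho_lin (dagger_base bB) mG) //.
      by rewrite compDl compZl compDr compZr.
    - move=> x hx; apply: le_trans (comp_norm _ _) _; rewrite -mulrA ler_wpM2l //.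
      apply: le_trans (comp_norm _ _) _; rewrite mulrC ler_wpM2l //.
      exact: (rho_norm (dagger_base bB) mG).
  move=> _ [_ [xi h <-] [xi' h' <-]] /=; split; first exact: (cm_gram mB).
  rewrite -(rtp_gram1 bB mB mG P) //; apply: cspan_sub.
  exists (adj (k1 xi ** d)); first by exists (k1 xi ** d) => //; exact: tri_sub.
  exists (k1 xi' ** d'); first exact: tri_sub.
  by rewrite adj_comp !compA.
Qed.

(** The representation of the product module is id (x) rho delta, seen here on |.>_1 and in
    [rho_tri_k2] on |.>_2. *)
Lemma rho_tri_k1 y xi : algd c y -> beta xi ->
  rho (tri k1 beta delta) y ** k1 xi = k1 xi ** rho delta y.
Proof.
move=> hy h; apply: (cm_ext mD) => d hd.
rewrite -!compA (rhoE cB mD) // (rhoE cB tri_cmodule) ?compA //.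
exact: tri_sub.
Qed.

Hypothesis dg : cspan (omul (rho_alg c delta) gamma) = gamma.

Lemma rho_tri_k2 y eta : algd c y -> gamma eta ->
  rho (tri k1 beta delta) y ** k2 eta = k2 (rho delta y ** eta).
Proof.
move=> hy g; apply: (cm_ext mB) => xi h.
rewrite -compA -(rtpE P) // compA rho_tri_k1 // -compA (rtpE P) //.
exact: (rho_semi dg).
Qed.

Lemma rho_comm x y : alg b x -> algd c y ->
  rho gamma x ** rho delta y = rho delta y ** rho gamma x.
Proof.
move=> hx hy; apply: (cm_ext mD) => d hd.
rewrite -!compA (rhoE cB mD) // [RHS](rhoE cB mD) ?compA //.
exact: (rho_semi gd).
Qed.

End Tri.

End Slices.

(** * Threefold products *)

Section Triples.
Variables (R : realType) (Z : hilbertType R).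

(* A triple product of L, M and N along (lambda, mu) and (nu, omi), all attached
   to M, on a single space carrying both bracketings; [tl12] and [tr23] insert
   an element of the left, resp. right, twofold product, [tl3] and [tr1] one of
   N, resp. L. *)
Record triple (L M N X Y : hilbertType R) (lambda : set 'L(Z, L))
    (mu nu : set 'L(Z, M)) (omi : set 'L(Z, N))
    (k1 : 'L(Z, L) -> 'L(M, X)) (k2 : 'L(Z, M) -> 'L(L, X))
    (m1 : 'L(Z, M) -> 'L(N, Y)) (m2 : 'L(Z, N) -> 'L(M, Y)) := Triple {
  tb : obase Z;
  tc : obase Z;
  tbB : cstar_base tb;
  tcB : cstar_base tc;
  tmL : cmodule tb lambda;
  tmM : cmodule (dagger tb) mu;
  tmM' : cmodule tc nu;
  tmN : cmodule (dagger tc) omi;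
  tgd : cspan (omul (rho_alg (dagger tb) mu) nu) = nu;
  tdg : cspan (omul (rho_alg tc nu) mu) = mu;
  tX : rtp lambda mu k1 k2;
  tY : rtp nu omi m1 m2;
  tsp : hilbertType R;
  tl12 : 'L(Z, X) -> 'L(N, tsp);
  tl3 : 'L(Z, N) -> 'L(X, tsp);
  tr1 : 'L(Z, L) -> 'L(Y, tsp);
  tr23 : 'L(Z, Y) -> 'L(L, tsp);
  tl : rtp (tri k1 lambda nu) omi tl12 tl3;
  tr : rtp lambda (tri m2 omi mu) tr1 tr23;
  tcomp : forall xi f, lambda xi -> omi f -> tl3 f ** k1 xi = tr1 xi ** m2 f
}.

Section TripleTheory.
Variables (L M N X Y : hilbertType R) (lambda : set 'L(Z, L)).
Variables (mu nu : set 'L(Z, M)) (omi : set 'L(Z, N)).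
Variables (k1 : 'L(Z, L) -> 'L(M, X)) (k2 : 'L(Z, M) -> 'L(L, X)).
Variables (m1 : 'L(Z, M) -> 'L(N, Y)) (m2 : 'L(Z, N) -> 'L(M, Y)).
Variable t : triple lambda mu nu omi k1 k2 m1 m2.

Let bB := tbB t. Let cB := tcB t. Let mL := tmL t. Let mM := tmM t.
Let mM' := tmM' t. Let mN := tmN t. Let P := tX t. Let Q := tY t.

Lemma t_mX : cmodule (tc t) (tri k1 lambda nu).
Proof. exact: (tri_cmodule bB cB mL mM mM' P (tgd t)). Qed.

Lemma t_mY : cmodule (dagger (tb t)) (tri m2 omi mu).
Proof.
exact: (tri_cmodule (dagger_base cB) (dagger_base bB) mN mM' mM
         (rtp_swap cB mM' mN Q) (tdg t)).
Qed.

(** The same space read from right to left. It is transparent because statements about [tl12] of the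
    swapped triple serve, by conversion, as statements about [tr23]. *)
Definition triple_swap : triple omi nu mu lambda m2 m1 k2 k1.
Proof.
refine (@Triple _ _ _ _ _ omi nu mu lambda m2 m1 k2 k1 (dagger (tc t)) (dagger (tb t))
  (dagger_base cB) (dagger_base bB) mN mM' mM mL (tdg t) (tgd t)
  (rtp_swap cB mM' mN Q) (rtp_swap bB mL mM P) (tsp t) (tr23 t) (tr1 t) (tl3 t)
  (tl12 t) (rtp_swap bB mL t_mY (tr t)) (rtp_swap cB t_mX mN (tl t)) _).
by move=> f xi hf h; rewrite (tcomp t).
Defined.

Lemma t_l12 xi eta : lambda xi -> nu eta -> tl12 t (k1 xi ** eta) = tr1 t xi ** m1 eta.
Proof.
move=> h g; apply: (cm_ext mN) => f hf.
rewrite (rtpE (tl t)) //; last exact: tri_sub.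
by rewrite compA (tcomp t) // -!compA (rtpE Q).
Qed.

(** Tested on |f'>_2: <f|_3 |f'>_3 is id (x) rho nu (f^* f'), which acts on the middle factor only
    and so passes the ket |xi>_1. A bra at one end of a threefold product thereby moves past a ket
    at the other. *)
Lemma t_l3r1 xi f : lambda xi -> omi f ->
  adj (tl3 t f) ** tr1 t xi = k1 xi ** adj (m2 f).
Proof.
move=> h hf; apply: (rtp_ext2 Q) => f' hf'.
rewrite -!compA -(tcomp t) // compA.
rewrite (rtp_gram1 (dagger_base cB) mN t_mX (rtp_swap cB t_mX mN (tl t))) //.
rewrite (rtp_gram1 (dagger_base cB) mN mM' (rtp_swap cB mM' mN Q)) //.
rewrite (rho_tri_k1 bB cB mL mM mM' P (tgd t)) //.
exact: (cm_gram mN).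
Qed.

Lemma t_r1l3 xi f : lambda xi -> omi f ->
  adj (tr1 t xi) ** tl3 t f = m2 f ** adj (k1 xi).
Proof. by move=> h hf; rewrite -[LHS]adjK adj_comp adjK t_l3r1 // adj_comp adjK. Qed.

Lemma t_r1l12 xi w : lambda xi -> tri k1 lambda nu w ->
  adj (tr1 t xi) ** tl12 t w = m1 (adj (k1 xi) ** w).
Proof.
move=> h hw; apply: (cm_ext mN) => f hf.
rewrite -compA (rtpE (tl t)) // compA.
rewrite t_r1l3 // (rtpE Q) ?compA //.
exact: (k1_adj_tri bB mL mM mM' P (tgd t)).
Qed.

Lemma csub_l12 (S : set 'L(N, tsp t)) : closed_subspace S ->
  closed_subspace [set w | tri k1 lambda nu w /\ S (tl12 t w)].
Proof. exact: (csub_k1 cB t_mX mN (tl t)). Qed.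

End TripleTheory.

Section TripleMaps.
Variables (L M N X Y : hilbertType R) (lambda : set 'L(Z, L)).
Variables (mu nu : set 'L(Z, M)) (omi : set 'L(Z, N)).
Variables (k1 : 'L(Z, L) -> 'L(M, X)) (k2 : 'L(Z, M) -> 'L(L, X)).
Variables (m1 : 'L(Z, M) -> 'L(N, Y)) (m2 : 'L(Z, N) -> 'L(M, Y)).
Variable t : triple lambda mu nu omi k1 k2 m1 m2.
Variables (L' M' X' Y' : hilbertType R) (lambda' : set 'L(Z, L')).
Variables (mu' nu' : set 'L(Z, M')).
Variables (k1' : 'L(Z, L') -> 'L(M', X')) (k2' : 'L(Z, M') -> 'L(L', X')).
Variables (m1' : 'L(Z, M') -> 'L(N, Y')) (m2' : 'L(Z, N) -> 'L(M', Y')).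
Variable t' : triple lambda' mu' nu' omi k1' k2' m1' m2'.

Lemma t_map_l12 (T : 'L(X, X')) (W : 'L(tsp t, tsp t')) w :
  (forall f, omi f -> W ** tl3 t f = tl3 t' f ** T) ->
  tri k1 lambda nu w -> tri k1' lambda' nu' (T ** w) ->
  W ** tl12 t w = tl12 t' (T ** w).
Proof.
move=> h hw hw'; apply: (cm_ext (tmN t)) => f hf.
by rewrite -compA !(rtpE (tl _)) // !compA h.
Qed.

End TripleMaps.

Section Assoc.
Variables (L M N X Y A B : hilbertType R) (lambda : set 'L(Z, L)).
Variables (mu nu : set 'L(Z, M)) (omi : set 'L(Z, N)) (b c : obase Z).
Variables (k1 : 'L(Z, L) -> 'L(M, X)) (k2 : 'L(Z, M) -> 'L(L, X)).
Variables (m1 : 'L(Z, M) -> 'L(N, Y)) (m2 : 'L(Z, N) -> 'L(M, Y)).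
Variables (l12 : 'L(Z, X) -> 'L(N, A)) (l3 : 'L(Z, N) -> 'L(X, A)).
Variables (r1 : 'L(Z, L) -> 'L(Y, B)) (r23 : 'L(Z, Y) -> 'L(L, B)).
Hypothesis bB : cstar_base b.
Hypothesis cB : cstar_base c.
Hypothesis mL : cmodule b lambda.
Hypothesis mM : cmodule (dagger b) mu.
Hypothesis mM' : cmodule c nu.
Hypothesis mN : cmodule (dagger c) omi.
Hypothesis gd : cspan (omul (rho_alg (dagger b) mu) nu) = nu.
Hypothesis dg : cspan (omul (rho_alg c nu) mu) = mu.
Hypothesis P : rtp lambda mu k1 k2.
Hypothesis Q : rtp nu omi m1 m2.
Hypothesis PA : rtp (tri k1 lambda nu) omi l12 l3.
Hypothesis PB : rtp lambda (tri m2 omi mu) r1 r23.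

Lemma rtp_total1 (H K S : hilbertType R) (beta : set 'L(Z, H)) (gamma : set 'L(Z, K))
    (q1 : 'L(Z, H) -> 'L(K, S)) (q2 : 'L(Z, K) -> 'L(H, S)) :
  rtp beta gamma q1 q2 -> cspan (oapp (q1 @` beta) setT) = setT.
Proof.
move=> W; have := rtp_total W; rewrite -subTset => h; apply/seteqP; split=> // y /h.
apply: cspan_mono => _ [[[xi z] eta] [/= h1 h2] <-].
by exists (q1 xi); [exists xi|exists (eta z)].
Qed.

Lemma assoc_unitary : exists T : 'L(A, B), unitary T /\
  forall xi f, lambda xi -> omi f -> T ** l3 f ** k1 xi = r1 xi ** m2 f.
Proof.
have mX := tri_cmodule bB cB mL mM mM' P gd.
have Q' := rtp_swap cB mM' mN Q.
have mY := tri_cmodule (dagger_base cB) (dagger_base bB) mN mM' mM Q' dg.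
have PA' := rtp_swap cB mX mN PA.
have [|||T [uT hT]] := @unitary_gram R A B M _
    [set p : 'L(Z, L) * 'L(Z, N) | lambda p.1 /\ omi p.2]
    (fun p => l3 p.2 ** k1 p.1) (fun p => r1 p.1 ** m2 p.2).
- have := total_omul (rtp_total1 PA') (rtp_total1 P).
  rewrite -!subTset => h y /h; apply: cspan_mono => _ [_ [_ [f hf <-] [_ [xi h1 <-] <-]] [z _ <-]].
  by exists (l3 f ** k1 xi); [exists (xi, f)|exists z].
- have := total_omul (rtp_total1 PB) (rtp_total1 Q').
  rewrite -!subTset => h y /h; apply: cspan_mono => _ [_ [_ [xi h1 <-] [_ [f hf <-] <-]] [z _ <-]].
  by exists (r1 xi ** m2 f); [exists (xi, f)|exists z].
- move=> [xi f] [xi' f'] [/= h1 h2] [/= h3 h4].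
  (* Both Gram operators reduce to products of rho mu (xi^* xi') and rho nu (f^* f') on the middle
     factor, in opposite orders; these two commute. *)
  rewrite !adj_comp -!compA (compA (adj (l3 f))) (compA (adj (r1 xi))).
  rewrite (rtp_gram1 (dagger_base cB) mN mX PA') // (rtp_gram1 bB mL mY PB) //.
  have hff : algd c (adj f ** f') by exact: (cm_gram mN).
  have hxx : alg b (adj xi ** xi') by exact: (cm_gram mL).
  rewrite (rho_tri_k1 bB cB mL mM mM' P gd) //.
  rewrite (rho_tri_k1 (dagger_base cB) (dagger_base bB) mN mM' mM Q' dg) //.
  rewrite !compA (rtp_gram1 bB mL mM P) // (rtp_gram1 (dagger_base cB) mN mM' Q') //.
  exact: (rho_comm cB mM' gd).
by exists T; split=> // xi f h1 h2; rewrite -compA; exact: (hT (xi, f)).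
Qed.

End Assoc.

Lemma rtp_transport (H K X X' : hilbertType R) (beta : set 'L(Z, H))
    (gamma : set 'L(Z, K)) k1 k2 (T : 'L(X, X')) :
  unitary T -> rtp beta gamma k1 k2 ->
  rtp beta gamma (fun xi => T ** k1 xi) (fun eta => T ** k2 eta).
Proof.
move=> uT P; split.
- by move=> xi eta h g; rewrite -!compA (rtpE P).
- move=> xi xi' eta eta' h h' g g'; rewrite -!compA adj_comp -compA (compA (adj T)).
  by case: uT => -> _; rewrite comp1l (rtp_gram P) // -!compA.
- rewrite -(total_unitary uT (rtp_total P)); congr cspan; apply/seteqP; split.
    move=> _ [_ [_ [xi h <-] [eta g <-]] [z _ <-]].
    by exists (k1 xi (eta z)); [exists (xi, z, eta)|].
  move=> _ [_ [[[xi z] eta] [/= h g] <-] <-].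
  exists (T ** k1 xi ** eta); last by exists z.
  by exists (T ** k1 xi); [exists xi|exists eta].
Qed.

End Triples.

(** * The legs of an abstract pentagon *)

Section PentagonData.
Variables (R : realType) (Z H : hilbertType R) (b : obase Z).

Lemma comp_r (A B C D : hilbertType R) (S : 'L(B, C)) (T : 'L(A, B)) (U : 'L(A, C)) :
  S ** T = U -> forall X : 'L(C, D), X ** S ** T = X ** U.
Proof. by move=> e X; rewrite -compA e. Qed.

(** Products are kept left-associated; in this form an equation S T = U rewrites inside them, X
    being the part further to the left. *)
Lemma comp_r3 (A B C D E : hilbertType R) (S : 'L(C, D)) (T : 'L(B, C)) (U : 'L(A, B))
    (W : 'L(A, D)) : S ** T ** U = W -> forall X : 'L(D, E), X ** S ** T ** U = X ** W.
Proof. by move=> e X; rewrite -e !compA. Qed.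

Lemma unitary_sw (A B C D : hilbertType R) (W : 'L(A, B)) (S : 'L(C, A))
    (T : 'L(D, B)) (U : 'L(C, D)) :
  unitary W -> unitary U -> W ** S = T ** U -> adj W ** T = S ** adj U.
Proof.
move=> [w1 w2] [u1 u2] e.
by rewrite -[adj W ** T]comp1r -u2 compA (comp_r (esym e)) !compA w1 comp1l.
Qed.

Lemma adj_eq (A B C D : hilbertType R) (W : 'L(A, B)) (S : 'L(C, A))
    (T : 'L(D, B)) (U : 'L(C, D)) :
  W ** S = T ** U -> adj S ** adj W = adj U ** adj T.
Proof. by move=> e; rewrite -!adj_comp e. Qed.

Lemma unitary_set (A B : hilbertType R) (V : 'L(A, B)) (S : set 'L(Z, A)) T :
  unitary V -> omul [set V] S = T -> omul [set adj V] T = S.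
Proof.
move=> [v1 v2] <-; apply/seteqP; split.
  by move=> _ [_ -> [_ [_ -> [w hw <-]] <-]]; rewrite compA v1 comp1l.
move=> w hw; exists (adj V) => //; exists (V ** w); last by rewrite compA v1 comp1l.
by exists V => //; exists w.
Qed.

(* x1, x2 are H hb(x)al H and H al(x)be H, with |.>_1 = a1, c1 and |.>_2 = a2, c2.
   P1, P2, P3 are the threefold products in which the middle factor is attached to
   both others; in P4 (P5) it is the third (first) factor.  W12, W23 are V_12, V_23
   on the left of the pentagon equation, U12, W13, U23 the operators on its right.
   Exchanging P1 with P3, P4 with P5 and all legs turns the data of V into data
   of V^*, see pdata_op. *)
Record pdata (hb al be : set 'L(Z, H)) := PData {
  dB : cstar_base b;
  dM : ctrimodule (dagger b) b (dagger b) hb al be;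
  x1 : hilbertType R;
  x2 : hilbertType R;
  a1 : 'L(Z, H) -> 'L(H, x1);
  a2 : 'L(Z, H) -> 'L(H, x1);
  c1 : 'L(Z, H) -> 'L(H, x2);
  c2 : 'L(Z, H) -> 'L(H, x2);
  dp1 : rtp hb al a1 a2;
  dp2 : rtp al be c1 c2;
  dV : 'L(x1, x2);
  dVu : unitary dV;
  dV1 : omul [set dV] (tri a2 al al) = tri c1 al al;
  dV2 : omul [set dV] (tri a1 hb be) = tri c2 be hb;
  dV3 : omul [set dV] (tri a1 hb hb) = tri c1 al hb;
  dV4 : omul [set dV] (tri a2 al be) = tri c2 be be;
  P1 : triple hb al hb al a1 a2 a1 a2;
  P2 : triple al be hb al c1 c2 a1 a2;
  P3 : triple al be al be c1 c2 c1 c2;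
  P4 : triple hb al be al a1 a2 c2 c1;
  P5 : triple al hb al be a2 a1 c1 c2;
  W12 : 'L(tsp P1, tsp P2);
  W23 : 'L(tsp P2, tsp P3);
  U23 : 'L(tsp P1, tsp P4);
  W13 : 'L(tsp P4, tsp P5);
  U12 : 'L(tsp P5, tsp P3);
  W12u : unitary W12;
  W23u : unitary W23;
  U23u : unitary U23;
  W13u : unitary W13;
  U12u : unitary U12;
  W12E : forall f, al f -> W12 ** tl3 P1 f = tl3 P2 f ** dV;
  W23E : forall xi, al xi -> W23 ** tr1 P2 xi = tr1 P3 xi ** dV;
  U23E : forall xi, hb xi -> U23 ** tr1 P1 xi = tr1 P4 xi ** dV;
  W13E : forall f, al f -> W13 ** tl3 P4 f = tr1 P5 f ** dV;
  U12E : forall f, be f -> U12 ** tl3 P5 f = tl3 P3 f ** dV;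
  dpent : W23 ** W12 = U12 ** W13 ** U23
}.

Section Modules.
Variables (hb al be : set 'L(Z, H)) (D : pdata hb al be).

Lemma pd_ma : cmodule b al. Proof. by case: (dM D) => [[]]. Qed.
Lemma pd_mh : cmodule (dagger b) hb. Proof. by case: (dM D) => [[]]. Qed.
Lemma pd_mb : cmodule (dagger b) be. Proof. by case: (dM D) => _ []. Qed.
Lemma pd_ha : cspan (omul (rho_alg (dagger b) hb) al) = al.
Proof. by case: (dM D) => [[]]. Qed.
Lemma pd_ah : cspan (omul (rho_alg b al) hb) = hb.
Proof. by case: (dM D) => [[]]. Qed.
Lemma pd_ab : cspan (omul (rho_alg b al) be) = be.
Proof. by case: (dM D) => _ _ []. Qed.
Lemma pd_ba : cspan (omul (rho_alg (dagger b) be) al) = al.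
Proof. by case: (dM D) => _ _ []. Qed.
Lemma pd_hb : cspan (omul (rho_alg (dagger b) hb) be) = be.
Proof. by case: (dM D) => _ []. Qed.
Lemma pd_bh : cspan (omul (rho_alg (dagger b) be) hb) = hb.
Proof. by case: (dM D) => _ []. Qed.
Lemma pd_p1' : rtp al hb (@a2 _ _ _ D) (@a1 _ _ _ D).
Proof. exact: (rtp_swap (dagger_base (dB D)) pd_mh pd_ma (dp1 D)). Qed.
Lemma pd_p2' : rtp be al (@c2 _ _ _ D) (@c1 _ _ _ D).
Proof. exact: (rtp_swap (dB D) pd_ma pd_mb (dp2 D)). Qed.

End Modules.

Section Opposite.
Variables (hb al be : set 'L(Z, H)).

Lemma tri_op : ctrimodule (dagger b) b (dagger b) hb al be ->
  ctrimodule (dagger b) b (dagger b) be al hb.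
Proof. by move=> [[? ? ? ?] [? ? ? ?] [? ? ? ?]]; split; split. Qed.

Variable D : pdata hb al be.

(** Adjoints reverse the pentagon equation, so the adjoint of V_23 becomes the new V_12 and
    conversely; the threefold products are read backwards on unchanged spaces. *)
Definition pdata_op : pdata be al hb.
Proof.
refine (@PData be al hb (dB D) (tri_op (dM D)) (x2 D) (x1 D) (@c2 _ _ _ D) (@c1 _ _ _ D)
  (@a2 _ _ _ D) (@a1 _ _ _ D) (pd_p2' D) (pd_p1' D) (adj (dV D)) (unitary_adj (dVu D))
  (unitary_set (dVu D) (dV1 D)) (unitary_set (dVu D) (dV2 D))
  (unitary_set (dVu D) (dV4 D)) (unitary_set (dVu D) (dV3 D))
  (triple_swap (P3 D)) (triple_swap (P2 D)) (triple_swap (P1 D))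
  (triple_swap (P5 D)) (triple_swap (P4 D))
  (adj (W23 D)) (adj (W12 D)) (adj (U12 D)) (adj (W13 D)) (adj (U23 D))
  (unitary_adj (W23u D)) (unitary_adj (W12u D)) (unitary_adj (U12u D))
  (unitary_adj (W13u D)) (unitary_adj (U23u D)) _ _ _ _ _ _).
- by move=> f h; exact: unitary_sw (W23u D) (dVu D) (W23E D h).
- by move=> f h; exact: unitary_sw (W12u D) (dVu D) (W12E D h).
- by move=> f h; exact: unitary_sw (U12u D) (dVu D) (U12E D h).
- by move=> f h; exact: unitary_sw (W13u D) (dVu D) (W13E D h).
- by move=> f h; exact: unitary_sw (U23u D) (dVu D) (U23E D h).
- by rewrite -adj_comp (dpent D) !adj_comp compA.
Defined.

End Opposite.

Section Legs.
Variables (hb al be : set 'L(Z, H)) (D : pdata hb al be).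
Local Notation V := (dV D).
Local Notation a1 := (@a1 _ _ _ D).
Local Notation a2 := (@a2 _ _ _ D).
Local Notation c1 := (@c1 _ _ _ D).
Local Notation c2 := (@c2 _ _ _ D).
Local Notation P1 := (P1 D).
Local Notation P2 := (P2 D).
Local Notation P3 := (P3 D).
Local Notation P4 := (P4 D).
Local Notation P5 := (P5 D).
Local Notation W12 := (W12 D).
Local Notation W23 := (W23 D).
Local Notation U23 := (U23 D).
Local Notation W13 := (W13 D).
Local Notation U12 := (U12 D).

Let bB := dB D.
Let bB' := dagger_base bB.
Let ma := pd_ma D. Let mh := pd_mh D. Let mb := pd_mb D.
Let g_ah := pd_ah D. Let g_ba := pd_ba D. Let g_bh := pd_bh D.
Let p1 := dp1 D.
Let p2 := dp2 D.
Let p1' := pd_p1' D.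
Let Vu := dVu D.

(* pA is A_V and pC is the space [<al|_1 V |al>_2] of semi-regularity; pA of
   pdata_op is the adjoint of hatA_V. *)
Definition legA0 : set 'L(H, H) :=
  omul (oadj (c1 @` al)) (omul [set V] (a1 @` hb)).
Definition pA : set 'L(H, H) := cspan legA0.
Definition pC : set 'L(H, H) :=
  cspan (omul (oadj (c1 @` al)) (omul [set V] (a2 @` al))).

Lemma pA_closed : closed_subspace pA. Proof. exact: cspan_closed. Qed.
Lemma pC_closed : closed_subspace pC. Proof. exact: cspan_closed. Qed.

Lemma pA_gen xi eta : al xi -> hb eta -> pA (adj (c1 xi) ** V ** a1 eta).
Proof.
move=> h g; apply: cspan_sub; exists (adj (c1 xi)).
  by exists (c1 xi) => //; exists xi.
by exists (V ** a1 eta); [exists V => //; exists (a1 eta) => //; exists eta|rewrite compA].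
Qed.

Lemma pC_gen xi f : al xi -> al f -> pC (adj (c1 xi) ** V ** a2 f).
Proof.
move=> h g; apply: cspan_sub; exists (adj (c1 xi)).
  by exists (c1 xi) => //; exists xi.
by exists (V ** a2 f); [exists V => //; exists (a2 f) => //; exists f|rewrite compA].
Qed.

Lemma pA_ind (Q : set 'L(H, H)) : closed_subspace Q ->
  (forall xi eta, al xi -> hb eta -> Q (adj (c1 xi) ** V ** a1 eta)) ->
  forall a, pA a -> Q a.
Proof.
move=> cQ h; apply: cspan_min => // _ [_ [_ [xi hx <-] <-] [_ [_ -> [_ [eta he <-] <-]] <-]].
by rewrite compA; exact: h.
Qed.

Lemma pC_ind (Q : set 'L(H, H)) : closed_subspace Q ->
  (forall xi f, al xi -> al f -> Q (adj (c1 xi) ** V ** a2 f)) ->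
  forall c, pC c -> Q c.
Proof.
move=> cQ h; apply: cspan_min => // _ [_ [_ [xi hx <-] <-] [_ [_ -> [_ [eta he <-] <-]] <-]].
by rewrite compA; exact: h.
Qed.

Lemma Vmem (S : set 'L(Z, x1 D)) T w : omul [set V] S = T -> S w -> T (V ** w).
Proof. by move=> <- hw; exists V => //; exists w. Qed.

Lemma Vmem' (S : set 'L(Z, x1 D)) T w : omul [set V] S = T -> T w -> S (adj V ** w).
Proof. by move=> /(unitary_set Vu) <- hw; exists (adj V) => //; exists w. Qed.

(** V maps hb |> hb onto al |> hb, and <xi|_1 returns to hb. With [pA_adj_hb], elements of A are
    morphisms for hb, which makes a (x) 1 and its adjoint available on the source of V. *)
Lemma pA_hb a eta : pA a -> hb eta -> hb (a ** eta).
Proof.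
move=> ha h; move: a ha.
apply: pA_ind; first exact: csub_compr (cm_closed mh).
move=> xi eta' hx he /=; rewrite -!compA.
apply: (k1_adj_tri bB ma mb mh p2 g_bh hx).
by apply: (Vmem (dV3 D)); exact: tri_sub.
Qed.

Lemma pA_adj_hb a eta : pA a -> hb eta -> hb (adj a ** eta).
Proof.
move=> ha h; move: a ha.
apply: pA_ind; first exact: csub_adj (csub_compr _ (cm_closed mh)).
move=> xi eta' hx he /=; rewrite !adj_comp adjK -!compA.
apply: (k1_adj_tri bB' mh ma mh p1 g_ah he).
by apply: (Vmem' (dV3 D)); exact: tri_sub.
Qed.

Lemma pC_al c f : pC c -> al f -> al (c ** f).
Proof.
move=> hc h; move: c hc.
apply: pC_ind; first exact: csub_compr (cm_closed ma).
move=> xi f' hx he /=; rewrite -!compA.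
apply: (k1_adj_tri bB ma mb ma p2 g_ba hx).
by apply: (Vmem (dV1 D)); exact: tri_sub.
Qed.

(** This and the next lemmas solve the pentagon equation for the product that a given slice argument
    meets between its bras and kets. *)
Lemma pent1 : W13 ** U23 = adj U12 ** W23 ** W12.
Proof.
by rewrite -compA (dpent D) !compA; case: (U12u D) => -> _; rewrite comp1l.
Qed.

Lemma pent2 : W13 ** U23 ** adj W12 = adj U12 ** W23.
Proof. by rewrite pent1 -compA; case: (W12u D) => _ ->; rewrite comp1r. Qed.

Lemma pent3 : W12 ** adj U23 = adj W23 ** U12 ** W13.
Proof.
have -> : W12 = adj W23 ** (W23 ** W12).
  by rewrite compA; case: (W23u D) => -> _; rewrite comp1l.
by rewrite (dpent D) -!compA; case: (U23u D) => _ ->; rewrite comp1r.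
Qed.

Lemma pent4 : adj W12 ** adj W23 = adj U23 ** adj W13 ** adj U12.
Proof. by rewrite -adj_comp (dpent D) !adj_comp compA. Qed.

Lemma pent5 : W23 ** W12 ** adj U23 = U12 ** W13.
Proof. by rewrite (dpent D) -!compA; case: (U23u D) => _ ->; rewrite comp1r. Qed.

Lemma U12_l12 w : tri a2 al al w -> U12 ** tl12 P5 w = tl12 P3 (V ** w).
Proof.
move=> hw; apply: (t_map_l12 (U12E D)) => //; exact: (Vmem (dV1 D)).
Qed.

Lemma W12_l12 w : tri a1 hb hb w -> W12 ** tl12 P1 w = tl12 P2 (V ** w).
Proof.
move=> hw; apply: (t_map_l12 (W12E D)) => //; exact: (Vmem (dV3 D)).
Qed.

Lemma V_l3 f : al f -> V ** adj (tl3 P4 f) = adj (tr1 P5 f) ** W13.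
Proof.
move=> h; have := unitary_sw (W13u D) Vu (W13E D h).
by move/adj_eq; rewrite !adjK => ->.
Qed.

(** From V_13 V_23 = V_12^* V_23 V_12: moving <xi'|_1 past |eta>_1 turns the product of two slices
    into <V w|_12 V_23 |V w'>_12 with V w in al |> al and V w' in al |> hb. Expanding V w' into xi2
    (x) eta2 leaves slices of V again. *)
Lemma pA_mul x y : pA x -> pA y -> pA (x ** y).
Proof.
move=> hx hy; move: x hx; apply: pA_ind; first exact: csub_compr pA_closed.
move=> xi eta h g /=; move: y hy; apply: pA_ind; first exact: csub_compl pA_closed.
move=> xi' eta' h' g' /=.
have [w wE] : exists w, w = a2 xi' ** xi by exists (a2 xi' ** xi).
have [w' wE'] : exists w', w' = a1 eta ** eta' by exists (a1 eta ** eta').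
have hw : tri a2 al al w by rewrite wE; exact: tri_sub.
have hw' : tri a1 hb hb w' by rewrite wE'; exact: tri_sub.
have hVw : tri c1 al al (V ** w) by exact: (Vmem (dV1 D)).
have -> : adj (c1 xi) ** V ** a1 eta ** (adj (c1 xi') ** V ** a1 eta') =
    adj (tl12 P3 (V ** w)) ** W23 ** tl12 P2 (V ** w').
  rewrite !compA (comp_r (esym (t_l3r1 P4 g h'))) !compA (comp_r (V_l3 h')).
  rewrite !compA (comp_r (esym (U23E D g))) !compA (comp_r pent1) !compA.
  rewrite (comp_r (esym (t_l12 P1 g g'))) -wE' (comp_r (W12_l12 hw')).
  rewrite -U12_l12 // adj_comp; congr (_ ** _ ** _ ** _).
  by rewrite -adj_comp wE (t_l12 P5).
have : tri c1 al hb (V ** w') by exact: (Vmem (dV3 D)).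
move: (V ** w') => v hv.
suff [] : [set v | tri c1 al hb v /\ pA (adj (tl12 P3 (V ** w)) ** W23 ** tl12 P2 v)] v by [].
move: v hv; tri_ind.
  exact: (csub_l12 (csub_compl _ pA_closed)).
move=> xi2 eta2 h2 g2; split; first exact: tri_sub.
rewrite (t_l12 P2) // compA (comp_r (W23E D h2)) compA.
have := t_r1l12 P3 h2 hVw => /(congr1 (@adj _ _ _)).
rewrite adj_comp adjK => ->.
apply: pA_gen => //; exact: (k1_adj_tri bB ma mb ma p2 g_ba).
Qed.

Let al_hb_semi t : pC t -> semi_morphism al al t.
Proof. by move=> ht f; exact: pC_al. Qed.

Let lop1 t := lop hb a1 a1 t.

(* From V_12^* V_23 = V_13 V_23 V_12^*. *)
Lemma pC_slice t xi xi' : pC t -> al xi -> al xi' ->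
  pC (adj (c1 xi) ** V ** lop1 t ** adj V ** c1 xi').
Proof.
move=> ht h h'.
suff [] : [set t | semi_morphism al al t /\
   pC (adj (c1 xi) ** V ** lop1 t ** adj V ** c1 xi')] t by [].
move: t ht; apply: pC_ind.
  apply: (csub_lop bB ma mh ma p1' p1'
    (Q := [set S | pC (adj (c1 xi) ** V ** S ** adj V ** c1 xi')])).
  have := csub_compl (adj (c1 xi) ** V) (csub_compr (adj V) (csub_compr (c1 xi') pC_closed)).
  by [].
move=> xi2 f2 h2 g2; have ht := pC_gen h2 g2.
split; first exact: al_hb_semi.
have [w wE] : exists w, w = a2 xi2 ** xi by exists (a2 xi2 ** xi).
have hw : tri a2 al al w by rewrite wE; exact: tri_sub.
have hVw : tri c1 al al (V ** w) by exact: (Vmem (dV1 D)).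
(* 1 (x) <xi2|_1 V |f2>_2 is a slice of V_23 in a threefold product, with xi2 in the second position
   and f2 in the third. *)
have tE : lop1 (adj (c1 xi2) ** V ** a2 f2) = adj (tl3 P4 xi2) ** U23 ** tl3 P1 f2.
  apply/esym/(lop_uniq bB ma mh ma p1' p1' (al_hb_semi ht)) => eta g.
  rewrite (comp_r (tcomp P1 g g2)) !compA (comp_r (U23E D g)) !compA.
  by rewrite (t_l3r1 P4 g h2).
rewrite tE !compA (comp_r (V_l3 h2)) !compA.
have e1 : tl3 P1 f2 ** adj V = adj W12 ** tl3 P2 f2.
  by rewrite (unitary_sw (W12u D) Vu (W12E D g2)).
rewrite (comp_r e1) !compA (comp_r3 pent2) !compA.
rewrite (comp_r (tcomp P2 h' g2)) !compA (comp_r (W23E D h')) !compA.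
have -> : adj (c1 xi) ** adj (tr1 P5 xi2) ** adj U12 = adj (tl12 P3 (V ** w)).
  rewrite -U12_l12 // adj_comp; congr (_ ** _).
  by rewrite -adj_comp wE (t_l12 P5).
have := t_r1l12 P3 h' hVw => /(congr1 (@adj _ _ _)).
rewrite adj_comp adjK => ->.
apply: pC_gen => //; exact: (k1_adj_tri bB ma mb ma p2 g_ba).
Qed.

(** Semi-regularity puts t = f f'^* into C, and 1 (x) t = |f>_2 <f'|_2. The slice of [pC_slice] then
    splits in the middle into an element of C and the adjoint of another. *)
Lemma compact_C f f' xi xi' : cspan (omul al (oadj al)) `<=` pC ->
  al f -> al f' -> al xi -> al xi' ->
  pC (adj (c1 xi) ** V ** a2 f ** adj (adj (c1 xi') ** V ** a2 f')).
Proof.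
move=> sr hf hf' h h'.
have ht : pC (f ** adj f').
  by apply/sr/cspan_sub; exists f => //; exists (adj f') => //; exists f'.
have := pC_slice ht h h'.
have -> : lop1 (f ** adj f') = a2 f ** adj (a2 f').
  apply/esym/(lop_uniq bB ma mh ma p1' p1' (al_hb_semi ht)) => eta g.
  have e : adj (a2 f') ** a1 eta = eta ** adj f'.
    apply: (cm_ext ma) => f2 hf2.
    rewrite -compA (rtpE p1) // compA (rtp_k1_gram bB ma mh p1') //.
    by rewrite compA.
  by rewrite (comp_r e) compA -(rtpE p1) // -compA.
by rewrite !adj_comp !adjK !compA.
Qed.

Lemma pC_CC : cspan (omul al (oadj al)) `<=` pC ->
  forall x y, pC x -> pC y -> pC (x ** adj y).
Proof.
move=> sr x y hx hy; move: x hx; apply: pC_ind; first exact: csub_compr pC_closed.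
move=> xi f h g; move: y hy; apply: pC_ind.
  exact: (csub_adj (P := [set y | pC (adj (c1 xi) ** V ** a2 f ** y)])
    (csub_compl _ pC_closed)).
by move=> xi' f' h' g'; exact: compact_C.
Qed.

End Legs.

Lemma pC_op (hb al be : set 'L(Z, H)) (D : pdata hb al be) x :
  pC (pdata_op D) x <-> pC D (adj x).
Proof.
split; move: x.
  apply: pC_ind; first exact/csub_adj/pC_closed.
  by move=> xi f h g; rewrite !adj_comp !adjK compA; exact: pC_gen.
move=> x; rewrite -{2}(adjK x); move: (adj x).
apply: pC_ind; first exact/csub_adj/pC_closed.
move=> xi f h g; rewrite !adj_comp !adjK compA.
exact: (@pC_gen _ _ _ (pdata_op D)).
Qed.

Definition semireg (hb al be : set 'L(Z, H)) (D : pdata hb al be) :=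
  cspan (omul al (oadj al)) `<=` pC D.

(** [al al^*] is self-adjoint, and the space C of the opposite data is the adjoint of C. *)
Lemma semireg_op (hb al be : set 'L(Z, H)) (D : pdata hb al be) :
  semireg D -> semireg (pdata_op D).
Proof.
move=> sr x hx; apply/pC_op/sr; move: x hx; span_ind.
  exact: csub_adj (cspan_closed _).
move=> _ [f hf [_ [f' hf' <-] <-]]; apply: cspan_sub.
by rewrite adj_comp adjK; exists f' => //; exists (adj f) => //; exists f.
Qed.

Lemma pC_star (hb al be : set 'L(Z, H)) (D : pdata hb al be) : semireg D ->
  forall x, pC D x -> pC D (adj x).
Proof.
move=> sr; apply: star_closed; first exact: pC_closed.
  exact: pC_CC.
(* For the opposite data [pC_CC] gives y^* x in C^*, that is x^* y in C. *)
move=> x y hx hy; have := @pC_CC _ _ _ (pdata_op D) (semireg_op sr) (adj y) (adj x).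
rewrite !pC_op !adj_comp !adjK; exact.
Qed.

End PentagonData.

(** * Self-adjointness of a leg and slices of its comultiplication *)

Section LegAlgebra.
Variables (R : realType) (Z H : hilbertType R) (b : obase Z).
Variables (hb al be : set 'L(Z, H)) (D : pdata b hb al be).
Hypothesis sr : semireg D.
Local Notation V := (dV D).
Local Notation a1 := (@a1 _ _ _ _ _ _ _ D).
Local Notation a2 := (@a2 _ _ _ _ _ _ _ D).
Local Notation c1 := (@c1 _ _ _ _ _ _ _ D).
Local Notation c2 := (@c2 _ _ _ _ _ _ _ D).
Local Notation P1 := (P1 D).
Local Notation P2 := (P2 D).
Local Notation P3 := (P3 D).
Local Notation P4 := (P4 D).
Local Notation P5 := (P5 D).
Local Notation W12 := (W12 D).
Local Notation W23 := (W23 D).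
Local Notation U23 := (U23 D).
Local Notation W13 := (W13 D).
Local Notation U12 := (U12 D).
Local Notation A := (pA D).
Local Notation C := (pC D).

Let bB := dB D.
Let bB' := dagger_base bB.
Let ma := pd_ma D. Let mh := pd_mh D. Let mb := pd_mb D.
Let g_ha := pd_ha D. Let g_ah := pd_ah D. Let g_ba := pd_ba D.
Let p1 := dp1 D.
Let p2 := dp2 D.
Let p1' := pd_p1' D.
Let Vu := dVu D.
Let cA := pA_closed D.

(** [legE a] is a (x) 1 on the source of V, and [legG c] is c (x) 1 on its target. *)
Definition legE (a : 'L(H, H)) : 'L(x1 D, x1 D) := lop al a2 a2 a.
Definition legG (c : 'L(H, H)) : 'L(x2 D, x2 D) := lop be c2 c2 c.

Let A_semi a : A a -> semi_morphism hb hb a.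
Proof. by move=> ha f; exact: (pA_hb ha). Qed.

Let A_mor a : A a -> morphism hb hb a.
Proof. by move=> ha; split=> f; [exact: (pA_hb ha)|exact: (pA_adj_hb ha)]. Qed.

Let C_semi c : C c -> semi_morphism al al c.
Proof. by move=> hc f; exact: (pC_al hc). Qed.

Let C_mor c : C c -> morphism al al c.
Proof. by move=> hc; split; [exact: C_semi|exact: (C_semi (pC_star sr hc))]. Qed.

Lemma legE_gen xi eta : al xi -> hb eta ->
  legE (adj (c1 xi) ** V ** a1 eta) = adj (tr1 P2 xi) ** W12 ** tr1 P1 eta.
Proof.
move=> h g; apply: esym.
apply: (lop_uniq bB' mh ma mh p1 p1 (A_semi (pA_gen (D := D) h g))) => f hf.
rewrite (comp_r (esym (tcomp P1 g hf))) !compA (comp_r (W12E D hf)) !compA.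
by rewrite (t_r1l3 P2 h hf).
Qed.

Lemma legG_gen xi f : al xi -> al f ->
  legG (adj (c1 xi) ** V ** a2 f) = adj (tr1 P3 xi) ** U12 ** tr1 P5 f.
Proof.
move=> h g; apply: esym.
apply: (lop_uniq bB ma mb ma p2 p2 (C_semi (pC_gen (D := D) h g))) => eta he.
rewrite (comp_r (esym (tcomp P5 g he))) !compA (comp_r (U12E D he)) !compA.
by rewrite (t_r1l3 P3 h he).
Qed.

(** A slice of V_12 V_23^* = V_23^* V_12 V_13: an element of A and one of C with the same bra xi are
    traded for each other, while the kets eta and f change places. *)
Lemma legEG xi eta f : al xi -> hb eta -> al f ->
  legE (adj (c1 xi) ** V ** a1 eta) ** adj V ** c1 f =
  adj V ** legG (adj (c1 xi) ** V ** a2 f) ** V ** a1 eta.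
Proof.
move=> h g hf; rewrite legE_gen // legG_gen //.
have e1 : tr1 P1 eta ** adj V = adj U23 ** tr1 P4 eta.
  by rewrite (unitary_sw (U23u D) Vu (U23E D g)).
rewrite (comp_r e1) !compA (comp_r (pent3 D)) !compA.
rewrite (comp_r (esym (tcomp P4 g hf))) !compA (comp_r (W13E D hf)) !compA.
by rewrite (adj_eq (W23E D h)).
Qed.

Lemma legE_a1 a eta : A a -> hb eta -> legE a ** a1 eta = a1 (a ** eta).
Proof. by move=> ha h; exact: (lop_k1 bB' mh ma mh p1 p1 (A_semi ha)). Qed.

Lemma legE_a2 a f : A a -> al f -> legE a ** a2 f = a2 f ** a.
Proof. by move=> ha h; exact: (lopE bB' mh ma mh p1 p1 (A_semi ha)). Qed.

Lemma legE_adj a : A a -> adj (legE a) = legE (adj a).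
Proof. by move=> ha; exact: (lop_adj bB' mh ma mh p1 p1 (A_mor ha)). Qed.

Lemma adj_a1_legE a eta : A a -> hb eta -> adj (a1 eta) ** legE a = adj (a1 (adj a ** eta)).
Proof.
move=> ha h; rewrite -[LHS]adjK adj_comp adjK legE_adj //; congr adj.
have := A_mor ha => -[_ ha'].
exact: (lop_k1 bB' mh ma mh p1 p1 ha').
Qed.

(** hb is spanned by the rho al (eta1^* eta2) eta = <eta1|_1 |eta2>_1 eta. Inserting V^* V and
    expanding V |eta2>_1 eta in al |> hb produces the factors <eta1|_1 V^* |xi>_1, adjoints of
    generators of A. *)
Lemma hb_dense : hb `<=` cspan (omul (oadj (legA0 D)) hb).
Proof.
move=> eta; rewrite -{1}g_ah; move: eta; span_ind; first exact: cspan_closed.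
move=> _ [x hx [eta g <-]].
case: hx => y hy <-.
have : cspan (omul (oadj hb) hb) y by case: mh => _ _ _ ->.
move=> hy'; suff [] : [set y | algd b y /\ cspan (omul (oadj (legA0 D)) hb) (rho al y ** eta)] y by [].
move: y {hy} hy'; span_ind.
  apply: (csub_preim_on (g := id) (M := `|eta|) (f := fun y => rho al y ** eta)).
  - by case: bB => _ [[]].
  - exact: cspan_closed.
  - by move=> a u v hu hv; rewrite (rho_lin bB ma) // compDl compZl.
  - move=> u hu; apply: le_trans (comp_norm _ _) _; rewrite mulrC ler_wpM2l //.
    exact: (rho_norm bB ma).
move=> _ [_ [eta1 g1 <-] [eta2 g2 <-]]; split; first exact: (cm_gram mh).
rewrite -(rtp_gram1 bB' mh ma p1) // -compA.
have : tri a1 hb hb (a1 eta2 ** eta) by exact: tri_sub.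
move=> /(Vmem (dV3 D)) hw.
have -> : a1 eta2 ** eta = adj V ** (V ** (a1 eta2 ** eta)).
  by rewrite compA; case: Vu => -> _; rewrite comp1l.
move: (V ** _) hw; tri_ind.
  exact: csub_compl (csub_compl _ (cspan_closed _)).
move=> xi eta' h g' /=; apply: cspan_sub.
exists (adj (adj (c1 xi) ** (V ** a1 eta1))); last first.
  by exists eta' => //; rewrite !adj_comp adjK !compA.
exists (adj (c1 xi) ** (V ** a1 eta1)) => //.
exists (adj (c1 xi)); first by exists (c1 xi) => //; exists xi.
by exists (V ** a1 eta1) => //; exists V => //; exists (a1 eta1) => //; exists eta1.
Qed.

Let legA0_gen a : legA0 D a -> exists xi eta, [/\ al xi, hb eta &
  a = adj (c1 xi) ** V ** a1 eta].
Proof.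
move=> [_ [_ [xi h <-] <-] [_ [_ -> [_ [eta g <-] <-]] <-]].
by exists xi, eta; rewrite compA.
Qed.

(* A^* is spanned by the slices <hb|_1 V^* (C (x) 1) V |hb>_1, and C = C^*. *)
Lemma pA_star a : A a -> A (adj a).
Proof.
pose E0 : set 'L(H, H) := [set x | exists c eta eta', [/\ C c, hb eta, hb eta' &
  x = adj (a1 eta) ** adj V ** legG c ** V ** a1 eta']].
(* [legEG] turns V^* (c (x) 1) V |eta'>_1 into (a (x) 1) V^* |f>_1; the bra <eta|_1 absorbs a (x) 1
   by becoming <a^* eta|_1, and the adjoint of a generator of A remains. *)
have E_A x : cspan E0 x -> A (adj x).
  move: x; span_ind; first exact: csub_adj.
  move=> _ [c [eta [eta' [hc g g' ->]]]].
  suff [] : [set c | semi_morphism al al c /\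
    A (adj (adj (a1 eta) ** adj V ** legG c ** V ** a1 eta'))] c by [].
  move: c hc; apply: pC_ind.
    apply: (csub_lop bB ma mb ma p2 p2
      (Q := [set S | A (adj (adj (a1 eta) ** adj V ** S ** V ** a1 eta'))])).
    have := csub_compl (adj (a1 eta) ** adj V) (csub_compr V (csub_compr (a1 eta') (csub_adj cA))).
    by [].
  move=> xi f h hf; split; first exact/C_semi/pC_gen.
  have -> : adj (a1 eta) ** adj V ** legG (adj (c1 xi) ** V ** a2 f) ** V ** a1 eta' =
      adj (a1 eta) ** legE (adj (c1 xi) ** V ** a1 eta') ** adj V ** c1 f.
    by rewrite (comp_r3 (legEG h g' hf)) !compA.
  have ha := pA_gen (D := D) h g'.
  rewrite (adj_a1_legE ha g); have := pA_adj_hb ha g.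
  move: (adj (adj (c1 xi) ** V ** a1 eta') ** eta) => v hv.
  by rewrite !adj_comp !adjK compA; exact: pA_gen.
(* Conversely [hb_dense] supplies eta in the form a^* eta', and the same identity is read
   backwards. *)
have A_E x : A x -> cspan E0 (adj x).
  move: x; apply: pA_ind; first exact/csub_adj/cspan_closed.
  move=> xi eta h g /=; rewrite !adj_comp adjK compA.
  suff [] : [set eta | hb eta /\ cspan E0 (adj (a1 eta) ** adj V ** c1 xi)] eta by [].
  move: eta g; apply: subset_trans hb_dense _; apply: cspan_min.
    apply: (csub_k1 bB' mh ma p1 (S := [set S | cspan E0 (adj S ** adj V ** c1 xi)])).
    have := csub_adj (csub_compr (adj V) (csub_compr (c1 xi) (cspan_closed E0))).
    by [].
  move=> _ [_ [a0 /legA0_gen[xi' [eta [h' g ->]]] <-] [eta' g' <-]].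
  have ha := pA_gen (D := D) h' g.
  split; first exact: (pA_adj_hb ha).
  rewrite -adj_a1_legE // (comp_r3 (legEG h' g h)).
  apply: cspan_sub; exists (adj (c1 xi') ** V ** a2 xi), eta', eta.
  by rewrite !compA; split=> //; exact: pC_gen.
have E_adj x : cspan E0 x -> cspan E0 (adj x).
  move: x; span_ind; first exact/csub_adj/cspan_closed.
  move=> _ [c [eta [eta' [hc g g' ->]]]]; apply: cspan_sub.
  exists (adj c), eta', eta; split=> //; first exact: pC_star.
  by rewrite !adj_comp !adjK (lop_adj bB ma mb ma p2 p2 (C_mor hc)) !compA.
by move=> ha; apply: E_A; rewrite -(adjK a); exact/E_adj/A_E.
Qed.

Lemma pA_rho_be x a : alg b x -> A a -> A (rho be x ** a).
Proof.
move=> hx ha; move: a ha; apply: pA_ind; first exact: csub_compl.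
move=> xi eta h g /=; rewrite !compA.
have -> : rho be x ** adj (c1 xi) = adj (c1 (xi ** adj x)).
  rewrite (k1_mul bB ma mb p2 h (alg_adj bB hx)) adj_comp.
  by rewrite (rho_adj bB' mb (alg_adj bB hx)) adjK.
by apply: pA_gen => //; exact: (cm_mul ma h (alg_adj bB hx)).
Qed.

Let mX1 : cmodule b (tri a2 al al) := tri_cmodule bB bB ma mh ma p1' g_ha.
Let mX2 : cmodule b (tri c1 al al) := tri_cmodule bB bB ma mb ma p2 g_ba.

(** rho al y passes from the bra through V to the ket: V maps the module al <| al onto al |> al and
    so intertwines their representations. *)
Lemma pA_rho_al y a : algd b y -> A a -> A (rho al y ** a).
Proof.
move=> hy ha; move: a ha; apply: pA_ind; first exact: csub_compl.
move=> xi eta h g /=; rewrite !compA.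
have hy' := algd_adj bB hy.
have e1 : rho al y ** adj (c1 xi) = adj (c1 xi) ** rho (tri c1 al al) y.
  have := congr1 (@adj _ _ _) (rho_tri_k1 bB bB ma mb ma p2 g_ba hy' h).
  by rewrite !adj_comp (rho_adj bB mX2 hy') (rho_adj bB ma hy') !adjK.
have e2 : rho (tri c1 al al) y ** V = V ** rho (tri a2 al al) y.
  apply: (cm_ext mX1) => w hw.
  rewrite -!compA (rhoE bB mX1) // (rhoE bB mX2) ?compA //.
  exact: (Vmem (dV1 D)).
have e3 : rho (tri a2 al al) y ** a1 eta = a1 (rho al y ** eta).
  exact: (rho_tri_k2 bB bB ma mh ma p1' g_ha g_ah hy g).
rewrite e1 (comp_r e2) compA (comp_r e3); apply: pA_gen => //.
exact: (rho_semi g_ah hy g).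
Qed.

Definition pDelta (a : 'L(H, H)) : 'L(x2 D, x2 D) := V ** legE a ** adj V.

Lemma pDelta_adj a : A a -> adj (pDelta a) = pDelta (adj a).
Proof. by move=> ha; rewrite /pDelta !adj_comp adjK legE_adj // compA. Qed.

Lemma pDelta_lin x a a' : A a -> A a' -> pDelta (x *: a + a') = x *: pDelta a + pDelta a'.
Proof.
move=> ha ha'; rewrite /pDelta /legE.
rewrite (lop_lin bB' mh ma mh p1 p1 _ (A_semi ha) (A_semi ha')).
by rewrite compDr compDl compZr compZl.
Qed.

Lemma pDelta_mul a a' : A a -> A a' -> pDelta (a ** a') = pDelta a ** pDelta a'.
Proof.
move=> ha ha'; rewrite /pDelta.
have -> : legE (a ** a') = legE a ** legE a'.
  apply: esym; apply: (lop_uniq bB' mh ma mh p1 p1 (A_semi (pA_mul ha ha'))) => f hf.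
  by rewrite -compA legE_a2 // compA legE_a2 // compA.
rewrite !compA; congr (_ ** _); rewrite -!compA; congr (_ ** _); congr (_ ** _).
by rewrite compA; case: Vu => -> _; rewrite comp1l.
Qed.

(* From V_12^* V_23^* = V_23^* V_13^* V_12^*. *)
Lemma pDelta_c1 a xi : A a -> al xi ->
  cspan (omul (c1 @` al) A) (pDelta a ** c1 xi).
Proof.
(* The adjoint pentagon equation computes the adjoint of Delta(a) on |xi>_1; as A is self-adjoint,
   this covers Delta(a) too. *)
move=> ha h; rewrite -(adjK a); have := pA_star ha; move: (adj a) => {ha}.
move=> {}a ha; rewrite -(pDelta_adj ha) /pDelta !adj_comp adjK compA.
suff [] : [set a | semi_morphism hb hb a /\
   cspan (omul (c1 @` al) A) (V ** adj (legE a) ** adj V ** c1 xi)] a by [].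
move: a ha; apply: pA_ind.
  apply: (csub_lop bB' mh ma mh p1 p1
    (Q := [set S | cspan (omul (c1 @` al) A) (V ** adj S ** adj V ** c1 xi)])).
  have := csub_adj (csub_compl V (csub_compr (adj V) (csub_compr (c1 xi)
    (cspan_closed (omul (c1 @` al) A))))).
  by [].
move=> xi' eta h' g; split; first exact/A_semi/pA_gen.
rewrite legE_gen // !adj_comp adjK !compA.
rewrite (comp_r (esym (unitary_sw (W23u D) Vu (W23E D h')))) !compA.
rewrite (comp_r (pent4 D)) !compA (comp_r (esym (t_l12 P3 h' h))).
have [w wE] : exists w, w = c1 xi' ** xi by exists (c1 xi' ** xi).
have hw : tri c1 al al w by rewrite wE; exact: tri_sub.
have hVw : tri a2 al al (adj V ** w) by exact: (Vmem' (dV1 D)).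
have e1 : adj U12 ** tl12 P3 w = tl12 P5 (adj V ** w).
  apply: t_map_l12 => // f hf.
  exact: unitary_sw (U12u D) Vu (U12E D hf).
rewrite -wE (comp_r e1); move: (adj V ** w) hVw => v hv.
set S := V ** _ ** _ ** _.
suff [] : [set v | tri a2 al al v /\ cspan (omul (c1 @` al) A) (S ** tl12 P5 v)] v by [].
move: v hv; tri_ind.
  exact: (csub_l12 (csub_compl _ (cspan_closed _))).
move=> xi2 xi3 h2 h3; split; first exact: tri_sub.
rewrite (t_l12 P5) // /S !compA.
rewrite (comp_r (unitary_sw (W13u D) Vu (W13E D h2))) !compA.
rewrite (comp_r (adj_eq (U23E D g))) !compA.
case: (Vu) => _ ->; rewrite comp1l (t_r1l3 P4) //.
rewrite -!compA; apply: cspan_sub; exists (c1 xi2); first by exists xi2.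
exists (adj (a1 eta) ** (adj V ** c1 xi3)) => //.
have := pA_star (pA_gen (D := D) h3 g).
by rewrite !adj_comp adjK.
Qed.

(* From V_23 V_12 V_23^* = V_12 V_13. *)
Lemma pDelta_c2 a eta : A a -> be eta ->
  cspan (omul (c2 @` be) A) (pDelta a ** c2 eta).
Proof.
move=> ha h; rewrite /pDelta.
suff [] : [set a | semi_morphism hb hb a /\
   cspan (omul (c2 @` be) A) (V ** legE a ** adj V ** c2 eta)] a by [].
move: a ha; apply: pA_ind.
  apply: (csub_lop bB' mh ma mh p1 p1
    (Q := [set S | cspan (omul (c2 @` be) A) (V ** S ** adj V ** c2 eta)])).
  have := csub_compl V (csub_compr (adj V) (csub_compr (c2 eta)
    (cspan_closed (omul (c2 @` be) A)))).
  by [].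
move=> xi eta' h' g; split; first exact/A_semi/pA_gen.
rewrite legE_gen // !compA.
have e0 : V ** adj (tr1 P2 xi) = adj (tr1 P3 xi) ** W23.
  have := adj_eq (unitary_sw (W23u D) Vu (W23E D h')).
  by rewrite !adjK.
rewrite e0 (comp_r (esym (unitary_sw (U23u D) Vu (U23E D g)))) !compA.
rewrite (comp_r3 (pent5 D)) !compA (comp_r (esym (t_l12 P4 g h))).
have [w wE] : exists w, w = a1 eta' ** eta by exists (a1 eta' ** eta).
have hw : tri a1 hb be w by rewrite wE; exact: tri_sub.
have hVw : tri c2 be hb (V ** w) by exact: (Vmem (dV2 D)).
have e1 : W13 ** tl12 P4 w = tr23 P5 (V ** w).
  exact: (t_map_l12 (t' := triple_swap P5) (W13E D)).
rewrite -wE (comp_r e1); move: (V ** w) hVw => v hv.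
suff [] : [set v | tri c2 be hb v /\ cspan (omul (c2 @` be) A)
  (adj (tr1 P3 xi) ** U12 ** tr23 P5 v)] v by [].
move: v hv; tri_ind.
  exact: (csub_l12 (t := triple_swap P5) (csub_compl _ (cspan_closed _))).
move=> eta2 eta3 h2 h3; split; first exact: tri_sub.
have -> : tr23 P5 (c2 eta2 ** eta3) = tl3 P5 eta2 ** a1 eta3.
  exact: (t_l12 (triple_swap P5)).
rewrite compA.
rewrite (comp_r (U12E D h2)) compA (t_r1l3 P3) // -!compA.
apply: cspan_sub; exists (c2 eta2); first by exists eta2.
by exists (adj (c1 xi) ** (V ** a1 eta3)) => //; rewrite compA; exact: pA_gen.
Qed.

End LegAlgebra.

(** * Fiber products and coassociativity *)

Section Fiber.
Variables (R : realType) (Z : hilbertType R).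

(** For the concrete kets this is [fiber] by conversion; on abstract products it can also be read
    with the legs exchanged. *)
Definition gfiber (H K X : hilbertType R) (beta : set 'L(Z, H)) (gamma : set 'L(Z, K))
    (k1 : 'L(Z, H) -> 'L(K, X)) (k2 : 'L(Z, K) -> 'L(H, X))
    (A : set 'L(H, H)) (B : set 'L(K, K)) : set 'L(X, X) :=
  let B1 := cspan (omul (k1 @` beta) B) in
  let A2 := cspan (omul (k2 @` gamma) A) in
  [set x | [/\ omul [set x] (k1 @` beta) `<=` B1,
               omul [set adj x] (k1 @` beta) `<=` B1,
               omul [set x] (k2 @` gamma) `<=` A2 &
               omul [set adj x] (k2 @` gamma) `<=` A2]].

Lemma gfiber_swap (H K X : hilbertType R) (beta : set 'L(Z, H)) (gamma : set 'L(Z, K))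
    (k1 : 'L(Z, H) -> 'L(K, X)) (k2 : 'L(Z, K) -> 'L(H, X)) A B :
  gfiber beta gamma k1 k2 A B = gfiber gamma beta k2 k1 B A.
Proof. by apply/seteqP; split=> x [h1 h2 h3 h4]; split. Qed.

Section Slice.
Variables (H K X : hilbertType R) (beta : set 'L(Z, H)).
Variables (k1 : 'L(Z, H) -> 'L(K, X)) (B : set 'L(K, K)).

Definition slice_in (x : 'L(X, X)) :=
  forall xi, beta xi -> cspan (omul (k1 @` beta) B) (x ** k1 xi).

Lemma slice_inP x : omul [set x] (k1 @` beta) `<=` cspan (omul (k1 @` beta) B) <->
  slice_in x.
Proof.
split=> [h xi hx|h _ [_ -> [_ [xi hx <-] <-]]]; last exact: h.
by apply: h; exists x => //; exists (k1 xi) => //; exists xi.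
Qed.

Lemma slice_sub xi d : beta xi -> B d -> cspan (omul (k1 @` beta) B) (k1 xi ** d).
Proof. by move=> h hd; apply: cspan_sub; exists (k1 xi); [exists xi|exists d]. Qed.

Lemma slice_closed : closed_subspace [set x | slice_in x].
Proof. by apply: csub_all => xi h; exact: csub_compr (cspan_closed _). Qed.

Lemma slice_ind (P : set 'L(K, X)) : closed_subspace P ->
  (forall xi d, beta xi -> B d -> P (k1 xi ** d)) ->
  forall w, cspan (omul (k1 @` beta) B) w -> P w.
Proof. by move=> cP h; apply: cspan_min => // _ [_ [xi hx <-] [d hd <-]]; exact: h. Qed.

Lemma slice_mul x y : omul B B `<=` B -> slice_in x -> slice_in y -> slice_in (x ** y).
Proof.
move=> BB hx hy xi h; rewrite -compA; move: (y ** k1 xi) (hy _ h).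
apply: slice_ind; first exact: csub_compl (cspan_closed _).
move=> xi' d h' hd /=; rewrite compA; move: (x ** k1 xi') (hx _ h').
apply: slice_ind; first exact: csub_compr (cspan_closed _).
move=> xi2 d2 h2 hd2 /=; rewrite -compA; apply: slice_sub => //.
by apply: BB; exists d2 => //; exists d.
Qed.

End Slice.

Lemma gfiberP (H K X : hilbertType R) (beta : set 'L(Z, H)) (gamma : set 'L(Z, K))
    (k1 : 'L(Z, H) -> 'L(K, X)) (k2 : 'L(Z, K) -> 'L(H, X)) A B x :
  gfiber beta gamma k1 k2 A B x <->
  [/\ slice_in beta k1 B x, slice_in beta k1 B (adj x),
      slice_in gamma k2 A x & slice_in gamma k2 A (adj x)].
Proof. by split=> -[h1 h2 h3 h4]; split; apply/slice_inP. Qed.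

Lemma gfiber_alg (H K X : hilbertType R) (beta : set 'L(Z, H)) (gamma : set 'L(Z, K))
    (k1 : 'L(Z, H) -> 'L(K, X)) (k2 : 'L(Z, K) -> 'L(H, X)) A B :
  cstar_alg A -> cstar_alg B -> cstar_alg (gfiber beta gamma k1 k2 A B).
Proof.
move=> [cA AA _] [cB BB _]; split.
- have -> : gfiber beta gamma k1 k2 A B =
     ([set x | slice_in beta k1 B x] `&` [set x | slice_in beta k1 B (adj x)]) `&`
     ([set x | slice_in gamma k2 A x] `&` [set x | slice_in gamma k2 A (adj x)]).
    apply/seteqP; split=> x.
      by move=> /gfiberP[h1 h2 h3 h4]; split; split.
    by move=> [[h1 h2] [h3 h4]]; apply/gfiberP; split.
  by apply: csubI; apply: csubI; do ?[exact: slice_closed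
    |exact: csub_adj (slice_closed _ _ _)].
- move=> _ [x /gfiberP[h1 h2 h3 h4] [y /gfiberP[g1 g2 g3 g4] <-]].
  by apply/gfiberP; rewrite adj_comp; split; exact: slice_mul.
- move=> _ [x /gfiberP[h1 h2 h3 h4] <-].
  by apply/gfiberP; rewrite adjK.
Qed.

Section Module.
Variables (b c d : obase Z) (H K X : hilbertType R).
Variables (beta alpha : set 'L(Z, H)) (gamma delta : set 'L(Z, K)).
Variables (k1 : 'L(Z, H) -> 'L(K, X)) (k2 : 'L(Z, K) -> 'L(H, X)).
Hypothesis bB : cstar_base b.
Hypothesis cB : cstar_base c.
Hypothesis mB : cmodule b beta.
Hypothesis mG : cmodule (dagger b) gamma.
Hypothesis mA : cmodule c alpha.
Hypothesis P : rtp beta gamma k1 k2.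
Hypothesis ba : cspan (omul (rho_alg b beta) alpha) = alpha.
Hypothesis ab : cspan (omul (rho_alg c alpha) beta) = beta.

Let P' := rtp_swap bB mB mG P.
Let bB' := dagger_base bB.

Lemma tri2_cmodule : cmodule c (tri k2 gamma alpha).
Proof. exact: (tri_cmodule bB' cB mG mB mA P' ba). Qed.

Let r_k2 y eta : algd c y -> gamma eta ->
  rho (tri k2 gamma alpha) y ** k2 eta = k2 eta ** rho alpha y.
Proof. exact: (rho_tri_k1 bB' cB mG mB mA P' ba). Qed.

Let r_k1 y xi : algd c y -> beta xi ->
  rho (tri k2 gamma alpha) y ** k1 xi = k1 (rho alpha y ** xi).
Proof. exact: (rho_tri_k2 bB' cB mG mB mA P' ba ab). Qed.

(** On |xi>_1 the representation acts through rho alpha on xi, and these images are total in beta by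
    [ab]. *)
Lemma rho_tri_span : cspan (omul (rho_alg c (tri k2 gamma alpha)) (tri k1 beta delta)) =
  tri k1 beta delta.
Proof.
apply/seteqP; split.
  apply: cspan_min; first exact: cspan_closed.
  move=> _ [_ [y hy <-] [w hw <-]]; move: w hw; tri_ind.
    exact: csub_compl (cspan_closed _).
  move=> xi e h he; rewrite compA r_k1 //; apply: tri_sub => //.
  exact: (rho_semi ab).
apply: tri_min; first exact: cspan_closed.
move=> xi e h he.
suff [] : [set xi | beta xi /\ cspan (omul (rho_alg c (tri k2 gamma alpha))
  (tri k1 beta delta)) (k1 xi ** e)] xi by [].
move: h; rewrite -{1}ab; move: xi; span_ind.
  exact: (csub_k1 bB mB mG P (csub_compr e (cspan_closed _))).
move=> _ [_ [y hy <-] [xi h <-]]; split; first exact: (rho_semi ab).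
rewrite -r_k1 // -compA; apply: cspan_sub.
exists (rho (tri k2 gamma alpha) y); first by exists y.
by exists (k1 xi ** e) => //; exact: tri_sub.
Qed.

Lemma gfiber_rho (A : set 'L(H, H)) (B : set 'L(K, K)) : cstar_alg A ->
  omul (rho_alg c alpha) A `<=` A ->
  omul (rho_alg c (tri k2 gamma alpha)) (gfiber beta gamma k1 k2 A B) `<=`
  gfiber beta gamma k1 k2 A B.
Proof.
move=> [_ _ sA] rA _ [_ [y hy <-] [x /gfiberP[h1 h2 h3 h4] <-]].
have hy' := algd_adj cB hy.
have rA' z a : algd c z -> A a -> A (a ** rho alpha z).
  move=> hz ha; rewrite -[_ ** _]adjK; apply: (sA); eexists; last by [].
  rewrite adj_comp; apply: rA; exists (adj (rho alpha z)).
    exists (adj z); first exact: algd_adj.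
    by rewrite (rho_adj cB mA).
  by exists (adj a) => //; apply: sA; exists a.
have ra : adj (rho (tri k2 gamma alpha) y) = rho (tri k2 gamma alpha) (adj y).
  exact: (rho_adj cB tri2_cmodule).
apply/gfiberP; rewrite adj_comp ra; split=> xi h; rewrite -compA.
- move: (x ** k1 xi) (h1 _ h); apply: slice_ind.
    exact: csub_compl (cspan_closed _).
  move=> xi' e h' he /=; rewrite compA r_k1 //; apply: slice_sub => //.
  exact: (rho_semi ab).
- by rewrite r_k1 //; apply: h2; exact: (rho_semi ab).
- move: (x ** k2 xi) (h3 _ h); apply: slice_ind.
    exact: csub_compl (cspan_closed _).
  move=> eta e h' he /=; rewrite compA r_k2 // -compA; apply: slice_sub => //.
  by apply: rA; exists (rho alpha y); [exists y|exists e].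
- rewrite r_k2 // compA; move: (adj x ** k2 xi) (h4 _ h); apply: slice_ind.
    exact: csub_compr (cspan_closed _).
  move=> eta e h' he /=; rewrite -compA; apply: slice_sub => //.
  exact: rA'.
Qed.

End Module.

(** (S (x) id) |xi>_1 = |S xi>_1 and the S xi are total in beta', so the ranges of the S (x) id are
    total. This yields uniqueness of the maps between fiber products. *)
Lemma joint_ext (b : obase Z) (H H' K X X' Y : hilbertType R) (beta : set 'L(Z, H))
    (beta' : set 'L(Z, H')) (gamma : set 'L(Z, K))
    (k1 : 'L(Z, H) -> 'L(K, X)) (k2 : 'L(Z, K) -> 'L(H, X))
    (k1' : 'L(Z, H') -> 'L(K, X')) (k2' : 'L(Z, K) -> 'L(H', X'))
    (F : set 'L(H, H')) (U W : 'L(X', Y)) :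
  cstar_base b -> cmodule b beta -> cmodule b beta' -> cmodule (dagger b) gamma ->
  rtp beta gamma k1 k2 -> rtp beta' gamma k1' k2' ->
  (forall S, F S -> semi_morphism beta beta' S) -> cspan (omul F beta) = beta' ->
  (forall S, F S -> U ** lop gamma k2 k2' S = W ** lop gamma k2 k2' S) -> U = W.
Proof.
move=> bB mB mB' mG P P' Fs Ft h; apply: (rtp_ext1 P') => xi h'.
suff [_ /= e] : [set xi | beta' xi /\ [set 0] ((U - W) ** k1' xi)] xi.
  by apply/eqP; rewrite -subr_eq0 -compBl e.
move: h'; rewrite -{1}Ft; move: xi; span_ind.
  apply: (csub_k1 bB mB' mG P' (S := [set S | [set 0] ((U - W) ** S)])).
  exact: csub_compl (@csub_single0 _ _).
move=> _ [S FS [xi hx <-]]; split; first exact: Fs.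
rewrite -(lop_k1 bB mB mG mB' P P' (Fs _ FS)) // compA compBl h // subrr.
exact: comp0l.
Qed.

(* y (S (x) T) = (S (x) T) x extends from a family of morphisms S1 with S1 beta
   total in beta' to all semi-morphisms S, since S1^* S commutes with A. *)
Lemma fiber_intertwine (b : obase Z) (H H' K X X' : hilbertType R) (beta : set 'L(Z, H))
    (beta' : set 'L(Z, H')) (gamma : set 'L(Z, K))
    (k1 : 'L(Z, H) -> 'L(K, X)) (k2 : 'L(Z, K) -> 'L(H, X))
    (k1' : 'L(Z, H') -> 'L(K, X')) (k2' : 'L(Z, K) -> 'L(H', X'))
    (A : set 'L(H, H)) (B : set 'L(K, K)) (pi : 'L(H, H) -> 'L(H', H'))
    (F : set 'L(H, H')) x y S T Y :
  cstar_base b -> cmodule b beta -> cmodule b beta' -> cmodule (dagger b) gamma ->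
  rtp beta gamma k1 k2 -> rtp beta' gamma k1' k2' ->
  (forall S1, F S1 -> morphism beta beta' S1) -> cspan (omul F beta) = beta' ->
  (forall a, A a -> A (adj a)) -> (forall a, A a -> pi (adj a) = adj (pi a)) ->
  (forall S1, F S1 -> intertwines A pi S1) ->
  gfiber beta gamma k1 k2 A B x ->
  (forall S1, F S1 ->
     adj y ** lop gamma k2 k2' S1 = lop gamma k2 k2' S1 ** adj x) ->
  semi_morphism beta beta' S -> intertwines A pi S ->
  semi_morphism gamma gamma T -> intertwines B id T ->
  (forall xi eta, beta xi -> gamma eta ->
     Y ** (k1 xi ** eta) = k1' (S ** xi) ** (T ** eta)) ->
  y ** Y = Y ** x.
Proof.
move=> bB mB mB' mG P P' Fm Ft sA spi Fi /gfiberP[xf _ xg _] hy hS iS hT iT hY.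
have P'' := rtp_swap bB mB mG P.
(* The adjoints are compared on the ranges of Y1 = S1 (x) id, where y^* Y1 = Y1 x^* is known; it
   remains that x commutes with Y1^* Y. *)
rewrite -[LHS]adjK -[RHS]adjK; congr adj.
apply: (joint_ext bB mB mB' mG P P' (fun S1 h => (Fm S1 h).1) Ft) => S1 FS1.
have [m1 m2] := Fm _ FS1.
rewrite !adj_comp -!compA hy //.
set Y1 := lop gamma k2 k2' S1.
have [p pE] : exists p, p = adj S1 ** S by exists (adj S1 ** S).
have hp : semi_morphism beta beta p by move=> xi h; rewrite pE -compA; apply: m2; exact: hS.
pose G1 := lop gamma k2 k2 p; pose G2 := lop beta k1 k1 T.
(* Y1^* Y = (p (x) 1) (1 (x) T). The first factor commutes with x because x |gamma>_2 lies in
   [|gamma>_2 A] and p commutes with A; the second because x |beta>_1 lies in [|beta>_1 B] and T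
   commutes with B. *)
have GE : adj Y1 ** Y = G1 ** G2.
  apply: (rtp_ext P) => xi eta h g; rewrite -!compA hY // (compA G2).
  rewrite (lopE (dagger_base bB) mG mB mG P'' P'' hT h) -compA.
  rewrite (compA (adj Y1)) (lop_adj bB mB mG mB' P P') //.
  rewrite (lop_k1 bB mB' mG mB P' P m2); last exact: hS.
  by rewrite (compA G1) (lop_k1 bB mB mG mB P P hp) // pE -!compA.
have pc a : A a -> p ** a = a ** p.
  move=> ha; rewrite pE -compA iS // !compA; congr (_ ** _).
  have := congr1 (@adj _ _ _) (Fi _ FS1 _ (sA _ ha)).
  by rewrite !adj_comp spi // !adjK.
have G1x : G1 ** x = x ** G1.
  apply: (rtp_ext2 P) => eta g; rewrite -!compA (lopE bB mB mG mB P P hp g).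
  rewrite [RHS]compA; apply/eqP; rewrite -subr_eq0; apply/eqP.
  suff : [set w | [set 0] (G1 ** w - w ** p)] (x ** k2 eta) by [].
  move: (x ** k2 eta) (xg _ g); apply: slice_ind.
    apply: (csub_preim (g := id) (M := `|G1| + `|p|) (f := fun w => G1 ** w - w ** p)).
    - exact: csub_single0.
    - move=> a u v; rewrite compDr compDl compZr compZl opprD addrACA scalerBr.
      by [].
    - move=> u; apply: le_trans (ler_normB _ _) _; rewrite mulrDl.
      by apply: lerD; [exact: comp_norm|rewrite mulrC; exact: comp_norm].
  move=> eta' a g' ha /=; rewrite compA (lopE bB mB mG mB P P hp g').
  by rewrite -!compA pc // subrr.
have G2x : G2 ** x = x ** G2.
  have lE xi (h : beta xi) := lopE (dagger_base bB) mG mB mG P'' P'' hT h.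
  apply: (rtp_ext1 P) => xi h; rewrite -!compA (lE _ h).
  rewrite [RHS]compA; apply/eqP; rewrite -subr_eq0; apply/eqP.
  suff : [set w | [set 0] (G2 ** w - w ** T)] (x ** k1 xi) by [].
  move: (x ** k1 xi) (xf _ h); apply: slice_ind.
    apply: (csub_preim (g := id) (M := `|G2| + `|T|) (f := fun w => G2 ** w - w ** T)).
    - exact: csub_single0.
    - move=> a u v; rewrite compDr compDl compZr compZl opprD addrACA scalerBr.
      by [].
    - move=> u; apply: le_trans (ler_normB _ _) _; rewrite mulrDl.
      by apply: lerD; [exact: comp_norm|rewrite mulrC; exact: comp_norm].
  move=> xi' a h' ha /=; rewrite compA (lE _ h').
  by rewrite -!compA iT // subrr.
rewrite -[LHS]adjK -[RHS]adjK; congr adj.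
rewrite !adj_comp !adjK -[LHS]compA GE -[RHS]compA G2x.
by rewrite !compA G1x.
Qed.

End Fiber.

(** * The Hopf bimodule of a leg *)

Section LegBimodule.
Variables (R : realType) (Z H : hilbertType R) (b : obase Z).
Variables (hb al be : set 'L(Z, H)) (D : pdata b hb al be).
Hypothesis sr : semireg D.
Local Notation V := (dV D).
Local Notation a1 := (@a1 _ _ _ _ _ _ _ D).
Local Notation a2 := (@a2 _ _ _ _ _ _ _ D).
Local Notation c1 := (@c1 _ _ _ _ _ _ _ D).
Local Notation c2 := (@c2 _ _ _ _ _ _ _ D).
Local Notation P1 := (P1 D).
Local Notation P2 := (P2 D).
Local Notation P3 := (P3 D).
Local Notation P4 := (P4 D).
Local Notation P5 := (P5 D).
Local Notation W12 := (W12 D).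
Local Notation W23 := (W23 D).
Local Notation U23 := (U23 D).
Local Notation W13 := (W13 D).
Local Notation U12 := (U12 D).
Local Notation A := (pA D).

Let bB := dB D.
Let bB' := dagger_base bB.
Let ma := pd_ma D. Let mh := pd_mh D. Let mb := pd_mb D.
Let g_ha := pd_ha D. Let g_ab := pd_ab D.
Let g_ba := pd_ba D. Let g_hb := pd_hb D.
Let p1 := dp1 D.
Let p2 := dp2 D.
Let p1' := pd_p1' D. Let p2' := pd_p2' D.
Let Vu := dVu D.

Local Notation Delta := (pDelta D).

Let A_semi a : A a -> semi_morphism hb hb a.
Proof. by move=> ha f; exact: (pA_hb ha). Qed.

Let mX2 : cmodule b (tri c1 al al) := tri_cmodule bB bB ma mb ma p2 g_ba.
Let mX2' : cmodule (dagger b) (tri c2 be be) := tri_cmodule bB' bB' mb ma mb p2' g_ab.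

Lemma pA_cstar : cstar_alg A.
Proof.
split; first exact: pA_closed.
  by move=> _ [x hx [y hy <-]]; exact: pA_mul.
by move=> _ [x hx <-]; exact: pA_star.
Qed.

Let rA_be : omul (rho_alg (dagger b) be) A `<=` A.
Proof. by move=> _ [_ [x hx <-] [a ha <-]]; exact: pA_rho_be. Qed.

Let rA_al : omul (rho_alg b al) A `<=` A.
Proof. by move=> _ [_ [x hx <-] [a ha <-]]; exact: pA_rho_al. Qed.

Lemma pDelta_fiber a : A a -> gfiber al be c1 c2 A A (Delta a).
Proof.
move=> ha; apply/gfiberP; rewrite (pDelta_adj ha).
have ha' := pA_star sr ha.
by split=> xi h; (exact: pDelta_c1 || exact: pDelta_c2).
Qed.

Definition kets : set 'L(H, x2 D) := [set T | exists2 f, al f & T = V ** a2 f].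

Lemma kets_intertwines T : kets T -> intertwines A Delta T.
Proof.
move=> [f h ->] a ha; rewrite /pDelta -!compA; congr (_ ** _).
rewrite (compA (adj V) V); case: Vu => -> _; rewrite comp1l.
by rewrite legE_a2.
Qed.

Lemma kets_be T : kets T -> morphism be (tri c2 be be) T.
Proof.
move=> [f h ->]; split=> [eta g|w hw].
  by rewrite -compA; apply: (Vmem (dV4 D)); exact: tri_sub.
rewrite adj_comp -compA; apply: (k1_adj_tri bB ma mh mb p1' g_hb h).
exact: (Vmem' (dV4 D)).
Qed.

Lemma kets_al T : kets T -> morphism al (tri c1 al al) T.
Proof.
move=> [f h ->]; split=> [eta g|w hw].
  by rewrite -compA; apply: (Vmem (dV1 D)); exact: tri_sub.
rewrite adj_comp -compA; apply: (k1_adj_tri bB ma mh ma p1' g_ha h).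
exact: (Vmem' (dV1 D)).
Qed.

Let kets_total_gen (S : set 'L(Z, H)) (W : set 'L(Z, x2 D)) :
  omul [set V] (tri a2 al S) = W -> closed_subspace W ->
  cspan (omul kets S) = W.
Proof.
move=> e cW; apply/seteqP; split.
  apply: cspan_min => // _ [_ [f h ->] [xi g <-]].
  by rewrite -e -compA; exists V => //; exists (a2 f ** xi) => //; exact: tri_sub.
rewrite -e => _ [_ -> [w hw <-]]; move: w hw; tri_ind.
  exact: csub_compl (cspan_closed _).
move=> f xi h g; rewrite compA; apply: cspan_sub; exists (V ** a2 f); last by exists xi.
by exists f.
Qed.

Lemma kets_total_be : cspan (omul kets be) = tri c2 be be.
Proof. by apply: kets_total_gen (dV4 D) (cspan_closed _). Qed.

Lemma kets_total_al : cspan (omul kets al) = tri c1 al al.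
Proof. by apply: kets_total_gen (dV1 D) (cspan_closed _). Qed.

Lemma pd_jointly_normal : jointly_normal (dagger b) b A be al
  (gfiber al be c1 c2 A A) (tri c2 be be) (tri c1 al al) Delta.
Proof.
have h1 : cbimodule (dagger b) b be al.
  by case: (dM D) => _ _ []; split.
have h2 : cbimodule (dagger b) b (tri c2 be be) (tri c1 al al).
  split=> //; first exact: (rho_tri_span al bB bB' ma mb mb p2 g_ab g_ba).
  exact: (rho_tri_span be bB' bB mb ma ma p2' g_ba g_ab).
have key (S : set 'L(Z, H)) W : cspan (omul kets S) = W ->
    (forall T, intertwiners A be al (tri c2 be be) (tri c1 al al) Delta T ->
       semi_morphism S W T) -> closed_subspace W ->
    cspan (omul (intertwiners A be al (tri c2 be be) (tri c1 al al) Delta) S) = W.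
  move=> kW sW cW; apply/seteqP; split.
    by apply: cspan_min => // _ [T hT [xi h <-]]; exact: sW.
  rewrite -{1}kW; apply: cspan_mono => _ [T hT [xi h <-]].
  exists T; last by exists xi.
  by split; [exact: kets_be|exact: kets_al|exact: kets_intertwines].
split.
- by split=> //; exact: pA_cstar.
- split=> //; first exact: (gfiber_alg _ _ _ _ pA_cstar pA_cstar).
    exact: (gfiber_rho bB bB' ma mb mb p2 g_ab g_ba pA_cstar rA_be).
  rewrite gfiber_swap.
  exact: (gfiber_rho bB' bB mb ma ma p2' g_ba g_ab pA_cstar rA_al).
- split.
  + by move=> _ [a ha <-]; exact: pDelta_fiber.
  + by move=> x a a' ha ha'; exact: pDelta_lin.
  + by move=> a a' ha ha'; exact: pDelta_mul.
  + by move=> a ha; rewrite pDelta_adj.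
- by apply: key kets_total_be _ (cspan_closed _) => T [[]].
- by apply: key kets_total_al _ (cspan_closed _) => T [_ []].
Qed.

Section Lift.
Variables (N Y : hilbertType R) (nu : set 'L(Z, H)) (omi : set 'L(Z, N)).
Variables (m1 : 'L(Z, H) -> 'L(N, Y)) (m2 : 'L(Z, N) -> 'L(H, Y)).
Variable t : triple hb al nu omi a1 a2 m1 m2.

(* a (x) 1 (x) 1 *)
Definition lift1 (a : 'L(H, H)) : 'L(tsp t, tsp t) :=
  lop (tri m2 omi al) (tr23 t) (tr23 t) a.

Let mL := tmL t.

Lemma lift1_r1 a eta : A a -> hb eta -> lift1 a ** tr1 t eta = tr1 t (a ** eta).
Proof.
move=> ha h.
exact: (lop_k1 (tbB t) mL (t_mY t) mL (tr t) (tr t) (A_semi ha)).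
Qed.

Lemma lift1_l3 a f : A a -> omi f -> lift1 a ** tl3 t f = tl3 t f ** legE D a.
Proof.
move=> ha hf; apply: (rtp_ext1 p1) => eta h.
rewrite -!compA (tcomp t) // compA lift1_r1 // legE_a1 //.
by rewrite (tcomp t) //; exact: (pA_hb ha).
Qed.

Lemma lift1_adj a : A a -> adj (lift1 a) = lift1 (adj a).
Proof.
move=> ha; apply: (lop_adj (tbB t) mL (t_mY t) mL (tr t) (tr t)).
by split=> f; [exact: (pA_hb ha)|exact: (pA_adj_hb ha)].
Qed.

End Lift.

Definition cop (a : 'L(H, H)) : 'L(tsp P3, tsp P3) :=
  U12 ** W13 ** lift1 P4 a ** adj (U12 ** W13).

Lemma cop_adj a : A a -> adj (cop a) = cop (adj a).
Proof. by move=> ha; rewrite /cop !(adj_comp _ (adj _)) !adj_comp !adjK lift1_adj // !compA. Qed.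

Lemma copE a : A a -> cop a = W23 ** W12 ** lift1 P1 a ** adj (W23 ** W12).
Proof.
move=> ha.
(* V_23 leaves alone the first factor, on which a acts. *)
have e : U23 ** lift1 P1 a = lift1 P4 a ** U23.
  apply: (rtp_ext1 (tr P1)) => eta h.
  rewrite -!compA lift1_r1 // (U23E D (pA_hb ha h)) (U23E D h).
  by rewrite compA lift1_r1.
rewrite (dpent D) !adj_comp !compA (comp_r e) !compA.
by rewrite -(compA _ U23); case: (U23u D) => _ ->; rewrite comp1r /cop adj_comp !compA.
Qed.

(** Amplifying V |f>_2 by an identity on the right puts f into the middle position and gives V_12
    |f>_2; amplifying it on the left gives V_23 |f>_3 in [lop_right]. *)
Let lop_left f : al f -> lop be c2 (tl3 P3) (V ** a2 f) = U12 ** tr1 P5 f.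
Proof.
move=> h; apply: esym.
have hk : kets (V ** a2 f) by exists f.
apply: (lop_uniq bB ma mb mX2 p2 (tl P3) (kets_al hk).1) => eta g.
by rewrite -compA -(tcomp P5) // !compA (U12E D).
Qed.

Let lop_right f : al f -> lop al c1 (tr1 P3) (V ** a2 f) = W23 ** tl3 P2 f.
Proof.
move=> h; apply: esym.
have hk : kets (V ** a2 f) by exists f.
apply: (lop_uniq bB' mb ma mX2' p2' (tl (triple_swap P3)) (kets_be hk).1) => xi g.
by rewrite -compA (tcomp P2) // !compA (W23E D).
Qed.

Let cop_left a f : A a -> al f ->
  cop a ** (U12 ** tr1 P5 f) = U12 ** tr1 P5 f ** Delta a.
Proof.
move=> ha h; rewrite /cop adj_comp !compA.
rewrite -(compA _ (adj U12) U12); case: (U12u D) => -> _; rewrite comp1r.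
rewrite (comp_r (unitary_sw (W13u D) Vu (W13E D h))) !compA.
rewrite (comp_r (lift1_l3 P4 ha h)) !compA (comp_r (W13E D h)) !compA.
by rewrite /pDelta ?compA.
Qed.

Let cop_right a f : A a -> al f ->
  cop a ** (W23 ** tl3 P2 f) = W23 ** tl3 P2 f ** Delta a.
Proof.
move=> ha h; rewrite copE // adj_comp !compA.
rewrite -(compA _ (adj W23) W23); case: (W23u D) => -> _; rewrite comp1r.
rewrite (comp_r (unitary_sw (W12u D) Vu (W12E D h))) !compA.
rewrite (comp_r (lift1_l3 P1 ha h)) !compA (comp_r (W12E D h)) !compA.
by rewrite /pDelta ?compA.
Qed.

Definition LDelta := semi_intertwiners A be al (tri c2 be be) (tri c1 al al) Delta.
Definition Lid := semi_intertwiners A be al be al id.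

(** The defining property of (Delta * id)(x) in ket form: Y is any operator acting as S (x) T on
    kets, in place of [otens], which refers to the concrete products. *)
Definition left_ext (x : 'L(x2 D, x2 D)) (y : 'L(tsp P3, tsp P3)) := forall S T Y,
  LDelta S -> Lid T -> (forall xi eta, al xi -> be eta ->
    Y ** (c1 xi ** eta) = tl12 P3 (S ** xi) ** (T ** eta)) -> y ** Y = Y ** x.

Definition right_ext (x : 'L(x2 D, x2 D)) (y : 'L(tsp P3, tsp P3)) := forall S T Y,
  Lid S -> LDelta T -> (forall xi eta, al xi -> be eta ->
    Y ** (c1 xi ** eta) = tr1 P3 (S ** xi) ** (T ** eta)) -> y ** Y = Y ** x.

Let id_in : Lid (bid H).
Proof.
split; [by move=> xi; rewrite comp1l|by move=> xi; rewrite comp1l|].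
by move=> a ha; rewrite comp1l comp1r.
Qed.

Let kets_in T : kets T -> LDelta T.
Proof.
by move=> hT; split; [exact: (kets_be hT).1|exact: (kets_al hT).1|exact: kets_intertwines].
Qed.

Lemma cop_left_ext a : A a -> left_ext (Delta a) (cop a).
Proof.
move=> ha S T Y [_ hS iS] [hT _ iT] hY.
apply: (fiber_intertwine bB ma mX2 mb p2 (tl P3) kets_al kets_total_al
  (pA_star sr) _ kets_intertwines (pDelta_fiber ha) _ hS iS hT iT hY).
  by move=> a' ha'; rewrite pDelta_adj.
move=> _ [f h ->]; rewrite lop_left // cop_adj // cop_left // ?pDelta_adj //.
exact: pA_star.
Qed.

Lemma cop_right_ext a : A a -> right_ext (Delta a) (cop a).
Proof.
move=> ha S T Y [_ hS iS] [hT _ iT] hY.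
have hf := pDelta_fiber ha; rewrite gfiber_swap in hf.
apply: (fiber_intertwine bB' mb mX2' ma p2' (tl (triple_swap P3)) kets_be kets_total_be
  (pA_star sr) _ kets_intertwines hf _ hT iT hS iS).
- by move=> a' ha'; rewrite pDelta_adj.
- move=> _ [f h ->]; rewrite lop_right // cop_adj // cop_right // ?pDelta_adj //.
  exact: pA_star.
- move=> eta xi g h; rewrite -(rtpE p2) // hY //.
  have [h1 h2] : al (S ** xi) /\ tri c2 be be (T ** eta) by split; [exact: hS|exact: hT].
  exact: (rtpE (tr P3)).
Qed.

(** The identity and the V |f>_2 are among the semi-intertwiners and already determine y by
    [joint_ext], so the choice in [fiber_map] will have a single candidate. *)
Lemma left_ext_uniq a y : A a -> left_ext (Delta a) y -> y = cop a.
Proof.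
move=> ha hy.
apply: (joint_ext bB ma mX2 mb p2 (tl P3) (fun S h => (kets_al h).1) kets_total_al).
move=> S hS.
have e xi eta : al xi -> be eta -> lop be c2 (tl3 P3) S ** (c1 xi ** eta) =
    tl12 P3 (S ** xi) ** (bid H ** eta).
  move=> h g; rewrite comp1l compA.
  by rewrite (lop_k1 bB ma mb mX2 p2 (tl P3) (kets_al hS).1).
rewrite (hy _ _ _ (kets_in hS) id_in e).
by rewrite (cop_left_ext ha (kets_in hS) id_in e).
Qed.

Lemma right_ext_uniq a y : A a -> right_ext (Delta a) y -> y = cop a.
Proof.
move=> ha hy.
apply: (joint_ext bB' mb mX2' ma p2' (tl (triple_swap P3)) (fun S h => (kets_be h).1)
  kets_total_be).
move=> S hS.
have e xi eta : al xi -> be eta -> lop al c1 (tr1 P3) S ** (c1 xi ** eta) =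
    tr1 P3 (bid H ** xi) ** (S ** eta).
  move=> h g; rewrite comp1l (rtpE p2) // compA.
  have -> : lop al c1 (tr1 P3) S ** c2 eta = tr23 P3 (S ** eta).
    exact: (lop_k1 bB' mb ma mX2' p2' (tl (triple_swap P3)) (kets_be hS).1).
  rewrite (rtpE (tr P3)) //; exact: (kets_be hS).1.
rewrite (hy _ _ _ id_in (kets_in hS) e).
by rewrite (cop_right_ext ha id_in (kets_in hS) e).
Qed.

End LegBimodule.

(** * Pseudo-multiplicative unitaries *)

Section LopUnitary.
Variables (R : realType) (Z : hilbertType R).
Variables (b : obase Z) (H K X H' X' : hilbertType R).
Variables (beta : set 'L(Z, H)) (gamma : set 'L(Z, K)).
Variables (k1 : 'L(Z, H) -> 'L(K, X)) (k2 : 'L(Z, K) -> 'L(H, X)).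
Variables (beta' : set 'L(Z, H')).
Variables (k1' : 'L(Z, H') -> 'L(K, X')) (k2' : 'L(Z, K) -> 'L(H', X')).
Hypothesis bB : cstar_base b.
Hypothesis mB : cmodule b beta.
Hypothesis mG : cmodule (dagger b) gamma.
Hypothesis mB' : cmodule b beta'.
Hypothesis P : rtp beta gamma k1 k2.
Hypothesis P' : rtp beta' gamma k1' k2'.

Lemma lop_unitary S : unitary S -> omul [set S] beta = beta' ->
  unitary (lop gamma k2 k2' S) /\
  forall eta, gamma eta -> lop gamma k2 k2' S ** k2 eta = k2' eta ** S.
Proof.
move=> [u1 u2] e.
have hS : semi_morphism beta beta' S.
  by move=> xi h; rewrite -e; exists S => //; exists xi.
have hS' : semi_morphism beta' beta (adj S).
  by rewrite -e => _ [_ -> [xi h <-]]; rewrite compA u1 comp1l.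
split; last by move=> eta g; exact: (lopE bB mB mG mB' P P' hS g).
have la := lop_adj bB mB mG mB' P P' (conj hS hS').
split; rewrite la.
  apply: (rtp_ext2 P) => eta g.
  rewrite -compA (lopE bB mB mG mB' P P' hS g) compA (lopE bB mB' mG mB P' P hS' g).
  by rewrite -compA u1 comp1l comp1r.
apply: (rtp_ext2 P') => eta g.
rewrite -compA (lopE bB mB' mG mB P' P hS' g) compA (lopE bB mB mG mB' P P' hS g).
by rewrite -compA u2 comp1l comp1r.
Qed.

End LopUnitary.

Section ConcreteMaps.
Variables (R : realType) (Z : hilbertType R).

Lemma xget_unique (T : choiceType) (x0 : T) (P : set T) t :
  P t -> (forall u, P u -> u = t) -> xget x0 P = t.
Proof. by move=> Pt h; case: xgetP => [u _ /h //|/(_ t)]. Qed.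

Section Concrete.
Variables (b c : obase Z) (H K L : hilbertType R).
Variables (beta : set 'L(Z, H)) (gamma delta : set 'L(Z, K)) (epsi : set 'L(Z, L)).
Hypothesis bB : cstar_base b.
Hypothesis cB : cstar_base c.
Hypothesis mB : cmodule b beta.
Hypothesis mG : cmodule (dagger b) gamma.

Let bB' := dagger_base bB.
Let P := rt_rtp bB mB mG.
Let Q := rt_rtp bB' mG mB.
Let Q' := rtp_swap bB' mG mB Q.

Lemma flipP : unitary (flip beta gamma) /\
  forall xi, beta xi -> flip beta gamma ** ket1 beta gamma xi = ket2 gamma beta xi.
Proof.
have pt (X : hilbertType R) k1 k2 : @rtp R Z H K X beta gamma k1 k2 ->
    cspan (oapp ((fun p : 'L(Z, H) * 'L(Z, K) => k1 p.1 ** p.2) @`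
      [set p | beta p.1 /\ gamma p.2]) setT) = setT.
  move=> W; rewrite -(rtp_total W); congr cspan; apply/seteqP; split.
    move=> _ [_ [[xi eta] [/= h g] <-] [z _ <-]].
    by exists (xi, z, eta).
  move=> _ [[[xi z] eta] [/= h g] <-].
  by exists (k1 xi ** eta); [exists (xi, eta)|exists z].
have [|T [uT hT]] := unitary_gram (pt _ _ _ P) (pt _ _ _ Q').
  move=> [xi eta] [xi' eta'] [/= h g] [/= h' g'].
  by rewrite (rtp_gram P) // (rtp_gram Q').
have T1 xi : beta xi -> T ** ket1 beta gamma xi = ket2 gamma beta xi.
  move=> h; apply: (cm_ext mG) => eta g; rewrite -compA; exact: (hT (xi, eta)).
suff -> : flip beta gamma = T by [].
apply: xget_unique => [xi z eta h g|U hU].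
  rewrite -(ket1E bB mB mG) // -(ket2E bB' mG mB) //.
  by rewrite -[LHS]/((T ** ket1 beta gamma xi) _) T1.
apply: (rtp_ext P) => xi eta h g; apply: bop_ext => z /=.
rewrite (ket1E bB mB mG) // hU // -(ket2E bB' mG mB) //.
by rewrite -(ket1E bB mB mG) // -[RHS]/((T ** ket1 beta gamma xi) _) T1.
Qed.

Hypothesis mD : cmodule c delta.
Hypothesis mE : cmodule (dagger c) epsi.
Hypothesis gd : cspan (omul (rho_alg (dagger b) gamma) delta) = delta.
Hypothesis dg : cspan (omul (rho_alg c delta) gamma) = gamma.

Let S := rt_rtp cB mD mE.
Let mX : cmodule c (rtri beta gamma delta) := tri_cmodule bB cB mB mG mD P gd.
Let mY : cmodule (dagger b) (ltri delta epsi gamma) :=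
  tri_cmodule (dagger_base cB) bB' mE mD mG (rtp_swap cB mD mE S) dg.
Let PA := rt_rtp cB mX mE.
Let PB := rt_rtp bB mB mY.

Lemma assocP : unitary (assoc beta gamma delta epsi) /\
  forall xi omega, beta xi -> epsi omega ->
    assoc beta gamma delta epsi ** ket2 (rtri beta gamma delta) epsi omega **
      ket1 beta gamma xi =
    ket1 beta (ltri delta epsi gamma) xi ** ket2 delta epsi omega.
Proof.
have [T [uT hT]] := assoc_unitary bB cB mB mG mD mE gd dg P S PA PB.
suff -> : assoc beta gamma delta epsi = T by [].
apply: xget_unique => // U hU.
apply: (rtp_ext2 PA) => omega hw; apply: (rtp_ext1 P) => xi h.
by rewrite hU // hT.
Qed.

Lemma rt_triple_comp xi omega : beta xi -> epsi omega ->
  ket2 (rtri beta gamma delta) epsi omega ** ket1 beta gamma xi =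
  adj (assoc beta gamma delta epsi) ** ket1 beta (ltri delta epsi gamma) xi **
    ket2 delta epsi omega.
Proof.
have [ua ea] := assocP => h hw; rewrite -compA -ea //.
by rewrite !compA; case: ua => -> _; rewrite comp1l.
Qed.

(** It lives on the left-bracketed product; the adjoint of the associator carries over the kets of
    the right-bracketed one. *)
Definition rt_triple : triple beta gamma delta epsi (ket1 beta gamma) (ket2 beta gamma)
  (ket1 delta epsi) (ket2 delta epsi) :=
  @Triple _ _ _ _ _ _ _ beta gamma delta epsi (ket1 beta gamma) (ket2 beta gamma)
    (ket1 delta epsi) (ket2 delta epsi) b c bB cB mB mG mD mE gd dg P S
    (rt (rtri beta gamma delta) epsi) _ _ _ _ PA
    (rtp_transport (unitary_adj (proj1 assocP)) PB) rt_triple_comp.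

End Concrete.

Section Flip23.
Variables (b c : obase Z) (H K L : hilbertType R).
Variables (beta delta : set 'L(Z, H)) (gamma : set 'L(Z, K)) (epsi : set 'L(Z, L)).
Hypothesis bB : cstar_base b.
Hypothesis cB : cstar_base c.
Hypothesis mB : cmodule b beta.
Hypothesis mG : cmodule (dagger b) gamma.
Hypothesis mD : cmodule c delta.
Hypothesis mE : cmodule (dagger c) epsi.
Hypothesis bd : cspan (omul (rho_alg b beta) delta) = delta.
Hypothesis db : cspan (omul (rho_alg c delta) beta) = beta.

Let bB' := dagger_base bB.
Let cB' := dagger_base cB.
Let P := rt_rtp bB mB mG.
Let Q := rt_rtp cB mD mE.
Let P' := rtp_swap bB mB mG P.
Let Q' := rtp_swap cB mD mE Q.
Let mX : cmodule c (ltri beta gamma delta) := tri_cmodule bB' cB mG mB mD P' bd.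
Let mY : cmodule b (ltri delta epsi beta) := tri_cmodule cB' bB mE mD mB Q' db.
Let PA := rt_rtp cB mX mE.
Let PB := rt_rtp bB mY mG.

(** Reading the first product backwards puts H, the factor common to both products, in the middle;
    the exchange of K and L is then an associator. *)
Lemma flip23P : unitary (flip23 beta delta gamma epsi) /\
  forall eta omega, gamma eta -> epsi omega ->
    flip23 beta delta gamma epsi ** ket2 (ltri beta gamma delta) epsi omega **
      ket2 beta gamma eta =
    ket2 (ltri delta epsi beta) gamma eta ** ket2 delta epsi omega.
Proof.
have [T [uT hT]] := assoc_unitary bB' cB mG mB mD mE bd db P' Q PA
  (rtp_swap bB mY mG PB).
suff -> : flip23 beta delta gamma epsi = T by [].
apply: xget_unique => // U hU.
apply: (rtp_ext2 PA) => omega hw; apply: (rtp_ext1 P') => eta g.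
by rewrite hU // hT.
Qed.

End Flip23.

End ConcreteMaps.

Section PseudoMultiplicativeUnitary.
Variables (R : realType) (Z H : hilbertType R) (b : obase Z).
Variables (hb al be : set 'L(Z, H)) (V : 'L(rt hb al, rt al be)).
Hypothesis hV : cpmu b V.

Let bB : cstar_base b. Proof. by case: hV. Qed.
Let bB' := dagger_base bB.
Let tM : ctrimodule (dagger b) b (dagger b) hb al be. Proof. by case: hV. Qed.
Let uV : unitary V. Proof. by case: hV. Qed.
Let V1 : omul [set V] (ltri hb al al) = rtri al be al. Proof. by case: hV => _ _ _ []. Qed.
Let V2 : omul [set V] (rtri hb al be) = ltri al be hb. Proof. by case: hV => _ _ _ []. Qed.
Let V3 : omul [set V] (rtri hb al hb) = rtri al be hb. Proof. by case: hV => _ _ _ []. Qed.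
Let V4 : omul [set V] (ltri hb al be) = ltri al be be. Proof. by case: hV => _ _ _ []. Qed.
Let pV : pentagon V. Proof. by case: hV. Qed.

Let ma : cmodule b al. Proof. by case: tM => [[]]. Qed.
Let mh : cmodule (dagger b) hb. Proof. by case: tM => [[]]. Qed.
Let mb : cmodule (dagger b) be. Proof. by case: tM => _ []. Qed.
Let g_ha : cspan (omul (rho_alg (dagger b) hb) al) = al. Proof. by case: tM => [[]]. Qed.
Let g_ah : cspan (omul (rho_alg b al) hb) = hb. Proof. by case: tM => [[]]. Qed.
Let g_ab : cspan (omul (rho_alg b al) be) = be. Proof. by case: tM => _ _ []. Qed.
Let g_ba : cspan (omul (rho_alg (dagger b) be) al) = al. Proof. by case: tM => _ _ []. Qed.
Let g_hb : cspan (omul (rho_alg (dagger b) hb) be) = be. Proof. by case: tM => _ []. Qed.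
Let g_bh : cspan (omul (rho_alg (dagger b) be) hb) = hb. Proof. by case: tM => _ []. Qed.

Let p1 : rtp hb al (ket1 hb al) (ket2 hb al) := rt_rtp bB' mh ma.
Let p2 : rtp al be (ket1 al be) (ket2 al be) := rt_rtp bB ma mb.
Let p1' := rtp_swap bB' mh ma p1.
Let p2' := rtp_swap bB ma mb p2.
Let q : rtp be al (ket1 be al) (ket2 be al) := rt_rtp bB' mb ma.
Let q' := rtp_swap bB' mb ma q.

Definition cP1 : triple hb al hb al (ket1 hb al) (ket2 hb al) (ket1 hb al) (ket2 hb al) :=
  rt_triple bB' bB' mh ma mh ma g_ah g_ha.
Definition cP2 : triple al be hb al (ket1 al be) (ket2 al be) (ket1 hb al) (ket2 hb al) :=
  rt_triple bB bB' ma mb mh ma g_bh g_hb.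
Definition cP3 : triple al be al be (ket1 al be) (ket2 al be) (ket1 al be) (ket2 al be) :=
  rt_triple bB bB ma mb ma mb g_ba g_ab.

Let assoc4P := assocP bB' bB' mh ma mb ma g_ab g_ba.
Let mX1h : cmodule (dagger b) (rtri hb al hb) := tri_cmodule bB' bB' mh ma mh p1 g_ah.
Let mX1b : cmodule (dagger b) (rtri hb al be) := tri_cmodule bB' bB' mh ma mb p1 g_ab.
Let mX1a : cmodule b (ltri hb al al) := tri_cmodule bB bB ma mh ma p1' g_ha.
Let mX1c : cmodule (dagger b) (ltri hb al be) := tri_cmodule bB bB' ma mh mb p1' g_hb.
Let mX2h : cmodule (dagger b) (rtri al be hb) := tri_cmodule bB bB' ma mb mh p2 g_bh.
Let mX2a : cmodule b (rtri al be al) := tri_cmodule bB bB ma mb ma p2 g_ba.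
Let mX2b : cmodule (dagger b) (ltri al be be) := tri_cmodule bB' bB' mb ma mb p2' g_ab.
Let mX2c : cmodule (dagger b) (ltri al be hb) := tri_cmodule bB' bB' mb ma mh p2' g_ah.
Let mX3 : cmodule b (ltri be al al) := tri_cmodule bB bB ma mb ma q' g_ba.

Let flipm : omul [set flip al be] (rtri al be al) = ltri be al al.
Proof.
have [uf ef] := flipP bB ma mb.
have sub : rtri al be al `<=` [set w | ltri be al al (flip al be ** w)].
  move=> w; rewrite -/(tri _ _ _ w); move: w; tri_ind.
    exact: csub_compl (cspan_closed _).
  by move=> xi d h hd /=; rewrite compA ef //; exact: tri_sub.
have sub' : ltri be al al `<=` [set w | rtri al be al (adj (flip al be) ** w)].
  move=> w; rewrite -/(tri _ _ _ w); move: w; tri_ind.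
    exact: csub_compl (cspan_closed _).
  move=> xi d h hd /=; rewrite compA -ef // !compA; case: uf => -> _.
  by rewrite comp1l; exact: tri_sub.
apply/seteqP; split; first by move=> _ [_ -> [w /sub hw <-]].
move=> w /sub' hw; exists (flip al be) => //; exists (adj (flip al be) ** w) => //.
by rewrite compA; case: uf => _ ->; rewrite comp1l.
Qed.

Let r4 : rtp hb (rtri al be al) (ket1 _ _) (ket2 _ _) := rt_rtp bB' mh mX2a.
Let r4' : rtp hb (ltri be al al) (ket1 _ _) (ket2 _ _) := rt_rtp bB' mh mX3.

Let F4 := opr hb (rtri al be al) (ltri be al al) (flip al be).

Let F4P : unitary F4 /\ forall xi, hb xi -> F4 ** ket1 hb (rtri al be al) xi =
  ket1 hb (ltri be al al) xi ** flip al be.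
Proof.
exact: (lop_unitary bB mX2a mh mX3 (rtp_swap bB' mh mX2a r4) (rtp_swap bB' mh mX3 r4')
  (flipP bB ma mb).1 flipm).
Qed.

(** P4 has the third factor in the middle: the associator leads from (1 3) 2 to 1 (3 2), and undoing
    the flip gives 1 (2 3), the source of [V13]. *)
Let G4 := adj F4 ** assoc hb al be al.

Let uG4 : unitary G4.
Proof. exact: unitary_comp (unitary_adj F4P.1) assoc4P.1. Qed.

Let comp4 xi f : hb xi -> al f ->
  G4 ** ket2 (rtri hb al be) al f ** ket1 hb al xi =
  ket1 hb (rtri al be al) xi ** ket1 al be f.
Proof.
move=> h hf; rewrite /G4 -!compA (compA (assoc _ _ _ _)) assoc4P.2 //.
rewrite -(flipP bB ma mb).2 // (compA (ket1 hb _ xi)) -F4P.2 //.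
by rewrite -!compA (compA (adj F4)); case: F4P => -[-> _] _; rewrite comp1l.
Qed.

Definition cP4 : triple hb al be al (ket1 hb al) (ket2 hb al) (ket2 al be) (ket1 al be) :=
  @Triple _ _ _ _ _ _ _ hb al be al _ _ _ _ (dagger b) (dagger b) bB' bB' mh ma mb ma
    g_ab g_ba p1 p2' (rt hb (rtri al be al)) _ _ _ _
    (rtp_transport uG4 (rt_rtp bB' mX1b ma)) r4 comp4.

Let F5 := flip23 al hb be al.
Let F5P := flip23P bB bB' ma mb mh ma g_ah g_ha.

Let r5 : rtp al (ltri al be hb) (fun xi => F5 ** ket2 _ _ xi) (fun w => F5 ** ket1 _ _ w) :=
  rtp_transport F5P.1 (rtp_swap bB' mX2c ma (rt_rtp bB' mX2c ma)).

Let comp5 xi f : al xi -> be f ->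
  ket2 (ltri hb al al) be f ** ket2 hb al xi = F5 ** ket2 (ltri al be hb) al xi ** ket2 al be f.
Proof. by move=> h hf; rewrite F5P.2. Qed.

Definition cP5 : triple al hb al be (ket2 hb al) (ket1 hb al) (ket1 al be) (ket2 al be) :=
  @Triple _ _ _ _ _ _ _ al hb al be _ _ _ _ b b bB bB ma mh ma mb
    g_ha g_ah p1' p2 (rt (ltri hb al al) be) _ _ _ _
    (rt_rtp bB mX1a mb) r5 comp5.

Let T12 := opl (rtri hb al hb) (rtri al be hb) al V.
Let T12P : unitary T12 /\ forall f, al f -> T12 ** ket2 (rtri hb al hb) al f =
  ket2 (rtri al be hb) al f ** V.
Proof.
exact: (lop_unitary bB' mX1h ma mX2h (rt_rtp bB' mX1h ma) (rt_rtp bB' mX2h ma) uV V3).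
Qed.

Let T23 := opr al (ltri hb al be) (ltri al be be) V.
Let T23P : unitary T23 /\ forall xi, al xi -> T23 ** ket1 al (ltri hb al be) xi =
  ket1 al (ltri al be be) xi ** V.
Proof.
exact: (lop_unitary bB' mX1c ma mX2b (rtp_swap bB ma mX1c (rt_rtp bB ma mX1c))
  (rtp_swap bB ma mX2b (rt_rtp bB ma mX2b)) uV V4).
Qed.

Let S23 := opr hb (ltri hb al al) (rtri al be al) V.
Let S23P : unitary S23 /\ forall xi, hb xi -> S23 ** ket1 hb (ltri hb al al) xi =
  ket1 hb (rtri al be al) xi ** V.
Proof.
exact: (lop_unitary bB mX1a mh mX2a (rtp_swap bB' mh mX1a (rt_rtp bB' mh mX1a))
  (rtp_swap bB' mh mX2a r4) uV V1).
Qed.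

Let S12 := opl (ltri hb al al) (rtri al be al) be V.
Let S12P : unitary S12 /\ forall f, be f -> S12 ** ket2 (ltri hb al al) be f =
  ket2 (rtri al be al) be f ** V.
Proof.
exact: (lop_unitary bB mX1a mb mX2a (rt_rtp bB mX1a mb) (rt_rtp bB mX2a mb) uV V1).
Qed.

Let S13 := opl (rtri hb al be) (ltri al be hb) al V.
Let S13P : unitary S13 /\ forall f, al f -> S13 ** ket2 (rtri hb al be) al f =
  ket2 (ltri al be hb) al f ** V.
Proof.
exact: (lop_unitary bB' mX1b ma mX2c (rt_rtp bB' mX1b ma) (rt_rtp bB' mX2c ma) uV V2).
Qed.

Let A1P := assocP bB' bB' mh ma mh ma g_ah g_ha.
Let A2P := assocP bB bB' ma mb mh ma g_bh g_hb.
Let A3P := assocP bB bB ma mb ma mb g_ba g_ab.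

(** P1, P2, P3 and P5 live on left-bracketed spaces and P4 on a right-bracketed one. So associators
    are inserted only into V_23 on either side of the pentagon equation, and [V13] fits between P4
    and P5 as it stands. *)
Definition cmu_data : pdata b hb al be.
Proof.
refine (@PData _ _ _ b hb al be bB tM (rt hb al) (rt al be) (ket1 hb al) (ket2 hb al)
  (ket1 al be) (ket2 al be) p1 p2 V uV V1 V2 V3 V4 cP1 cP2 cP3 cP4 cP5
  T12 (adj (assoc al be al be) ** T23 ** assoc al be hb al)
  (S23 ** assoc hb al hb al) (V13 V) S12
  T12P.1 _ _ _ S12P.1 T12P.2 _ _ _ S12P.2 _).
- exact: unitary_comp (unitary_comp (unitary_adj A3P.1) T23P.1) A2P.1.
- exact: unitary_comp S23P.1 A1P.1.
- rewrite /V13; apply: unitary_comp F4P.1; apply: unitary_comp (unitary_adj assoc4P.1).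
  exact: unitary_comp F5P.1 S13P.1.
- move=> xi h /=; rewrite -!compA; congr (_ ** _).
  rewrite (compA (assoc _ _ _ _)); case: A2P => -[_ ->] _.
  by rewrite comp1l T23P.2.
- move=> xi h /=; rewrite -!compA (compA (assoc _ _ _ _)); case: A1P => -[_ ->] _.
  by rewrite comp1l S23P.2.
(* [G4] enters the kets of P4 so that its associator and flip cancel against those of [V13]. *)
- move=> f h /=; rewrite /V13 -/F4 -/S13 -/F5 /G4 -!compA; congr (_ ** _).
  rewrite (compA F4); case: F4P => -[_ ->] _; rewrite comp1l.
  rewrite (compA (adj _) (assoc _ _ _ _)); case: assoc4P => -[-> _] _; rewrite comp1l.
  by rewrite S13P.2.
- have := pV; rewrite /pentagon -/T12 -/T23 -/S12 -/S23 => e.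
  rewrite -!compA in e; rewrite -!compA e !compA.
  by case: A3P => -[-> _] _; rewrite comp1l.
Defined.

End PseudoMultiplicativeUnitary.

Lemma jointly_normal_swap (R : realType) (Z : hilbertType R) (b1 b2 : obase Z)
    (H K : hilbertType R) A (alpha1 alpha2 : set 'L(Z, H)) B (gamma1 gamma2 : set 'L(Z, K))
    pi : jointly_normal b1 b2 A alpha1 alpha2 B gamma1 gamma2 pi ->
  jointly_normal b2 b1 A alpha2 alpha1 B gamma2 gamma1 pi.
Proof.
have e : intertwiners A alpha2 alpha1 gamma2 gamma1 pi =
         intertwiners A alpha1 alpha2 gamma1 gamma2 pi.
  by apply/seteqP; split=> T [h1 h2 h3]; split.
move=> [[[m1 m2 r1 r2] cA rA1 rA2] [[n1 n2 s1 s2] cB rB1 rB2] sp t1 t2].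
by split; rewrite ?e //; split=> //; split.
Qed.

Lemma semi_intertwiners_swap (R : realType) (Z H K : hilbertType R) A
    (alpha1 alpha2 : set 'L(Z, H)) (gamma1 gamma2 : set 'L(Z, K)) pi T :
  semi_intertwiners A alpha1 alpha2 gamma1 gamma2 pi T ->
  semi_intertwiners A alpha2 alpha1 gamma2 gamma1 pi T.
Proof. by case. Qed.

(** * Coassociativity for the concrete fiber products *)

Section Coassociativity.
Variables (R : realType) (Z H : hilbertType R) (b : obase Z).
Variables (al be : set 'L(Z, H)).
Hypothesis bB : cstar_base b.
Hypothesis ma : cmodule b al.
Hypothesis mb : cmodule (dagger b) be.
Hypothesis g_ab : cspan (omul (rho_alg b al) be) = be.
Hypothesis g_ba : cspan (omul (rho_alg (dagger b) be) al) = al.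
Variables (A : set 'L(H, H)) (Delta : 'L(H, H) -> 'L(rt al be, rt al be)).

Let bB' := dagger_base bB.
Let p := rt_rtp bB ma mb.
Let p' := rtp_swap bB ma mb p.
Let mX : cmodule b (rtri al be al) := tri_cmodule bB bB ma mb ma p g_ba.
Let mY : cmodule (dagger b) (ltri al be be) := tri_cmodule bB' bB' mb ma mb p' g_ab.

Let LD := semi_intertwiners A be al (ltri al be be) (rtri al be al) Delta.
Let LI := semi_intertwiners A be al be al id.

Let otensE (H' K' : hilbertType R) (al' : set 'L(Z, H')) (be' : set 'L(Z, K')) S T :
  cmodule b al' -> cmodule (dagger b) be' ->
  semi_morphism al al' S -> semi_morphism be be' T ->
  forall xi eta, al xi -> be eta ->
  otens al al' be be' S T ** (ket1 al be xi ** eta) =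
  ket1 al' be' (S ** xi) ** (T ** eta).
Proof.
move=> ma' mb' hS hT.
have p2 := rt_rtp bB ma' mb'.
have [Y [hY _]] := otens_ex bB ma mb ma' mb' p p2 hS hT.
suff -> : otens al al' be be' S T = Y by [].
apply: xget_unique => [xi z eta h g|U hU].
  rewrite -(ket1E bB ma mb) // -(ket1E bB ma' mb'); [|exact: hS|exact: hT].
  by rewrite -[LHS]/((Y ** (ket1 al be xi ** eta)) z) hY.
apply: (rtp_ext p) => xi eta h g; rewrite hY //; apply: bop_ext => z /=.
rewrite (ket1E bB ma mb) // hU // -(ket1E bB ma' mb') //; [exact: hS|exact: hT].
Qed.

Let left_cond (x : 'L(rt al be, rt al be)) y := forall S T Y, LD S -> LI T ->
  (forall xi eta, al xi -> be eta -> Y ** (ket1 al be xi ** eta) =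
     ket1 (rtri al be al) be (S ** xi) ** (T ** eta)) -> y ** Y = Y ** x.

Let right_cond (x : 'L(rt al be, rt al be)) y := forall S T Y, LI S -> LD T ->
  (forall xi eta, al xi -> be eta -> Y ** (ket1 al be xi ** eta) =
     adj (assoc al be al be) ** ket1 al (ltri al be be) (S ** xi) ** (T ** eta)) ->
  y ** Y = Y ** x.

(** If y a is the only solution of both conditions, [fiber_map] returns y a on the left and its
    conjugate by the associator on the right, since [right_cond] is stated on the left-bracketed
    space. *)
Lemma coassociative_of (y : 'L(H, H) -> 'L(rt (rtri al be al) be, rt (rtri al be al) be)) :
  (forall a, A a -> left_cond (Delta a) (y a)) ->
  (forall a z, A a -> left_cond (Delta a) z -> z = y a) ->
  (forall a, A a -> right_cond (Delta a) (y a)) ->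
  (forall a z, A a -> right_cond (Delta a) z -> z = y a) ->
  coassociative A be al Delta.
Proof.
move=> l1 l2 r1 r2; rewrite /coassociative; cbv zeta => a ha.
have [[ua1 ua2] _] := assocP bB bB ma mb ma mb g_ba g_ab.
set as_ := assoc al be al be in ua1 ua2 *.
have -> : fiber_map al (rtri al be al) be be LD LI (Delta a) = y a.
  apply: xget_unique => [S T hS hT|z hz].
    by apply: (l1 _ ha S T) => // xi eta h g; apply: otensE => //; [case: hS|case: hT].
  apply: l2 => // S T Y hS hT hY; have -> : Y = otens al (rtri al be al) be be S T.
    by apply: (rtp_ext p) => xi eta h g; rewrite hY // otensE //; [case: hS|case: hT].
  exact: hz.
have -> : fiber_map al al be (ltri al be be) LI LD (Delta a) = as_ ** y a ** adj as_.
  apply: xget_unique => [S T hS hT|z hz].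
    rewrite -!compA (r1 _ ha S T) // => [|xi eta h g]; last first.
      rewrite -compA otensE ?compA //; [by case: hS|by case: hT].
    by rewrite !compA ua2 comp1l.
  rewrite -(r2 _ (adj as_ ** z ** as_) ha); last first.
    move=> S T Y hS hT hY.
    have e : as_ ** Y = otens al al be (ltri al be be) S T.
      apply: (rtp_ext p) => xi eta h g; rewrite -compA hY // otensE //; [|by case: hS|by case: hT].
      by rewrite !compA ua2 comp1l.
    rewrite -compA e -compA hz // -e !compA ua1 comp1l.
    by [].
  by rewrite !compA ua2 comp1l -compA ua2 comp1r.
by rewrite -!compA ua1 comp1r.
Qed.

End Coassociativity.

Theorem theorem5p7 (R : realType) (K H : hilbertType R) (b : obase K)
    (hbeta alpha beta : set 'L(K, H)) (V : 'L(rt hbeta alpha, rt alpha beta)) :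
  cpmu b V -> semi_regular V ->
  hopf_bimodule (dagger b) (hatA V) alpha hbeta (hatDelta V) /\
  hopf_bimodule b (legA V) beta alpha (legDelta V).
Proof.
(* With b in constructor form, [dagger (dagger b)] is b by conversion. *)
case: b => B B' hV sV.
pose D := cmu_data hV.
have sr : semireg D by [].
have srop := semireg_op sr.
have bB := dB D.
have ma := pd_ma D; have mh := pd_mh D.
(* The slices <eta|_2 V |f>_2 are adjoints of generators of the opposite leg, and that leg is
   self-adjoint. *)
have eA : hatA V = pA (pdata_op D).
  apply/seteqP; split.
    apply: cspan_min; first exact: pA_closed.
    move=> x [_ [_ [eta g <-] <-] [_ [_ -> [_ [f h <-] <-]] <-]].
    rewrite -[_ ** _]adjK; apply: (pA_star srop).
    by rewrite !adj_comp adjK; exact: (pA_gen (D := pdata_op D)).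
  move=> x hx; rewrite -(adjK x); have := pA_star srop hx; move: (adj x).
  apply: pA_ind; first exact: csub_adj (cspan_closed _).
  move=> f eta h g; rewrite !adj_comp !adjK; apply: cspan_sub.
  exists (adj (ket2 alpha beta eta)); first by exists (ket2 alpha beta eta) => //; exists eta.
  exists (V ** ket2 hbeta alpha f) => //; exists V => //.
  by exists (ket2 hbeta alpha f) => //; exists f.
have eD : hatDelta V = pDelta (pdata_op D).
  by apply/funext => y; rewrite /hatDelta /pDelta /= adjK.
split.
  rewrite eA eD; split; first exact: dagger_base.
    apply: jointly_normal_swap.
    have := pd_jointly_normal srop; rewrite gfiber_swap; exact.
  (* Reversing the legs exchanges the two sides: the concrete Delta * id is the right extension for
     the opposite data, and id * Delta the left one. *)
  apply: (@coassociative_of _ _ _ (OBase B' B) hbeta alpha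
    (dagger_base bB) mh ma (pd_ha D) (pd_ah D) (pA (pdata_op D)) (pDelta (pdata_op D)) (cop (pdata_op D))) => //.
  - move=> a ha S T Y hS hT hY.
    have [hS1 hS2 _] := hS; have [hT1 hT2 _] := hT.
    apply: (cop_right_ext srop ha (semi_intertwiners_swap hT) (semi_intertwiners_swap hS)).
    move=> xi eta h g; rewrite -[LHS]/(Y ** (ket2 hbeta alpha xi ** eta)).
    rewrite -(rtpE (dp1 D)) // hY //.
    exact: (rtpE (tl (cP1 hV)) (hS2 _ g) (hT1 _ h)).
  - move=> a z ha hz; apply: (right_ext_uniq srop ha) => S T Y hS hT hY.
    have [hS1 hS2 _] := hS; have [hT1 hT2 _] := hT.
    apply: (hz T S) => [||eta xi g h]; [exact: semi_intertwiners_swap hT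
      |exact: semi_intertwiners_swap hS|].
    rewrite (rtpE (dp1 D)) // (hY _ _ h g).
    exact: esym (rtpE (tl (cP1 hV)) (hT1 _ g) (hS2 _ h)).
  - move=> a ha S T Y hS hT hY.
    have [hS1 hS2 _] := hS; have [hT1 hT2 _] := hT.
    apply: (cop_left_ext srop ha (semi_intertwiners_swap hT) (semi_intertwiners_swap hS)).
    move=> xi eta h g; rewrite -[LHS]/(Y ** (ket2 hbeta alpha xi ** eta)).
    rewrite -(rtpE (dp1 D)) // hY //.
    exact: (rtpE (tr (cP1 hV)) (hS2 _ g) (hT1 _ h)).
  - move=> a z ha hz; apply: (left_ext_uniq srop ha) => S T Y hS hT hY.
    have [hS1 hS2 _] := hS; have [hT1 hT2 _] := hT.
    apply: (hz T S) => [||eta xi g h]; [exact: semi_intertwiners_swap hT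
      |exact: semi_intertwiners_swap hS|].
    rewrite (rtpE (dp1 D)) // (hY _ _ h g).
    exact: esym (rtpE (tr (cP1 hV)) (hT1 _ g) (hS2 _ h)).
split=> //; first exact: pd_jointly_normal sr.
apply: (@coassociative_of _ _ _ (OBase B B') alpha beta
  bB ma (pd_mb D) (pd_ab D) (pd_ba D) (pA D) (pDelta D) (cop D)) => //.
- exact: cop_left_ext sr.
- exact: left_ext_uniq sr.
- exact: cop_right_ext sr.
- exact: right_ext_uniq sr.
Qed.
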